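(* Let $X=x$, $Z=z$, and let $P_Y^A=P_{Y|X}(\cdot|x)$, $P_Y^B=\tilde P_{Y|Z}(\cdot|z)$ be the targets of the encoder (party $A$) and decoder (party $B$), with proposal $Q_Y$ and constant $\omega$ such that $P_Y^A(y)/Q_Y(y)\le\omega$ and $P_Y^B(y)/Q_Y(y)\le\omega$ for all $y$ (and all values $z$ of $Z$). Let $K_A=\mathrm{ERS}(W;P_Y^A,Q_Y)$, $K_B=\mathrm{ERS}(W;P_Y^B,Q_Y)$, $Y_A=Y_{K_A}$, $Y_B=Y_{K_B}$, in the communication setup described in the context. Then for every batch size $N\ge 2$, $$\Pr\big(Y_A=Y_B\mid Y_A=y,X=x,Z=z\big)\ \ge\ \left(1+\mu_1'(N)+\frac{P_Y^A(y)}{P_Y^B(y)}\big(1+\mu_2'(N)\big)\right)^{-1},$$ where $$\mu_1'(N)=\frac1N\Big[\omega+\omega\,\mathbb I_N(\omega,2)\,d_2(Q_Y\|P_Y^B)+\frac{\omega^2}{N-1}d_2(Q_Y\|P_Y^B)\Big],$$ $$\mu_2'(N)=\frac1N\Big[\omega+\omega\,\mathbb I_N(\omega,2)\,d_2(Q_Y\|P_Y^A)+\frac{\omega^2}{N-1}d_2(Q_Y\|P_Y^A)\Big].$$ In particular, if $d_2(Q_Y\|P_Y^A)$ and $d_2(Q_Y\|P_Y^B)$ are finite, then $\mu_1'(N),\mu_2'(N)\to0$ as $N\to\infty$ with rate $N^{-1}$.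
   Context: Distributions are identified with densities (or mass functions) with respect to a common reference measure. $d_2(Q\|P)=\mathbb{E}_{Y\sim Q}[Q(Y)/P(Y)]$, and $\mathbb I_N(\omega,i)=2\cdot\mathbf 1_{N>i}+\omega\cdot\mathbf 1_{N=i}$. The bound is read as trivial ($0$) when a quantity in it is infinite. Common randomness: $W=\{(B_1,U_1),(B_2,U_2),\dots\}$, $U_i\sim\mathcal U(0,1)$, $B_i=\{(Y_{i1},S_{i1}),\dots,(Y_{iN},S_{iN})\}$ with $Y_{ij}\sim Q_Y$, $S_{ij}\sim\mathrm{Exp}(1)$, all independent. Ensemble Rejection Sampling $\mathrm{ERS}(W;P,Q_Y)$ for a target $P$ with $\omega_P=\max_yP(y)/Q_Y(y)<\infty$: process batches $i=1,2,\dots$ in order. In batch $i$ put $\lambda_{ik}=P(Y_{ik})/Q_Y(Y_{ik})$, $K_i^{\mathrm{cand}}=\arg\min_{1\le k\le N}S_{ik}/\lambda_{ik}$, $\hat Z=\sum_{k=1}^N\lambda_{ik}$, $\bar Z=\hat Z+\omega_P-\lambda_{i,K_i^{\mathrm{cand}}}$; accept if $U_i\le\hat Z/\bar Z$, otherwise go to batch $i+1$. At the first accepted batch $i$, set $K_1=i$ (batch index), $K_2=K_i^{\mathrm{cand}}$ (local index), and return the global index $K=(K_1-1)N+K_2$; write $Y_K=Y_{K_1,K_2}$. Then $Y_K\sim P$. Party $A$ uses $\omega_P=\omega_x=\max_yP_{Y|X}(y|x)/Q_Y(y)$ and party $B$ uses $\omega_P=\omega_z=\max_y\tilde P_{Y|Z}(y|z)/Q_Y(y)$.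 Distributed matching with communication: $(X,Y,Z)\sim P_{X,Y,Z}$. The encoder observes $X=x\sim P_X$, independent of $W$, and selects $Y_A=Y_{K_A}\sim P_{Y|X}(\cdot|x)$. Given $X=x,Y_A=y$, one generates $Z=z\sim P_{Z|X,Y}(\cdot|x,y)$, so that $Z-(X,Y_A)-W$ is a Markov chain. The decoder observes $Z=z$ and uses the target $\tilde P_{Y|Z}(\cdot|z)$, where $\tilde P_{Y|Z}$ is an arbitrary conditional distribution (not necessarily $P_{Y|Z}$), to select $Y_B=Y_{K_B}$ from the same $W$. *)

(* Defs.v *)
From HB Require Import structures.
From mathcomp Require Import all_boot all_order all_algebra.
From mathcomp Require Import all_classical all_reals all_analysis.

Set Implicit Arguments.
Unset Strict Implicit.
Unset Printing Implicit Defensive.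

Import Order.TTheory GRing.Theory Num.Theory.
Import numFieldNormedType.Exports.

Local Open Scope classical_set_scope.
Local Open Scope ring_scope.

Definition prob_density (R : realType) (d : measure_display)
    (T : measurableType d) (nu : {measure set T -> \bar R}) (p : T -> R) :=
  [/\ measurable_fun setT p, forall y, 0 <= p y &
      (\int[nu]_y (p y)%:E = 1)%E].

Definition cond_density (R : realType) (d d' : measure_display)
    (T : measurableType d) (T' : measurableType d')
    (nu : {measure set T -> \bar R}) (p : T' -> T -> R) :=
  measurable_fun setT (fun u : T' * T => p u.1 u.2) /\
  forall x, prob_density nu (p x).

(* Extended-real division: a / 0 = +oo for a > 0 and 0 / 0 = 0. *)
Definition dratio (R : realType) (T : Type) (p q : T -> R) (y : T) : \bar R :=
  ((p y)%:E / (q y)%:E)%E.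

(* d_2(Q || P) = E_{Y ~ Q}[Q(Y) / P(Y)]; equal to +oo as soon as P vanishes on
   a set of positive Q-probability. *)
Definition d2 (R : realType) (d : measure_display) (T : measurableType d)
    (nu : {measure set T -> \bar R}) (q p : T -> R) : \bar R :=
  (\int[nu]_y ((q y)%:E * dratio q p y))%E.

Definition II (R : realType) (N : nat) (omega : R) (i : nat) : R :=
  2 * (i < N)%N%:R + omega * (N == i)%N%:R.

Definition mu' (R : realType) (d : measure_display) (T : measurableType d)
    (nu : {measure set T -> \bar R}) (q p : T -> R) (omega : R) (N : nat)
    : \bar R :=
  ((N%:R^-1)%:E *
   (omega%:E + (omega * II N omega 2)%:E * d2 nu q p
    + (omega ^+ 2 / (N.-1)%:R)%:E * d2 nu q p))%E.

(* When d2 is +oo, or when pB y = 0 < pA y, the inverted quantity is +oo and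
   the bound is 0. *)
Definition matching_bound (R : realType) (d : measure_display)
    (T : measurableType d) (nu : {measure set T -> \bar R}) (q pA pB : T -> R)
    (omega : R) (N : nat) (y : T) : \bar R :=
  ((1 + mu' nu q pB omega N
    + dratio pA pB y * (1 + mu' nu q pA omega N))^-1)%E.

(* A realization of W with batch size n.+1: batch i is the pair (B_i, U_i),
   and B_i k = (Y_ik, S_ik). Batches and local indices are counted from 0. *)
Definition batches (R : realType) (T : Type) (n : nat) : Type :=
  nat -> ('I_n.+1 -> T * R) * R.

Section ERS.
Context {R : realType} {T : Type} {n : nat}.
Implicit Types (p q : T -> R) (B : 'I_n.+1 -> T * R) (w : batches R T n).

Definition weight p q (y : T) : R := fine (dratio p q y).

Definition omegaP p q : R := fine (ereal_sup (range (dratio p q))).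

(* The quotient is taken in \bar R so that proposals of weight 0 get +oo. *)
Definition ers_cand p q B : 'I_n.+1 :=
  [arg min_(k < ord0) ((B k).2%:E / dratio p q (B k).1)%E]%O.

Definition ers_Zhat p q B : R := \sum_(k < n.+1) weight p q (B k).1.

Definition ers_Zbar p q B : R :=
  ers_Zhat p q B + omegaP p q - weight p q (B (ers_cand p q B)).1.

Definition ers_accept p q (b : ('I_n.+1 -> T * R) * R) : bool :=
  b.2 <= ers_Zhat p q b.1 / ers_Zbar p q b.1.

(* The pair (K_1, K_2), which encodes the global index K_1 * n.+1 + K_2.
   If no batch is accepted (a null event) the value (0, 0) is a dummy. *)
Definition ERS w p q : nat * 'I_n.+1 :=
  match pselect (exists i, ers_accept p q (w i)) with
  | left h => let i := ex_minn h in (i, ers_cand p q (w i).1)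
  | right _ => (0%N, ord0)
  end.

Definition sample_at w (K : nat * 'I_n.+1) : T := ((w K.1).1 K.2).1.

Definition ERS_sample w p q : T := sample_at w (ERS w p q).

End ERS.

Definition mutually_independent (R : realType) (d : measure_display)
    (Omega : measurableType d) (P : probability Omega R) (I : eqType)
    (F : I -> set_system Omega) :=
  forall (J : seq I) (E : I -> set Omega), uniq J ->
    (forall i, i \in J -> F i (E i)) ->
    P (\bigcap_(i in [set` J]) E i) = (\prod_(i <- J) P (E i))%E.

Section common_randomness.
Context {R : realType} {d dY : measure_display} {Omega : measurableType d}
  {TY : measurableType dY} {P : probability Omega R} {n : nat}.
Implicit Types (Y : nat -> 'I_n.+1 -> {RV P >-> TY})
  (S : nat -> 'I_n.+1 -> {RV P >-> R}) (U : nat -> {RV P >-> R}).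

Definition W_of Y S U (w : Omega) : batches R TY n :=
  fun i => (fun k => (Y i k w, S i k w), U i w).

(* The sigma-algebras generated by the individual variables Y_ik, S_ik, U_i. *)
Definition W_components Y S U
    (s : (nat * 'I_n.+1) + (nat * 'I_n.+1) + nat) : set_system Omega :=
  match s with
  | inl (inl ik) => g_sigma_algebra_preimage (Y ik.1 ik.2)
  | inl (inr ik) => g_sigma_algebra_preimage (S ik.1 ik.2)
  | inr i => g_sigma_algebra_preimage (U i)
  end.

Definition sigma_W Y S U : set_system Omega :=
  <<s \bigcup_s W_components Y S U s >>.

Definition common_randomness (nu : {measure set TY -> \bar R}) (q : TY -> R)
    Y S U :=
  [/\ forall i k A, measurable A ->
        distribution P (Y i k) A = (\int[nu]_(y in A) (q y)%:E)%E,
      forall i k A, measurable A ->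
        distribution P (S i k) A = exponential_prob 1 A,
      forall i A, measurable A ->
        distribution P (U i) A = uniform_prob (@ltr01 R) A &
      mutually_independent P (W_components Y S U)].

Definition indep_of_W (dX : measure_display) (TX : measurableType dX)
    (X : {RV P >-> TX}) Y S U :=
  forall A E, g_sigma_algebra_preimage X A -> sigma_W Y S U E ->
    P (A `&` E) = (P A * P E)%E.

Definition sigma_XW (dX : measure_display) (TX : measurableType dX)
    (X : {RV P >-> TX}) Y S U : set_system Omega :=
  <<s g_sigma_algebra_preimage X `|` sigma_W Y S U >>.

(* Given (X, W), the law of Z is kappa (X, Y_A, .): this says both that
   Z ~ kappa (x, y, .) given X = x, Y_A = y and that Z - (X, Y_A) - W is a
   Markov chain. *)
Definition generated_from (dX dZ : measure_display) (TX : measurableType dX)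
    (TZ : measurableType dZ) (kappa : R.-pker (TX * TY)%type ~> TZ)
    (X : {RV P >-> TX}) (YA : Omega -> TY) (Z : {RV P >-> TZ}) Y S U :=
  forall E D, sigma_XW X Y S U E -> measurable D ->
    P (E `&` Z @^-1` D) = (\int[P]_(w in E) kappa (X w, YA w) D)%E.

End common_randomness.

(* g is a version of t |-> P (E | V = t). *)
Definition cond_prob_version (R : realType) (d d' : measure_display)
    (Omega : measurableType d) (T : measurableType d') (P : probability Omega R)
    (E : set Omega) (V : Omega -> T) (g : T -> R) :=
  measurable_fun setT g /\
  forall C, measurable C ->
    (\int[P]_(w in V @^-1` C) (g (V w))%:E = P (E `&` V @^-1` C))%E.

(* Main.v *)
Require Import Defs.
From HB Require Import structures.
From mathcomp Require Import all_boot all_order all_algebra.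
From mathcomp Require Import all_classical all_reals all_analysis.
From mathcomp Require Import measurable_realfun.
From mathcomp Require Import ring lra.

(* It is enough to bound below the probability that both parties accept the
   same entry of the very first batch. Given that entry k of this batch has the
   value y, put a = P_A(y)/Q(y), b = P_B(y)/Q(y), and let a_j, b_j be the weights
   of the other entries. Entry k wins both exponential races with probability
   1 / (1 + sum_j max (a_j/a, b_j/b)), and the uniform variable accepts it for
   both parties with probability
   min ((a + sum_j a_j) / (omega_A + sum_j a_j),
        (b + sum_j b_j) / (omega_B + sum_j b_j)).
   The inverse of the product of these two quantities is at most X_A + X_B, where
   X_A = (sum_j a_j + omega + omega (a + sum_j a_j) / (b + sum_j b_j)) / a and
   X_B is symmetric. The mean ratio in X_A is controlled by d_2(Q || P_B) through
   the inequality between arithmetic and harmonic means, and Jensen's inequality,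
   in the tangent form 1/x >= 2 t - t^2 x, turns the resulting bound on the mean
   of X_A + X_B into N^-1 a times the claimed bound. Summing over the N entries
   and integrating y shows that, for every event F in (Y_A, X, Z), the
   probability of F with Y_A = Y_B is at least the integral over F of the claimed
   bound, because Y_A has density P_A. *)

(** Giving up all later batches is cheap: the loss enters through (omega_A - a) / (a + sum_j a_j)
    and its analogue for B, which are of order omega / N and are absorbed by mu'. The obstacle is
    that Z is drawn from Y_A, which is a function of all of W, so W cannot be averaged with Z held
    fixed. On a match at entry k of the first batch, however, Y_A is the value y of that entry.
    There the law of Z is the kernel at y, and both y and z can be frozen before the other variables
    are averaged. A conditional probability given (Y_A, X, Z) is determined only up to null sets.
    This is why the estimate is first proved in integrated form, over an arbitrary event F, and only
    then transferred to an arbitrary version. Independence is used through sub-sigma-algebras of the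
    given probability space: to be a function of certain variables means to be measurable for the
    sigma-algebra that they generate. *)

Set Implicit Arguments.
Unset Strict Implicit.
Unset Printing Implicit Defensive.

Import Order.TTheory GRing.Theory Num.Theory.
Import numFieldNormedType.Exports.

Local Open Scope classical_set_scope.
Local Open Scope ring_scope.

(** * Kernels, disintegration and densities *)

Section kernels.
Context {R : realType} {d0 d1 d2 : measure_display} {T0 : measurableType d0}
  {T1 : measurableType d1} {T2 : measurableType d2}.

Section pull.
Variables (k : R.-pker T1 ~> T2) (f : T0 -> T1).

(** The measurability proof is an argument so that the kernel instances below attach to the term
    [kpull mf] itself. *)
Definition kpull (mf : measurable_fun setT f) (t : T0) :
  {measure set T2 -> \bar R} := k (f t).

Hypothesis mf : measurable_fun setT f.

Let measurable_kpull U : measurable U ->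
  measurable_fun [set: T0] (kpull mf ^~ U).
Proof. by move=> mU; exact: measurableT_comp (measurable_kernel k U mU) mf. Qed.

HB.instance Definition _ := isKernel.Build _ _ _ _ R (kpull mf) measurable_kpull.

Let kpull_prob t : kpull mf t [set: T2] = 1%E.
Proof. exact: prob_kernel. Qed.

HB.instance Definition _ :=
  Kernel_isProbability.Build _ _ _ _ R (kpull mf) kpull_prob.
End pull.

Section cst.
Variables (m : probability T2 R).

Definition kcst (t : T0) : {measure set T2 -> \bar R} := m.

Let measurable_kcst U : measurable U -> measurable_fun [set: T0] (kcst ^~ U).
Proof. by move=> mU; exact: measurable_cst. Qed.

HB.instance Definition _ := isKernel.Build _ _ _ _ R kcst measurable_kcst.

Let kcst_prob t : kcst t [set: T2] = 1%E.
Proof. exact: probability_setT. Qed.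

HB.instance Definition _ := Kernel_isProbability.Build _ _ _ _ R kcst kcst_prob.
End cst.

Section graph.
Variable k : R.-pker T1 ~> T2.

(** The law of (y, V), where y is [t.2] and V is drawn from [k y]; the product domain is the shape
    that [kcomp] expects. *)
Definition kgraph (t : T0 * T1) : {measure set (T1 * T2) -> \bar R} :=
  measure_function_pushforward__canonical__measure_function_Measure
    (k t.2) (pair1_measurable t.2).

Let measurable_kgraph U : measurable U ->
  measurable_fun [set: T0 * T1] (kgraph ^~ U).
Proof.
move=> mU; rewrite (_ : kgraph ^~ U = (fun y => k y (xsection U y)) \o snd).
  apply: measurableT_comp => //.
  by apply: measurable_fun_xsection_finite_kernel; rewrite inE.
by apply/funext => -[u y]; rewrite /kgraph /= /pushforward xsectionE.
Qed.

HB.instance Definition _ := isKernel.Build _ _ _ _ R kgraph measurable_kgraph.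

Let kgraph_prob t : kgraph t setT = 1%E.
Proof. by rewrite /kgraph /= /pushforward preimage_setT prob_kernel. Qed.

HB.instance Definition _ :=
  Kernel_isProbability.Build _ _ _ _ R kgraph kgraph_prob.
End graph.
End kernels.

Section disintegration.
Context {R : realType} {d d1 d2 : measure_display} {Om : measurableType d}
  {T1 : measurableType d1} {T2 : measurableType d2}.
Variables (P : probability Om R) (V1 : Om -> T1) (V2 : Om -> T2).
Hypotheses (mV1 : measurable_fun setT V1) (mV2 : measurable_fun setT V2).
Local Open Scope ereal_scope.

(** The hypothesis fixes the law of ([V1], [V2]) on rectangles, a pi-system that generates the
    product sigma-algebra. Hence this law is the composition of the law of [V1] with the graph of
    [k], and integrals against it iterate. *)
Lemma disintegration (k : R.-pker T1 ~> T2) :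
  (forall E D, measurable E -> measurable D ->
    P (V1 @^-1` E `&` V2 @^-1` D) = \int[P]_(w in V1 @^-1` E) k (V1 w) D) ->
  forall f : T1 * T2 -> \bar R, measurable_fun setT f -> (forall t, 0 <= f t) ->
  \int[P]_w f (V1 w, V2 w) = \int[P]_w \int[k (V1 w)]_v f (V1 w, v).
Proof.
move=> H f mf f0.
have mV : measurable_fun setT (fun w => (V1 w, V2 w)) by exact: measurable_fun_pair.
pose P1 : probability T1 R := distribution P (mfun_Sub (mem_set mV1)).
have P1E A : P1 A = P (V1 @^-1` A) by [].
pose l : R.-pker unit ~> T1 := kcst P1.
pose g : R.-pker (unit * T1)%type ~> (T1 * T2)%type := kgraph k.
have E1 : \int[P]_w f (V1 w, V2 w) = \int[kcomp l g tt]_t f t.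
  transitivity (\int[pushforward P (fun w => (V1 w, V2 w))]_t f t).
    by rewrite ge0_integral_pushforward.
  apply: eq_measure_integral => A mA _.
  pose C := [set A `*` B | A in @measurable _ T1 & B in @measurable _ T2].
  apply: (measure_unique C (fun=> setT)) => //.
  - by rewrite measurable_prod_measurableType.
  - move=> _ _ [X1 mX1 [X2 mX2 <-]] [Y1 mY1 [Y2 mY2 <-]].
    exists (X1 `&` Y1); first exact: measurableI.
    by exists (X2 `&` Y2); [exact: measurableI|rewrite setXI].
  - by move=> _; exists setT => //; exists setT => //; rewrite setXTT.
  - by rewrite bigcup_const.
  - move=> _ [A1 mA1 [A2 mA2 <-]]; rewrite /= /kcomp /= /kcst.
    rewrite /pushforward [LHS](H A1 A2)//.
    rewrite integral_mkcond ge0_integral_distribution//=; last first.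
      have := measurable_kernel g (A1 `*` A2) (measurableX mA1 mA2).
      exact: (measurable_fun_pair2).
    apply: eq_integral => w _ /=; rewrite patchE /kgraph /pushforward /=.
    case: ifPn => [|]; rewrite ?inE ?notin_setE /preimage/= => A1w.
      by congr (k _ _); apply/seteqP; split => t //= -[].
    by rewrite (_ : [set t | _] = set0) ?measure0//; apply/seteqP; split => t //= -[].
  - by move=> _; rewrite /= /pushforward preimage_setT probability_setT ltry.
rewrite E1 integral_kcomp// /l /= /kcst ge0_integral_distribution//=; last 2 first.
- apply: measurable_fun_integral_kernel => // U mU.
  exact: measurable_fun_pair2 (measurable_kernel g U mU).
- by move=> y; exact: integral_ge0.
apply: eq_integral => w _; rewrite /kgraph /= ge0_integral_pushforward//.
Qed.
End disintegration.

Section density.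
Context {R : realType} {d : measure_display} {T : measurableType d}.
Variables (mu m : {measure set T -> \bar R}) (g : T -> R).
Hypotheses (mg : measurable_fun setT g) (g0 : forall y, 0 <= g y).
Hypothesis mE : forall A, measurable A -> (m A = \int[mu]_(y in A) (g y)%:E)%E.
Local Open Scope ereal_scope.

Let density_indic A : measurable A ->
  \int[m]_y (\1_A y)%:E = \int[mu]_y ((\1_A y)%:E * (g y)%:E).
Proof.
move=> mA; rewrite integral_indic// setIT mE// integral_mkcond.
apply: eq_integral => y _; rewrite patchE indicE.
by case: (y \in A); rewrite ?mul1e ?mul0e.
Qed.

Import HBNNSimple.

Let density_nnsfun (f : {nnsfun T >-> R}) :
  \int[m]_y (f y)%:E = \int[mu]_y ((f y)%:E * (g y)%:E).
Proof.
under [LHS]eq_integral do rewrite fimfunE -fsumEFin//.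
rewrite [LHS]ge0_integral_fsum//; last 2 first.
  - by move=> r; exact/measurable_EFinP/measurableT_comp.
  - by move=> r x _; rewrite EFinM nnfun_muleindic_ge0.
have fg y : (f y)%:E * (g y)%:E =
    \sum_(r \in range f) (r * \1_(f @^-1` [set r]) y)%:E * (g y)%:E.
  rewrite {1}fimfunE -fsumEFin// ge0_mule_fsuml// => r.
  by rewrite EFinM nnfun_muleindic_ge0.
under [RHS]eq_integral do rewrite fg.
rewrite [RHS]ge0_integral_fsum//; last 2 first.
  - move=> r; apply: emeasurable_funM; last exact/measurable_EFinP.
    exact/measurable_EFinP/measurableT_comp.
  - move=> r x _; apply: mule_ge0; last by rewrite lee_fin.
    by rewrite EFinM nnfun_muleindic_ge0.
(* The constant r leaves the integral when it is nonnegative; a nonnegative simple function has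
   empty fibres over negative r, so there both sides vanish. *)
apply: eq_fsbigr => r _; have [r0|r0] := leP 0%R r.
- under eq_integral do rewrite EFinM.
  rewrite ge0_integralZl//; last exact/measurable_EFinP/measurable_indic.
  under [RHS]eq_integral do rewrite EFinM -muleA.
  rewrite [RHS]ge0_integralZl//; last 2 first.
    apply: emeasurable_funM; last exact/measurable_EFinP.
    exact/measurable_EFinP/measurable_indic.
    by move=> x _; rewrite mule_ge0// lee_fin.
  by rewrite density_indic.
- rewrite !integral0_eq// => y _; by rewrite preimage_nnfun0// indic0 mulr0 ?mul0e.
Qed.

(** The usual ascent from indicators through simple functions to monotone limits, with one
    approximating sequence for both integrals. *)
Lemma ge0_integral_density (f : T -> \bar R) :
  measurable_fun setT f -> (forall y, 0 <= f y) ->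
  \int[m]_y f y = \int[mu]_y (f y * (g y)%:E).
Proof.
move=> mf f0; pose f_ := nnsfun_approx measurableT mf.
transitivity (limn (fun n => \int[m]_y (f_ n y)%:E)).
  rewrite -monotone_convergence//=.
  - apply: eq_integral => y _; apply/esym/cvg_lim => //=.
    exact: cvg_nnsfun_approx.
  - by move=> n; exact/measurable_EFinP.
  - by move=> n y _; rewrite lee_fin.
  - by move=> y _ a b ab; rewrite lee_fin; exact/lefP/nd_nnsfun_approx.
transitivity (limn (fun n => \int[mu]_y ((f_ n y)%:E * (g y)%:E))).
  by congr (limn _); apply/funext => n; exact: density_nnsfun.
rewrite -monotone_convergence//=.
- apply: eq_integral => y _; apply/cvg_lim => //=.
  by apply: cvgeZr => //; exact: cvg_nnsfun_approx.
- by move=> n; apply: emeasurable_funM; exact/measurable_EFinP.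
- by move=> n y _; rewrite mule_ge0// lee_fin.
- move=> y _ a b ab; apply: lee_wpmul2r; rewrite lee_fin//.
  exact/lefP/nd_nnsfun_approx.
Qed.
End density.

Section inverse.
Context {R : realType}.

Lemma measurable_invr : measurable_fun [set: R] (GRing.inv : R -> R).
Proof.
have mD : measurable [set x : R | x != 0] by apply: open_measurable.
rewrite (_ : setT = [set x : R | x != 0] `|` [set 0]); last first.
  by apply/seteqP; split => x //= _; case: (eqVneq x 0); [right|left].
apply/measurable_funU => //; split; last exact: measurable_fun_set1.
apply: open_continuous_measurable_fun => //; apply/in_setP => x /= x0.
exact: inv_continuous.
Qed.

Lemma measurable_inve : measurable_fun [set: \bar R] (@inve R).
Proof.
rewrite (_ : @inve R = fun x => if x == +oo%E then 0%E else
  if x == -oo%E then -oo%E else if x == 0%E then +oo%E else ((fine x)^-1)%:E).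
  do 3 (apply: measurable_fun_ifT => //; first exact: measurable_fun_eqe).
  apply/measurable_EFinP; apply: measurableT_comp measurable_invr _.
  exact: fine_measurable.
by apply/funext => -[x||] //=; rewrite inver eqe.
Qed.
End inverse.

(** * Consequences of independence *)

Section independence.
Context {R : realType} {d : measure_display} {Om : measurableType d}
  {P : probability Om R} {I : eqType} {F : I -> set_system Om}.
Hypothesis FT : forall i, F i setT.
Hypothesis FI : forall i, setI_closed (F i).
Hypothesis mF : forall i, F i `<=` measurable.
Hypothesis indF : mutually_independent P F.
Local Open Scope ereal_scope.

Let G s := [set E | exists J : seq I, exists A : I -> set Om,
  [/\ uniq J, s \notin J, forall i, i \in J -> F i (A i) &
      E = \bigcap_(i in [set` J]) A i]].

Let setIG s : setI_closed (G s).
Proof.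
move=> _ _ [J1 [A1 [u1 s1 F1 ->]]] [J2 [A2 [u2 s2 F2 ->]]].
exists (undup (J1 ++ J2)), (fun i => (if i \in J1 then A1 i else setT) `&`
                     (if i \in J2 then A2 i else setT)); split.
- exact: undup_uniq.
- by rewrite mem_undup mem_cat negb_or s1 s2.
- by move=> i _; apply: FI; case: ifPn => // iJ; [exact: F1|exact: F2].
- apply/seteqP; split => [w [w1 w2] i /= |w H].
    rewrite mem_undup mem_cat => _.
    by split; case: ifPn => // iJ; [exact: w1|exact: w2].
  split=> i /= iJ.
    have := H i; rewrite /= mem_undup mem_cat iJ => /(_ isT)[+ _].
    by [].
  by have := H i; rewrite /= mem_undup mem_cat iJ orbT => /(_ isT)[_].
Qed.

(** Finite intersections of events carried by components other than [s] form the pi-system [G s].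
    Mutual independence gives the product formula on it, and uniqueness of measures extends the
    formula to the generated sigma-algebra. *)
Lemma independent_of_others s E D :
  <<s \bigcup_(i in [set~ s]) F i >> E -> F s D ->
  P (E `&` D) = P E * P D.
Proof.
move=> sE FD; have mD := mF FD.
have PD : P D \is a fin_num by exact: fin_num_measure.
have PD0 : (0 <= fine (P D))%R by exact: fine_ge0.
have Gm : G s `<=` measurable.
  move=> _ [J [A [uJ sJ FA ->]]].
  by apply: fin_bigcap_measurable => // i /FA; exact: mF.
have GT : G s setT.
  by exists [::], (fun=> setT); split => //; apply/seteqP; split.
have cE : (NngNum PD0)%:num%:E = P D by rewrite -[RHS]fineK.
(* As functions of [E], the two sides are finite measures: [P] restricted to [D], and [P] scaled by
   [P D]. *)
suff : forall E, <<s G s >> E -> mrestr P mD E = mscale (NngNum PD0) P E.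
  move=> /(_ E); rewrite /mrestr /mscale cE muleC => -> //.
  apply: sub_sigma_algebra2 sE => A [i si FA].
  exists [:: i], (fun=> A); split => //.
  - by rewrite inE eq_sym; exact/eqP.
  - by move=> j; rewrite inE => /eqP ->.
  - by apply/seteqP; split => [w Aw j _//|w]; apply => /=; rewrite inE.
apply: (g_sigma_algebra_measure_unique (G s) Gm (fun=> setT)) => //.
- by rewrite bigcup_const.
- move=> _ [J [A [uJ sJ FA ->]]]; rewrite /= /mrestr /mscale cE.
  have := indF (J := s :: J) (E := fun i => if i == s then D else A i).
  rewrite /= sJ => /(_ uJ) H.
  rewrite indF// muleC -[LHS](_ : P (\bigcap_(i in [set` s :: J])
    (if i == s then D else A i)) = _); last first.
    congr (P _); apply/seteqP; split => [w H' |w [H1 Dw] i /=].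
      split; last by have := H' s; rewrite /= eqxx; apply; rewrite inE eqxx.
      move=> i /= iJ; have := H' i; rewrite /= inE iJ orbT => /(_ isT).
      by case: eqP iJ sJ => // -> ->.
    by rewrite inE; case: eqP => //= _ iJ; exact: H1.
  rewrite H.
    rewrite big_cons eqxx muleC; congr (_ * _).
    apply: eq_big_seq => i iJ; case: eqP iJ sJ => // -> -> //.
  by move=> i; rewrite inE; case: eqP => [->//|_ /=]; exact: FA.
- by move=> _; rewrite /= /mrestr setTI -ge0_fin_numE.
Qed.

End independence.

(** * Exponential and uniform laws *)

Section laws.
Context {R : realType}.

(** [b] treats the closed and the open half-line together, because both weak and strict races are
    needed. The threshold may be negative, hence the maximum with 0. *)
Lemma exponential_tail b (u : R) :
  exponential_prob 1 [set` Interval (BSide b u) +oo%O] =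
  (expR (- Num.max u 0))%:E.
Proof.
have mpdf D : measurable D ->
    measurable_fun D (EFin \o exponential_pdf (1 : R)).
  by move=> mD; apply/measurable_EFinP/measurable_funTS;
    exact: measurable_exponential_pdf.
rewrite /exponential_prob.
transitivity (\int[lebesgue_measure]_(x in `[u, +oo[) (exponential_pdf 1 x)%:E)%E.
  case: b => //; rewrite [in LHS]integral_itv_obnd_cbnd//.
  exact: mpdf.
have FTC (v : R) : 0 <= v ->
    (\int[lebesgue_measure]_(x in `[v, +oo[) (exponential_pdf 1 x)%:E =
     (expR (- v))%:E)%E.
  move=> v0.
  have cexp : continuous (fun x : R^o => - expR (- x)).
    move=> x; apply: cvgN; apply: continuous_comp; last exact: continuous_expR.
    by apply: cvgN; exact: cvg_id.
  rewrite (@ge0_continuous_FTC2y _ _ (fun x => - expR (- x)) _ 0)//.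
  - by rewrite sub0e EFinN oppeK.
  - by move=> x _; exact: exponential_pdf_ge0.
  - apply: (continuous_subspaceW _ (@within_continuous_exponential_pdf R 1)).
    by move=> x /=; rewrite !in_itv/= !andbT; exact: le_trans.
  - rewrite -oppr0; apply: cvgN; exact: cvgr_expR.
  - exact/cvg_at_right_filter/cexp.
  - move=> x; rewrite in_itv/= andbT => vx.
    have := @derive1_exponential_pdf R 1 x; rewrite in_itv/= andbT.
    move=> /(_ (le_lt_trans v0 vx)) <-.
    by congr (derive1 _ x); apply/funext => z; rewrite mulN1r.
have [u0|u0] := leP 0 u; first exact: FTC.
(* For u < 0 the tail lies between the tail from 0 and the total mass, and both equal 1. *)
rewrite oppr0 expR0.
apply/eqP; rewrite eq_le; apply/andP; split.
  rewrite -(@integral_exponential_pdf R 1)//.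
  apply: ge0_subset_integral => //; first exact: mpdf.
  by move=> x _; rewrite lee_fin exponential_pdf_ge0.
have -> : 1%:E = (expR (- 0 : R))%:E by rewrite oppr0 expR0.
rewrite -FTC//; apply: ge0_subset_integral => //; first exact: mpdf.
- by move=> x _; rewrite lee_fin exponential_pdf_ge0.
- by move=> x /=; rewrite !in_itv/= !andbT; exact/le_trans/ltW.
Qed.

(** Tilting the density of rate 1 by exp (- c x) gives (1 + c)^-1 times the density of rate 1 + c.
    The positive part of s is the form in which the tails of the rivals in a race present the
    exponent. *)
Lemma exponential_laplace (d : measure_display) (Om : measurableType d)
    (P : probability Om R) (X : {RV P >-> R}) (c : R) :
  (forall A, measurable A -> distribution P X A = exponential_prob 1 A) ->
  0 <= c ->
  (\int[distribution P X]_s (expR (- (Num.max s 0 * c)))%:E =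
   ((1 + c)^-1)%:E)%E.
Proof.
move=> XE c0; have r0 : 0 < 1 + c by rewrite ltr_pwDl.
have mL : measurable_fun [set: R] (fun s : R => (expR (- (Num.max s 0 * c)))%:E).
  apply/measurable_EFinP; apply: measurableT_comp => //.
  apply: measurable_funN; apply: measurable_funM => //.
  exact: measurable_maxr.
rewrite ge0_integral_distribution//.
(* Lebesgue measure lives on measurableTypeR, whose display differs from that of R *)
have mX : @measurable_fun _ _ Om (measurableTypeR R) setT X.
  exact: (measurable_funPT X).
have -> : (\int[P]_x ((fun s => (expR (- (Num.max s 0 * c)))%:E) \o X) x =
   \int[pushforward P (X : Om -> measurableTypeR R)]_s
     (expR (- (Num.max s 0 * c)))%:E)%E.
  by rewrite ge0_integral_pushforward.
rewrite (@ge0_integral_density _ _ _ lebesgue_measure _ (exponential_pdf 1))//.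
- transitivity (\int[lebesgue_measure]_x
      ((1 + c)^-1%:E * (exponential_pdf (1 + c) x)%:E))%E.
    apply: eq_integral => x _; rewrite -!EFinM; congr (_%:E).
    have [x0|x0] := leP 0 x; last by rewrite !lt0_exponential_pdf// !mulr0.
    rewrite !exponential_pdfE//= mul1r mulrA mulVf ?gt_eqF//.
    by rewrite mul1r -expRD; congr expR; rewrite mulN1r mulNr mulrDl mul1r opprD addrC mulrC.
  rewrite ge0_integralZl//.
  - by rewrite integral_exponential_pdf// mule1.
  - by apply/measurable_EFinP; exact: measurable_exponential_pdf.
  - by move=> x _; rewrite lee_fin exponential_pdf_ge0// ltW.
  - by rewrite lee_fin invr_ge0 ltW.
- exact: measurable_exponential_pdf.
- by move=> x; exact: exponential_pdf_ge0.
Qed.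

Lemma uniform_cdf (t : R) : 0 <= t <= 1 ->
  uniform_prob (@ltr01 R) `]-oo, t] = t%:E.
Proof.
move=> /andP[t0 t1]; rewrite /uniform_prob integral_uniform_pdf.
rewrite (_ : _ `&` _ = `[0, t]%classic); last first.
  apply/seteqP; split => x /=; rewrite !in_itv/=.
    by move=> [-> /andP[->]].
  by move=> /andP[-> xt]; split => //=; exact: le_trans t1.
rewrite (eq_integral (cst 1%E)); last first.
  move=> x; rewrite inE/= in_itv/= /uniform_pdf => /andP[-> xt].
  by rewrite (le_trans xt t1) subr0 invr1.
rewrite integral_cst//= mul1e lebesgue_measure_itv/= lte_fin.
by case: ltP => [_|t0']; [rewrite -EFinB subr0|congr EFin; apply/le_anti/andP].
Qed.

End laws.

Lemma measurable_side {R : realType} {d : measure_display}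
    {T : measurableType d} b (x y : T -> R) :
  measurable_fun setT x -> measurable_fun setT y ->
  measurable_fun setT (fun t => (x t \in Interval (BSide b (y t)) +oo%O)%:R : R).
Proof.
move=> mx my; apply: (@measurableT_comp _ _ _ _ _ _ (fun b : bool => b%:R : R)) => //.
rewrite (_ : (fun t => _) = fun t => if b then y t <= x t else y t < x t).
  case: b; first exact: measurable_fun_ler.
  exact: measurable_fun_ltr.
by apply/funext => t; rewrite in_itv/= andbT; case: b.
Qed.

Lemma measurable_sum_cond {R : realType} {d : measure_display}
    {T : measurableType d} (I : Type) (s : seq I) (p : pred I) (h : I -> T -> R) :
  (forall i, p i -> measurable_fun setT (h i)) ->
  measurable_fun setT (fun x => \sum_(i <- s | p i) h i x).
Proof.
move=> mh; rewrite (_ : (fun x => _) =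
  fun x => \sum_(i <- s) (if p i then h i x else 0)); last first.
  by apply/funext => x; rewrite big_mkcond.
apply: measurable_sum => i; case: (boolP (p i)) => [/mh//|_].
exact: measurable_cst.
Qed.

Lemma measurable_prod_cond {R : realType} {d : measure_display}
    {T : measurableType d} (I : eqType) (s : seq I) (p : pred I) (h : I -> T -> R) :
  (forall i, p i -> measurable_fun setT (h i)) ->
  measurable_fun setT (fun x => \prod_(i <- s | p i) h i x).
Proof.
move=> mh; rewrite (_ : (fun x => _) =
  fun x => \prod_(i <- s) (if p i then h i x else 1)); last first.
  by apply/funext => x; rewrite big_mkcond.
apply: measurable_prod => i _; case: (boolP (p i)) => [/mh//|_].
exact: measurable_cst.
Qed.

(** * Integrating out one component of the common randomness *)

Section components.
Context {R : realType} {d dY : measure_display} {Om : measurableType d}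
  {TY : measurableType dY} {P : probability Om R} {n : nat}
  {nu : {measure set TY -> \bar R}} {q : TY -> R}
  {Y : nat -> 'I_n.+1 -> {RV P >-> TY}}
  {S : nat -> 'I_n.+1 -> {RV P >-> R}} {U : nat -> {RV P >-> R}}.
Hypothesis crW : common_randomness nu q Y S U.
Local Notation W_ := (W_components Y S U).
Notation comp := ((nat * 'I_n.+1) + (nat * 'I_n.+1) + nat)%type.
Implicit Types s : comp.

(* Om equipped with the sigma-algebra generated by all the variables but s *)
Definition others s := g_sigma_algebraType (\bigcup_(s' in [set~ s]) W_ s').

(** Measurability from [all_W] expresses that a quantity is a function of the common randomness
    alone. *)
Definition all_W := g_sigma_algebraType (\bigcup_s W_ s).

Let preimage_mem (dT : measure_display) (T : measurableType dT)
    (V : {RV P >-> T}) (A : set T) : measurable A ->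
  g_sigma_algebra_preimage V (V @^-1` A).
Proof. by move=> mA; exists A => //; rewrite setTI. Qed.

Lemma measurable_Y_others s i k : s <> inl (inl (i, k)) ->
  measurable_fun setT (Y i k : others s -> TY).
Proof.
move=> sik _ A mA; rewrite setTI; apply: sub_sigma_algebra.
by exists (inl (inl (i, k))); [by move=> /esym|exact: preimage_mem].
Qed.

Lemma measurable_S_others s i k : s <> inl (inr (i, k)) ->
  measurable_fun setT (S i k : others s -> R).
Proof.
move=> sik _ A mA; rewrite setTI; apply: sub_sigma_algebra.
by exists (inl (inr (i, k))); [by move=> /esym|exact: preimage_mem].
Qed.

Lemma measurable_U_others s i : s <> inr i ->
  measurable_fun setT (U i : others s -> R).
Proof.
move=> si _ A mA; rewrite setTI; apply: sub_sigma_algebra.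
by exists (inr i); [by move=> /esym|exact: preimage_mem].
Qed.

Lemma measurable_Y_all i k : measurable_fun setT (Y i k : all_W -> TY).
Proof.
move=> _ A mA; rewrite setTI; apply: sub_sigma_algebra.
by exists (inl (inl (i, k))) => //; exact: preimage_mem.
Qed.

Lemma measurable_S_all i k : measurable_fun setT (S i k : all_W -> R).
Proof.
move=> _ A mA; rewrite setTI; apply: sub_sigma_algebra.
by exists (inl (inr (i, k))) => //; exact: preimage_mem.
Qed.

Lemma measurable_U_all i : measurable_fun setT (U i : all_W -> R).
Proof.
move=> _ A mA; rewrite setTI; apply: sub_sigma_algebra.
by exists (inr i) => //; exact: preimage_mem.
Qed.

Let W_measurable s : W_ s `<=` measurable.
Proof. by move: s => [[[i k]|[i k]]|i] _ [A mA <-]; exact: measurable_funPT. Qed.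

Lemma measurable_id_others s : measurable_fun setT (id : Om -> others s).
Proof.
move=> _ A mA; rewrite setTI preimage_id.
apply: smallest_sub mA; first exact: sigma_algebra_measurable.
by move=> B [s' _]; exact: W_measurable.
Qed.

Lemma measurable_id_all : measurable_fun setT (id : Om -> all_W).
Proof.
move=> _ A mA; rewrite setTI preimage_id.
apply: smallest_sub mA; first exact: sigma_algebra_measurable.
by move=> B [s' _]; exact: W_measurable.
Qed.

Local Open Scope ereal_scope.

(** Fubini without a product space: [V] is independent of the sigma-algebra of [others s], so the
    dependence on that sigma-algebra can be frozen while [V] is averaged. *)
Lemma integrate_out (dT : measure_display) (T : measurableType dT)
    (V : {RV P >-> T}) s (f : others s * T -> \bar R) :
  W_ s = g_sigma_algebra_preimage V ->
  measurable_fun setT f -> (forall t, 0 <= f t) ->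
  \int[P]_w f (w, V w) = \int[P]_w \int[distribution P V]_v f (w, v).
Proof.
move=> WV mf f0.
apply: (@disintegration _ _ _ _ _ _ _ P (id : Om -> others s) V _ _
  (kcst (distribution P V))) => //.
- exact: measurable_id_others.
- move=> E D mE mD; rewrite /kcst integral_cst; last first.
    by have := measurable_id_others measurableT mE; rewrite setTI.
  rewrite muleC; case: crW => _ _ _ ind.
  apply: (independent_of_others _ _ _ ind (s := s)).
  - by move=> [[[i k]|[i k]]|i]; exists setT => //; rewrite preimage_setT setTI.
  - move=> s' A B.
    by move: s' => [[[i k]|[i k]]|i] [A' mA' <-] [B' mB' <-];
      exists (A' `&` B'); rewrite ?preimage_setI ?setTI//; exact: measurableI.
  - exact: W_measurable.
  - exact: mE.
  - by rewrite WV; exact: preimage_mem.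
Qed.

End components.

(** * Exponential races *)

Section races.
Context {R : realType} {d dY : measure_display} {Om : measurableType d}
  {TY : measurableType dY} {P : probability Om R} {n : nat}
  {nu : {measure set TY -> \bar R}} {q : TY -> R}
  {Y : nat -> 'I_n.+1 -> {RV P >-> TY}}
  {S : nat -> 'I_n.+1 -> {RV P >-> R}} {U : nat -> {RV P >-> R}}.
Hypothesis crW : common_randomness nu q Y S U.
Local Notation others := (@others _ _ _ _ _ P n Y S U).
Local Open Scope ereal_scope.

Lemma measurable_others s (dT : measure_display) (T : measurableType dT)
  (f : Om -> T) : measurable_fun setT (f : others s -> T) -> measurable_fun setT f.
Proof.
move=> mf _ B mB; have := mf measurableT B mB.
by rewrite !setTI => /(measurable_id_others measurableT); rewrite setTI.
Qed.

Lemma integrate_U i (g : Om -> \bar R) (t : Om -> R) :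
  measurable_fun setT (g : others (inr i) -> \bar R) ->
  measurable_fun setT (t : others (inr i) -> R) ->
  (forall w, 0 <= g w) -> (forall w, 0 <= t w <= 1)%R ->
  \int[P]_w (g w * (U i w <= t w)%R%:R%:E) = \int[P]_w (g w * (t w)%:E).
Proof.
move=> mg mt g0 t01.
pose f (x : others (inr i) * R) : \bar R := g x.1 * (x.2 <= t x.1)%R%:R%:E.
have mtb : measurable_fun setT (fun x : others (inr i) * R => (x.2 <= t x.1)%R).
  by apply: measurable_fun_ler => //; exact: measurableT_comp mt _.
rewrite (integrate_out crW (V := U i) (s := inr i) (f := f))//.
- apply: eq_integral => w _; rewrite /f /=.
  rewrite ge0_integralZl//.
  + congr (_ * _); rewrite -(uniform_cdf (t01 w)).
    case: crW => _ _ HU _; rewrite -(HU i)//.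
    transitivity (\int[distribution P (U i)]_v (\1_(`]-oo, t w]%classic) v)%:E).
      by apply: eq_integral => v _; rewrite indicE mem_setE in_itv.
    by rewrite integral_indic// setIT.
  + apply/measurable_EFinP; apply: (@measurableT_comp _ _ _ _ _ _ (fun b : bool => b%:R : R)) => //.
    by apply: measurable_fun_ler.
- apply: emeasurable_funM; first exact: measurableT_comp mg _.
  by apply/measurable_EFinP; apply: (@measurableT_comp _ _ _ _ _ _ (fun b : bool => b%:R : R)).
- by move=> x; rewrite /f mule_ge0.
Qed.

Lemma integrate_S b i k (g : Om -> \bar R) (u : Om -> R) :
  measurable_fun setT (g : others (inl (inr (i, k))) -> \bar R) ->
  measurable_fun setT (u : others (inl (inr (i, k))) -> R) ->
  (forall w, 0 <= g w) ->
  \int[P]_w (g w * (S i k w \in Interval (BSide b (u w)) +oo%O)%:R%:E) =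
  \int[P]_w (g w * (expR (- Num.max (u w) 0))%R%:E).
Proof.
move=> mg mu g0.
pose f (x : others (inl (inr (i, k))) * R) : \bar R :=
  g x.1 * (x.2 \in Interval (BSide b (u x.1)) +oo%O)%:R%:E.
rewrite (integrate_out crW (V := S i k) (s := inl (inr (i, k))) (f := f))//.
- apply: eq_integral => w _; rewrite /f /=.
  rewrite ge0_integralZl//.
  + congr (_ * _); rewrite -(exponential_tail b).
    case: crW => _ HS _ _; rewrite -(HS i k)//.
    transitivity (\int[distribution P (S i k)]_v
        (\1_([set` Interval (BSide b (u w)) +oo%O]) v)%:E).
      by apply: eq_integral => v _; rewrite indicE mem_setE.
    by rewrite integral_indic// setIT.
  + by apply/measurable_EFinP; apply: measurable_side.
- apply: emeasurable_funM; first exact: measurableT_comp mg _.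
  apply/measurable_EFinP; apply: measurable_side => //.
  exact: measurableT_comp mu _.
- by move=> x; rewrite /f mule_ge0.
Qed.

Section race.
Variables (b : bool) (i : nat) (k : 'I_n.+1) (c : 'I_n.+1 -> Om -> R).
Hypothesis c0 : forall j w, (0 <= c j w)%R.
Hypothesis mc : forall j j',
  measurable_fun setT (c j : others (inl (inr (i, j'))) -> R).

Local Notation beats j w :=
  (S i j w \in Interval (BSide b (S i k w * c j w)%R) +oo%O).

(** The rivals are removed one at a time. With [S i k] frozen, rival j stays behind with probability
    exp (- c_j S_k^+), and this factor is absorbed into [g] for the next step. This is why [g] is
    allowed to depend on [S i k] but on no other [S i j]. *)
Let race_given_winner (r : seq 'I_n.+1) : uniq r -> k \notin r ->
  forall g : Om -> \bar R, (forall w, 0 <= g w) ->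
  (forall j, j != k ->
    measurable_fun setT (g : others (inl (inr (i, j))) -> \bar R)) ->
  \int[P]_w (g w * (\prod_(j <- r) (beats j w)%:R)%R%:E) =
  \int[P]_w (g w * (expR (- (Num.max (S i k w) 0 * \sum_(j <- r) c j w)))%R%:E).
Proof.
elim: r => [_ _ g _ _|j r IH /= /andP[jr ur] + g g0 mg].
  by apply: eq_integral => w _; rewrite !big_nil mulr0 oppr0 expR0.
rewrite inE negb_or => /andP[kj kr].
have mS j' : j' != j ->
    measurable_fun setT (S i j' : others (inl (inr (i, j))) -> R).
  by move=> jj'; apply: measurable_S_others => -[ejj']; rewrite ejj' eqxx in jj'.
transitivity (\int[P]_w ((g w * (\prod_(j <- r) (beats j w)%:R)%R%:E) *
    (beats j w)%:R%:E)).
  by apply: eq_integral => w _; rewrite big_cons mulrC EFinM muleA.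
rewrite integrate_S; first last.
- move=> w; apply: mule_ge0 => //; rewrite lee_fin.
  by apply: prodr_ge0.
- by apply: measurable_funM => //; exact: mS.
- apply: emeasurable_funM; first by apply: mg; rewrite eq_sym.
  apply/measurable_EFinP; apply: measurable_prod => j' j'r.
  apply: measurable_side.
    by apply: mS; apply: contraNneq jr => <-.
  by apply: measurable_funM; [exact: mS|exact: mc].
transitivity (\int[P]_w ((g w * (expR (- Num.max (S i k w * c j w) 0))%R%:E) *
   (\prod_(j <- r) (beats j w)%:R)%R%:E)).
  by apply: eq_integral => w _; rewrite muleAC.
rewrite IH//.
- apply: eq_integral => w _; rewrite -muleA -EFinM -expRD big_cons.
  congr (_ * (expR _)%:E); rewrite mulrDr opprD; congr (- _ - _)%R.
  by rewrite maxr_pMl// mul0r.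
- by move=> w; rewrite mule_ge0// lee_fin expR_ge0.
- move=> j' j'k; apply: emeasurable_funM; first exact: mg.
  apply/measurable_EFinP; apply: measurableT_comp => //.
  apply: measurable_funN; apply: measurable_maxr => //.
  apply: measurable_funM; last exact: mc.
  by apply: measurable_S_others => -[ekj']; rewrite ekj' eqxx in j'k.
Qed.

(** Averaging the product of the exponential factors over [S i k] gives the Laplace transform of
    Exp(1) at the sum of the c_j. The value is the same for both [b], as ties are null. *)
Lemma race (g : Om -> \bar R) : (forall w, 0 <= g w) ->
  (forall j, measurable_fun setT (g : others (inl (inr (i, j))) -> \bar R)) ->
  \int[P]_w (g w * (\prod_(j | j != k) (beats j w)%:R)%R%:E) =
  \int[P]_w (g w * ((1 + \sum_(j | j != k) c j w)^-1)%R%:E).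
Proof.
move=> g0 mg; pose r := [seq j <- index_enum 'I_n.+1 | j != k].
have := @race_given_winner r _ _ g g0 (fun j _ => mg j).
rewrite filter_uniq ?index_enum_uniq// mem_filter eqxx => /(_ isT isT).
under eq_integral do rewrite big_filter.
under [X in _ = X -> _]eq_integral do rewrite big_filter.
move=> ->.
pose f (x : others (inl (inr (i, k))) * R) : \bar R :=
  g x.1 * (expR (- (Num.max x.2 0 * \sum_(j | j != k) c j x.1)))%R%:E.
rewrite (integrate_out crW (V := S i k) (s := inl (inr (i, k))) (f := f))//.
- apply: eq_integral => w _; rewrite /f /=.
  rewrite ge0_integralZl//.
  + congr (_ * _); apply: exponential_laplace; last exact: sumr_ge0.
    by case: crW => _ HS _ _; exact: HS.
  + apply/measurable_EFinP; apply: measurableT_comp => //.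
    apply: measurable_funN; apply: measurable_funM => //.
    exact: measurable_maxr.
- apply: emeasurable_funM; first exact: measurableT_comp (mg k) _.
  apply/measurable_EFinP; apply: measurableT_comp => //.
  apply: measurable_funN; apply: measurable_funM => //.
    exact: measurable_maxr.
  apply: measurable_sum_cond => j _.
  exact: (measurableT_comp (@mc j k) (@measurable_fst _ _ _ _)).
- by move=> x; rewrite /f mule_ge0// lee_fin expR_ge0.
Qed.
End race.

End races.

(** * The sampler *)

Section targets.
Context {R : realType} {T : Type}.
Implicit Types (p q : T -> R) (y : T).

Section one_target.
Variables (p q : T -> R) (om : R).
Hypotheses (p0 : forall y, 0 <= p y) (q0 : forall y, 0 <= q y).
Hypothesis pq : forall y, (dratio p q y <= om%:E)%E.

Lemma dratio_ge0 y : (0 <= dratio p q y)%E.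
Proof. by rewrite /dratio mule_ge0 ?inve_ge0 ?lee_fin. Qed.

Lemma dratioE y : dratio p q y = (weight p q y)%:E.
Proof.
rewrite /weight fineK// ge0_fin_numE ?dratio_ge0//.
exact: le_lt_trans (pq y) (ltry _).
Qed.

Lemma weight_ge0 y : 0 <= weight p q y.
Proof. by rewrite /weight fine_ge0// dratio_ge0. Qed.

(** Where [q] vanishes, the bound on [dratio] forces [p] to vanish, because a positive number over 0
    is +oo. *)
Lemma weight_mulr y : weight p q y * q y = p y.
Proof.
have := pq y; rewrite /weight /dratio inver; case: ifPn => [/eqP ->|qy] H.
  rewrite mulr0; apply/esym/eqP; rewrite eq_le p0 andbT leNgt; apply/negP => py.
  by move: H; rewrite gt0_muley ?lte_fin.
by rewrite /= -mulrA mulVf// mulr1.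
Qed.

(** The element of [T] excludes the supremum of an empty range, which would be -oo. *)
Lemma sup_dratioE : T -> ereal_sup (range (dratio p q)) = (omegaP p q)%:E.
Proof.
move=> y; rewrite /omegaP fineK// ge0_fin_numE.
  apply: le_lt_trans (ltry om); apply: ge_ereal_sup => _ [z _ <-].
  exact: pq.
by apply: le_trans (dratio_ge0 y) _; apply: ereal_sup_ubound; exists y.
Qed.

Lemma weight_le_omegaP y : weight p q y <= omegaP p q.
Proof.
rewrite -lee_fin -dratioE -(sup_dratioE y); apply: ereal_sup_ubound.
by exists y.
Qed.

Lemma omegaP_le : T -> omegaP p q <= om.
Proof.
move=> y; rewrite -lee_fin -(sup_dratioE y).
by apply: ge_ereal_sup => _ [z _ <-]; exact: pq.
Qed.

Lemma omegaP_ge0 : T -> 0 <= omegaP p q.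
Proof. by move=> y; exact: le_trans (weight_ge0 y) (weight_le_omegaP y). Qed.

End one_target.
End targets.

Section candidate.
Context {R : realType} {T : Type} {n : nat}.
Variables (p q : T -> R) (om : R).
Hypotheses (p0 : forall y, 0 <= p y) (q0 : forall y, 0 <= q y).
Hypothesis pq : forall y, (dratio p q y <= om%:E)%E.
Local Notation lam := (weight p q).
Implicit Types B : 'I_n.+1 -> T * R.

Lemma ers_candP B j :
  ((B (ers_cand p q B)).2%:E / dratio p q (B (ers_cand p q B)).1 <=
   (B j).2%:E / dratio p q (B j).1)%E.
Proof. by rewrite /ers_cand; case: Order.TotalTheory.arg_minP => // i _; exact. Qed.

(** Strict inequalities make the minimizer unique, so no tie has to be broken. For a rival of weight
    0 the hypothesis says that its exponential is positive, so its quotient is +oo. *)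
Lemma strict_race_cand B k : 0 < lam (B k).1 ->
  (forall j, j != k -> (B k).2 * (lam (B j).1 / lam (B k).1) < (B j).2) ->
  ers_cand p q B = k.
Proof.
move=> lk H; apply/eqP; apply: contraT => ck.
have := ers_candP B k; rewrite leNgt => /negP[].
set j := ers_cand p q B in ck *.
have Hj := H _ ck; rewrite !(dratioE p0 q0 pq) !inver gt_eqF//.
case: ifPn => [/eqP lj0|lj0].
  rewrite lj0 mul0r mulr0 in Hj.
  by rewrite gt0_muley ?lte_fin// -EFinM ltry.
have lj : 0 < lam (B j).1 by rewrite lt_neqAle eq_sym lj0 weight_ge0.
by rewrite -!EFinM lte_fin ltr_pdivlMr// -mulrA [_^-1 * _]mulrC.
Qed.

(** Converse of [strict_race_cand] up to ties. For a rival of weight 0 the claim reads 0 <=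
    [(B j).2], which is where positivity enters. *)
Lemma cand_race B k : (forall j, 0 < (B j).2) -> ers_cand p q B = k ->
  0 < lam (B k).1 ->
  forall j, (B k).2 * (lam (B j).1 / lam (B k).1) <= (B j).2.
Proof.
move=> S0 ck lk j; have := ers_candP B j; rewrite ck.
rewrite !(dratioE p0 q0 pq) !inver gt_eqF//.
case: ifPn => [/eqP -> _|lj0]; first by rewrite mul0r mulr0 ltW.
have lj : 0 < lam (B j).1 by rewrite lt_neqAle eq_sym lj0 weight_ge0.
by rewrite -!EFinM lee_fin ler_pdivlMr// -mulrA [_^-1 * _]mulrC.
Qed.

(** A minimizer of weight 0 has quotient +oo, so all quotients are +oo, which only weight 0
    allows. *)
Lemma cand_null B : (forall j, 0 < (B j).2) ->
  lam (B (ers_cand p q B)).1 = 0 -> forall j, lam (B j).1 = 0.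
Proof.
move=> S0 ck0 j; have := ers_candP B j.
rewrite !(dratioE p0 q0 pq) !inver ck0 eqxx gt0_muley ?lte_fin// leye_eq.
by case: ifPn => [/eqP//|_]; rewrite -EFinM.
Qed.

End candidate.

Section first_accepted.
Context {R : realType} {T : Type} {n : nat}.
Variables (p q : T -> R) (w : batches R T n).

Lemma ERS_first i : ers_accept p q (w i) ->
  (forall j, (j < i)%N -> ~~ ers_accept p q (w j)) ->
  ERS w p q = (i, ers_cand p q (w i).1).
Proof.
move=> ai rj; rewrite /ERS; case: pselect => [h|[]]; last by exists i.
case: ex_minnP => m am mm; have -> // : m = i.
apply/eqP; rewrite eqn_leq mm// leqNgt; apply/negP => /rj.
by rewrite am.
Qed.

Lemma ERS_none : (forall i, ~~ ers_accept p q (w i)) -> ERS w p q = (0%N, ord0).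
Proof. by move=> H; rewrite /ERS; case: pselect => // -[i ai]; have := H i; rewrite ai. Qed.
End first_accepted.

Section measurability.
Context {R : realType} {d0 dY : measure_display} {T0 : measurableType d0}
  {TY : measurableType dY} {n : nat}.

(** The minimizer depends on the values only through the finite table of their comparisons: [D tau]
    is the event that this table is [tau], and [G tau] is the index that the definition of [arg min]
    then picks, default included. *)
Lemma measurable_arg_min (E : 'I_n.+1 -> T0 -> \bar R) k :
  (forall j, measurable_fun setT (E j)) ->
  measurable [set t | [arg min_(j < ord0) E j t]%O = k].
Proof.
move=> mE.
pose D (tau : {ffun 'I_n.+1 * 'I_n.+1 -> bool}) :=
  \bigcap_(ij in [set: 'I_n.+1 * 'I_n.+1])
    [set t | (E ij.1 t <= E ij.2 t)%E = tau ij].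
pose G (tau : {ffun 'I_n.+1 * 'I_n.+1 -> bool}) : 'I_n.+1 :=
  odflt ord0 [pick i | [forall j, tau (i, j)]].
rewrite (_ : [set t | _] = \bigcup_(tau in [set tau | G tau = k]) D tau).
  apply: fin_bigcup_measurable; first exact: finite_finset.
  move=> tau _; apply: fin_bigcap_measurable; first exact: finite_finset.
  move=> [i j] _ /=.
  have mle : measurable_fun setT (fun t => (E i t <= E j t)%E).
    exact: measurable_fun_lee.
  rewrite [X in measurable X](_ : _ = (fun t => (E i t <= E j t)%E) @^-1` [set tau (i, j)])//.
  by rewrite -[X in measurable X]setTI; exact: mle.
have GE t tau : D tau t -> [arg min_(j < ord0) E j t]%O = G tau.
  move=> Dt; rewrite /Order.arg_min /extremum /G.
  congr odflt; apply: eq_pick => i /=.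
  by apply: eq_forallb => j; have := Dt (i, j) Logic.I => /= ->.
apply/seteqP; split => [t tk|t [tau Gk Dt]] /=; last by rewrite (GE t tau).
exists [ffun ij => (E ij.1 t <= E ij.2 t)%E].
  by rewrite /= -tk -(GE t)// => ij _ /=; rewrite ffunE.
by move=> ij _ /=; rewrite ffunE.
Qed.

Variables (p : T0 -> TY -> R) (q : TY -> R).
Hypotheses (mp : measurable_fun setT (fun u : T0 * TY => p u.1 u.2))
  (mq : measurable_fun setT q).

Lemma measurable_dratio (y : T0 -> TY) : measurable_fun setT y ->
  measurable_fun setT (fun t => dratio (p t) q (y t)).
Proof.
move=> my; rewrite /dratio; apply: emeasurable_funM.
  apply/measurable_EFinP.
  exact: (measurableT_comp mp (measurable_fun_pair (@measurable_id _ _ setT) my)).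
apply: (measurableT_comp measurable_inve); apply/measurable_EFinP.
exact: (measurableT_comp mq my).
Qed.

Lemma measurable_weight (y : T0 -> TY) : measurable_fun setT y ->
  measurable_fun setT (fun t => weight (p t) q (y t)).
Proof.
move=> my; rewrite /weight.
by apply: (measurableT_comp (fine_measurable measurableT)); exact: measurable_dratio.
Qed.

Hypothesis mom : measurable_fun setT (fun t => omegaP (p t) q).

Section batch.
Variable b : T0 -> ('I_n.+1 -> TY * R) * R.
Hypotheses (mY : forall k, measurable_fun setT (fun t => ((b t).1 k).1))
  (mS : forall k, measurable_fun setT (fun t => ((b t).1 k).2))
  (mU : measurable_fun setT (fun t => (b t).2)).

Lemma measurable_cand k :
  measurable [set t | ers_cand (p t) q (b t).1 = k].
Proof.
apply: measurable_arg_min => j; apply: emeasurable_funM.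
  exact/measurable_EFinP.
by apply: (measurableT_comp measurable_inve); exact: measurable_dratio.
Qed.

Lemma measurable_accept :
  measurable_fun setT (fun t => ers_accept (p t) q (b t)).
Proof.
have mZ : measurable_fun setT (fun t => ers_Zhat (p t) q (b t).1).
  by apply: measurable_sum_cond => k _; exact: measurable_weight.
apply: measurable_fun_ler => //; apply: measurable_funM => //.
apply: (measurableT_comp measurable_invr).
apply: measurable_funB; first exact: measurable_funD.
(* The weight at a random index becomes a finite sum over fixed indices, each multiplied by the
   indicator that it is the candidate. *)
rewrite (_ : (fun t => _) = fun t => \sum_(k < n.+1)
  \1_[set t | ers_cand (p t) q (b t).1 = k] t * weight (p t) q ((b t).1 k).1).
  apply: measurable_sum => k; apply: measurable_funM; last exact: measurable_weight.
  by apply: measurable_indic; exact: measurable_cand.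
apply/funext => t; rewrite (bigD1 (ers_cand (p t) q (b t).1))//= big1 => [|k kc].
  by rewrite indicE mem_set//= mul1r addr0.
by rewrite indicE memNset ?mul0r// => /= ck; rewrite ck eqxx in kc.
Qed.

Lemma measurable_accept_set : measurable [set t | ers_accept (p t) q (b t)].
Proof.
rewrite -[X in measurable X]setTI.
by have := measurable_accept measurableT (_ : measurable [set true]); exact.
Qed.

Lemma measurable_reject_set : measurable [set t | ~~ ers_accept (p t) q (b t)].
Proof.
rewrite (_ : [set t | _] = ~` [set t | ers_accept (p t) q (b t)]).
  by apply: measurableC; exact: measurable_accept_set.
by apply/seteqP; split => t /= /negP.
Qed.

End batch.

Variable w : T0 -> batches R TY n.
Hypotheses (mY : forall i k, measurable_fun setT (fun t => ((w t i).1 k).1))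
  (mS : forall i k, measurable_fun setT (fun t => ((w t i).1 k).2))
  (mU : forall i, measurable_fun setT (fun t => (w t i).2)).

(** The event is cut according to the first accepted batch and its candidate; where every batch is
    rejected, the sample is the dummy entry (0, [ord0]). The target varies with t so that the sample
    becomes jointly measurable in W and in the observation that selects the target. *)
Lemma measurable_ERS_sample :
  measurable_fun setT (fun t => ERS_sample (w t) (p t) q).
Proof.
move=> _ C mC; rewrite setTI.
pose rej i := [set t | ~~ ers_accept (p t) q (w t i)].
pose A i k := [set t | ers_accept (p t) q (w t i)] `&`
  (\bigcap_(j < i) rej j) `&` [set t | ers_cand (p t) q (w t i).1 = k].
pose yC i k := (fun t => ((w t i).1 k).1) @^-1` C.
have myC i k : measurable (yC i k).
  by rewrite -[X in measurable X]setTI; exact: mY.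
rewrite (_ : _ @^-1` C =
  (\bigcup_i \bigcup_(k in [set: 'I_n.+1]) (A i k `&` yC i k)) `|`
  (\bigcap_i rej i `&` yC 0%N ord0)).
  apply: measurableU; last first.
    apply: measurableI => //; apply: bigcapT_measurable => i.
    exact: measurable_reject_set.
  apply: bigcupT_measurable => i.
  apply: fin_bigcup_measurable; first exact: finite_finset.
  move=> k _; apply: measurableI => //; apply: measurableI; last exact: measurable_cand.
  apply: measurableI; first exact: measurable_accept_set.
  apply: fin_bigcap_measurable; first exact: finite_II.
  by move=> j _; exact: measurable_reject_set.
apply/seteqP; split => [t /= Ct|t [[i _ [k _ [[[ai ri] ck] Ck]]]|[ri C0]]] /=.
- have [[i ai]|nacc] := pselect (exists i, ers_accept (p t) q (w t i)).
    left; have ex : exists i, ers_accept (p t) q (w t i) by exists i.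
    case: (ex_minnP ex) => m am mm.
    have rm j : (j < m)%N -> ~~ ers_accept (p t) q (w t j).
      by move=> jm; apply/negP => /mm; rewrite leqNgt jm.
    exists m => //; exists (ers_cand (p t) q (w t m).1) => //; split; first by split.
    by move: Ct; rewrite /ERS_sample (ERS_first am rm).
  have H i : ~~ ers_accept (p t) q (w t i).
    by apply/negP => ai; apply: nacc; exists i.
  right; split; first by move=> i _; exact: H.
  by move: Ct; rewrite /ERS_sample (ERS_none H).
- by rewrite /ERS_sample (ERS_first ai ri) /sample_at /= ck.
- by rewrite /ERS_sample (ERS_none (fun i => ri i Logic.I)).
Qed.

End measurability.

(** * The law of the selected sample *)

Lemma natr_forall (R : comPzSemiRingType) (I : finType) (a f : pred I) :
  ([forall (j | a j), f j])%:R = \prod_(j | a j) (f j)%:R :> R.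
Proof.
case: forall_inP => [H|H]; first by rewrite big1// => j /H ->.
have [j aj fj] : exists2 j, a j & ~~ f j.
  apply/exists_inP; apply: contraT; rewrite negb_exists_in => /forall_inP K.
  by case: H => j /K; rewrite negbK.
by rewrite (bigD1 j)//= (negbTE fj) mul0r.
Qed.

Lemma measurable_natb {R : realType} {d : measure_display}
    {T : measurableType d} (f : T -> bool) :
  measurable_fun setT f -> measurable_fun setT (fun t => (f t)%:R : R).
Proof.
by move=> mf; apply: (@measurableT_comp _ _ _ _ _ _ (fun b : bool => b%:R : R)).
Qed.

Lemma le_of_geometric_bound {R : realType} (c x s : R) : 0 <= s < 1 ->
  (forall m, c * (1 - s ^+ m) <= x) -> c <= x.
Proof.
move=> /andP[s0 s1] H.
have cv : (fun m => c * (1 - s ^+ m)) @ \oo --> c * (1 - 0).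
  apply: cvgMl_tmp; apply: cvgB; first exact: cvg_cst.
  by apply: cvg_expr; rewrite ger0_norm.
rewrite subr0 mulr1 in cv.
rewrite -(cvg_lim _ cv)//; apply: limr_le; first by apply/cvg_ex; exists c.
by near=> m; exact: H.
Unshelve. all: end_near. Qed.

Section law.
Context {R : realType} {d dY : measure_display} {Om : measurableType d}
  {TY : measurableType dY} {P : probability Om R} {n : nat}
  {nu : {measure set TY -> \bar R}} {q : TY -> R}
  {Y : nat -> 'I_n.+1 -> {RV P >-> TY}}
  {S : nat -> 'I_n.+1 -> {RV P >-> R}} {U : nat -> {RV P >-> R}}.
Hypothesis crW : common_randomness nu q Y S U.
Hypothesis hq : prob_density nu q.
Local Notation others := (@others _ _ _ _ _ P n Y S U).
Local Notation W := (W_of Y S U).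

Let mq : measurable_fun setT q. Proof. by case: hq. Qed.
Let q0 y : 0 <= q y. Proof. by case: hq. Qed.

Lemma integral_Y i k (f : TY -> \bar R) : measurable_fun setT f ->
  (forall y, 0 <= f y)%E ->
  (\int[P]_w f (Y i k w) = \int[nu]_y (f y * (q y)%:E))%E.
Proof.
move=> mf f0; rewrite -(@ge0_integral_distribution _ _ _ _ _ _ (Y i k) f)//.
apply: ge0_integral_density => //.
by case: crW => HY _ _ _ A; exact: HY.
Qed.

Lemma integrate_Y i k (f : others (inl (inl (i, k))) * TY -> \bar R) :
  measurable_fun setT f -> (forall t, 0 <= f t)%E ->
  (\int[P]_w f (w, Y i k w) = \int[P]_w \int[nu]_y (f (w, y) * (q y)%:E))%E.
Proof.
move=> mf f0; rewrite (integrate_out crW (V := Y i k) (s := inl (inl (i, k))))//.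
apply: eq_integral => w _; apply: ge0_integral_density => //.
  by case: crW => HY _ _ _ A; exact: HY.
exact: (measurableT_comp mf (@pair1_measurable _ _ (others (inl (inl (i, k)))) TY w)).
Qed.

Variables (p : TY -> R) (om : R).
Hypothesis hp : prob_density nu p.
Hypothesis pq : forall y, (dratio p q y <= om%:E)%E.
Local Notation lam := (weight p q).
Local Notation omp := (omegaP p q).

Let mp : measurable_fun setT p. Proof. by case: hp. Qed.
Let p0 y : 0 <= p y. Proof. by case: hp. Qed.
Let lam0 y : 0 <= lam y. Proof. exact: weight_ge0. Qed.
Let lam_om y : lam y <= omp. Proof. exact: (weight_le_omegaP p0 q0 pq). Qed.

Lemma measurable_weight1 : measurable_fun setT lam.
Proof.
have := @measurable_weight R _ _ TY TY (fun _ => p) q _ mq id (@measurable_id _ _ _).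
by apply; exact: (measurableT_comp mp).
Qed.
Let mlam := measurable_weight1.

(** Integrate p = lam q <= omp q. *)
Lemma omegaP_ge1 : 1 <= omp.
Proof.
have [_ _ q1] := hq; have [_ _ p1] := hp.
rewrite -lee_fin -[leLHS]p1.
rewrite -[leRHS]mule1 -[X in (_ <= _ * X)%E]q1 -ge0_integralZl//; last 3 first.
- exact/measurable_EFinP.
- by move=> y _; rewrite lee_fin.
- by rewrite lee_fin; exact: (omegaP_ge0 p0 q0 pq point).
apply: ge0_le_integral => //.
- by move=> y _; rewrite lee_fin.
- exact/measurable_EFinP.
- by apply/measurable_EFinP; exact: measurable_funM.
- move=> y _; rewrite -EFinM lee_fin -(weight_mulr p0 pq).
  exact: ler_wpM2r.
Qed.
Let omp0 : 0 < omp. Proof. exact: lt_le_trans ltr01 omegaP_ge1. Qed.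

(** The acceptance threshold of batch i in case its candidate is k. Fixing k makes it a function of
    the proposals alone. *)
Definition acceptance i k (w : Om) : R :=
  let Z := \sum_(j < n.+1) lam (Y i j w) in Z / (Z + omp - lam (Y i k w)).

(** With [b] false the races are strict, and the event implies that batch i is accepted with
    candidate k; with [b] true they are weak, and the event follows from this almost surely. As both
    versions have the same probability, the acceptance event is enclosed between them. *)
Definition wins b i k (w : Om) : bool :=
  [&& 0 < lam (Y i k w),
    [forall (j | j != k), S i j w \in Interval
      (BSide b (S i k w * (lam (Y i j w) / lam (Y i k w)))) +oo%O] &
    U i w <= acceptance i k w].

Definition rejections i (w : Om) : R :=
  \prod_(j < i) (~~ ers_accept p q (W w j))%:R.

(** With Z the total weight of the batch, the race probability lam_k / Z times the acceptance
    probability Z / (omp + sum of the other weights) is lam_k times this quantity, from which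
    [Y i k] is absent. *)
Definition inv_total i k (w : Om) : R :=
  (omp + \sum_(j | j != k) lam (Y i j w))^-1.

Lemma acceptance01 i k w : 0 <= acceptance i k w <= 1.
Proof.
rewrite /acceptance; set Z := \sum_(j < _) _.
have Z0 : 0 <= Z by exact: sumr_ge0.
have Zl : Z <= Z + omp - lam (Y i k w) by rewrite -addrA lerDl subr_ge0.
rewrite divr_ge0//=; last exact: le_trans Zl.
have [->|ZZ] := eqVneq (Z + omp - lam (Y i k w)) 0; first by rewrite invr0 mulr0.
by rewrite ler_pdivrMr ?mul1r// lt_neqAle eq_sym ZZ (le_trans Z0).
Qed.

Lemma rejections01 i w : 0 <= rejections i w <= 1.
Proof.
rewrite /rejections; apply: (big_ind (fun x : R => 0 <= x <= 1)) => //.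
- by rewrite ler01 lexx.
- by move=> x y /andP[x0 x1] /andP[y0 y1]; rewrite mulr_ge0//= mulr_ile1.
- by move=> j _; case: (~~ _); rewrite ?lexx ?ler01.
Qed.

Lemma inv_total_ge0 i k w : 0 <= inv_total i k w.
Proof. by rewrite invr_ge0; apply: addr_ge0; [exact: ltW|exact: sumr_ge0]. Qed.

Lemma measurable_weight_others s i k : s <> inl (inl (i, k)) ->
  measurable_fun setT (fun w : others s => lam (Y i k w)).
Proof. by move=> si; apply: (measurableT_comp mlam); exact: measurable_Y_others. Qed.

Lemma measurable_rejections_others s i :
  (forall j k, (j < i)%N ->
    [/\ s <> inl (inl (j, k)), s <> inl (inr (j, k)) & s <> inr j]) ->
  measurable_fun setT (rejections i : others s -> R).
Proof.
move=> si; apply: measurable_prod => j _; apply: measurable_natb.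
apply: measurable_neg; have ji := ltn_ord j.
apply: (@measurable_accept _ _ _ (others s) TY n (fun _ => p) q _ _ _
  (fun w => W w j)) => //.
- exact: (measurableT_comp mp).
- by move=> k; apply: measurable_Y_others; case: (si j k ji).
- by move=> k; apply: measurable_S_others; case: (si j k ji).
- by apply: measurable_U_others; case: (si j ord0 ji).
Qed.

Lemma measurable_acceptance_others s i k : (forall j, s <> inl (inl (i, j))) ->
  measurable_fun setT (acceptance i k : others s -> R).
Proof.
move=> si; apply: measurable_funM.
  by apply: measurable_sum => j; exact: measurable_weight_others.
apply: (measurableT_comp measurable_invr); apply: measurable_funB.
  apply: measurable_funD => //.
  by apply: measurable_sum => j; exact: measurable_weight_others.
exact: measurable_weight_others.
Qed.

(** [U i], then the exponentials, then [Y i k] are integrated out. The conditional probability of a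
    win is lam (Y_k) times a factor free of Y_k, and lam q = p: this is why the winning value has
    density exactly p, whatever the other entries are. *)
Lemma win_probability b i k C : measurable C ->
  (\int[P]_w (rejections i w * \1_C (Y i k w) * (wins b i k w)%:R)%:E =
   (\int[nu]_(y in C) (p y)%:E) *
     \int[P]_w (rejections i w * inv_total i k w)%:E)%E.
Proof.
move=> mC.
pose c j w := lam (Y i j w) / lam (Y i k w).
pose beats j w := S i j w \in Interval (BSide b (S i k w * c j w)) +oo%O.
pose g0 w := rejections i w * \1_C (Y i k w) * (0 < lam (Y i k w))%R%:R.
have g00 w : 0 <= g0 w by rewrite !mulr_ge0//; case/andP: (rejections01 i w).
have c0 j w : 0 <= c j w by rewrite divr_ge0.
have mc s j : (forall j', s <> inl (inl (i, j'))) ->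
    measurable_fun setT (c j : others s -> R).
  move=> si; apply: measurable_funM; first exact: measurable_weight_others.
  apply: (measurableT_comp measurable_invr); exact: measurable_weight_others.
have mg0 s : (forall j k, (j < i)%N ->
      [/\ s <> inl (inl (j, k)), s <> inl (inr (j, k)) & s <> inr j]) ->
    (forall j, s <> inl (inl (i, j))) ->
    measurable_fun setT (g0 : others s -> R).
  move=> sj si; apply: measurable_funM; first apply: measurable_funM.
  - exact: measurable_rejections_others.
  - apply: (measurableT_comp (measurable_indic mC)).
    exact: measurable_Y_others.
  - apply: measurable_natb; apply: measurable_fun_ltr => //.
    exact: measurable_weight_others.
have E1 : (\int[P]_w (rejections i w * \1_C (Y i k w) * (wins b i k w)%:R)%:E =
   \int[P]_w ((g0 w * \prod_(j | j != k) (beats j w)%:R)%:E *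
     (U i w <= acceptance i k w)%R%:R%:E))%E.
  apply: eq_integral => w _; rewrite -EFinM /wins -!mulnb !natrM natr_forall.
  by congr (_%:E); rewrite /g0 !mulrA.
rewrite E1 (integrate_U crW)//; first last.
- by move=> w; exact: acceptance01.
- by move=> w; rewrite lee_fin mulr_ge0// prodr_ge0.
- exact: measurable_acceptance_others.
- apply/measurable_EFinP; apply: measurable_funM.
    by apply: mg0 => // j k' ji; split => // -[ej]; rewrite ej ltnn in ji.
  apply: measurable_prod_cond => j _; apply: measurable_side.
    exact: measurable_S_others.
  by apply: measurable_funM; [exact: measurable_S_others|exact: mc].
have E2 : (\int[P]_w ((g0 w * \prod_(j | j != k) (beats j w)%:R)%:E *
     (acceptance i k w)%:E) =
   \int[P]_w ((g0 w * acceptance i k w)%:E *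
     (\prod_(j | j != k) (beats j w)%:R)%:E))%E.
  by apply: eq_integral => w _; rewrite -!EFinM mulrAC.
rewrite E2 (race crW b k c0); first last.
- move=> j; apply/measurable_EFinP; apply: measurable_funM.
    by apply: mg0 => // j' k' ji; split => // -[ej]; rewrite ej ltnn in ji.
  exact: measurable_acceptance_others.
- move=> w; rewrite lee_fin mulr_ge0//.
  by case/andP: (acceptance01 i k w).
- by move=> j j'; exact: mc.
pose f (x : others (inl (inl (i, k))) * TY) : \bar R :=
  (rejections i x.1 * \1_C x.2 * lam x.2 * inv_total i k x.1)%:E.
have E3 : (\int[P]_w ((g0 w * acceptance i k w)%:E *
    ((1 + \sum_(j | j != k) c j w)^-1)%:E) = \int[P]_w f (w, Y i k w))%E.
  apply: eq_integral => w _; rewrite /f /= -EFinM /g0 /acceptance /inv_total.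
  congr (_%:E).
  have [l0|l0] := ltP 0 (lam (Y i k w)); last first.
    have -> : lam (Y i k w) = 0 by apply/le_anti; rewrite l0 lam0.
    by rewrite !(mulr0, mul0r).
  rewrite -mulr_suml (bigD1 k)//=; set A := \sum_(j | j != k) _.
  have A0 : 0 <= A by exact: sumr_ge0.
  rewrite mulr1 -!mulrA; congr (_ * (_ * _)).
  have -> : lam (Y i k w) + A + omp - lam (Y i k w) = omp + A.
    by ring.
  by field; rewrite ?gt_eqF// ?ltr_pwDl// ltr_wpDr.
have mrej : measurable_fun setT (rejections i : others (inl (inl (i, k))) -> R).
  apply: measurable_rejections_others => j k' ji.
  by split => // -[ej]; rewrite ej ltnn in ji.
have minv : measurable_fun setT (inv_total i k : others (inl (inl (i, k))) -> R).
  apply: (measurableT_comp measurable_invr); apply: measurable_funD => //.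
  apply: measurable_sum_cond => j jk; apply: measurable_weight_others.
  by move=> -[ekj]; rewrite ekj eqxx in jk.
rewrite E3 integrate_Y//.
- rewrite muleC -ge0_integralZr//=; last 3 first.
  + apply/measurable_EFinP; apply: measurable_funM.
      exact: measurable_others mrej.
    exact: measurable_others minv.
  + by move=> w _; rewrite lee_fin mulr_ge0 ?inv_total_ge0//; case/andP: (rejections01 i w).
  + by apply: integral_ge0 => y _; rewrite lee_fin.
  apply: eq_integral => w _.
  rewrite [X in _ = (_ * X)%E]integral_mkcond -ge0_integralZl//; last 3 first.
  + apply/(measurable_restrictT _ mC)/measurable_funTS; exact/measurable_EFinP.
  + by move=> y _; rewrite patchE; case: ifP => // _; rewrite lee_fin.
  + by rewrite lee_fin mulr_ge0 ?inv_total_ge0//; case/andP: (rejections01 i w).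
  apply: eq_integral => y _; rewrite patchE /f /= -EFinM indicE -(weight_mulr p0 pq).
  case: (y \in C); last by rewrite mule0 mulr0 !mul0r.
  by rewrite -EFinM; congr (_%:E); rewrite /=; ring.
- apply/measurable_EFinP; apply: measurable_funM; first apply: measurable_funM;
    first apply: measurable_funM.
  + exact: (measurableT_comp mrej (@measurable_fst _ _ _ _)).
  + exact: (measurableT_comp (measurable_indic mC) (@measurable_snd _ _ _ _)).
  + exact: (measurableT_comp mlam (@measurable_snd _ _ _ _)).
  + exact: (measurableT_comp minv (@measurable_fst _ _ _ _)).
- move=> x; rewrite /f lee_fin !mulr_ge0 ?inv_total_ge0//.
  by case/andP: (rejections01 i x.1).
Qed.

Lemma wins_cand i k w : wins false i k w ->
  ers_accept p q (W w i) /\ ers_cand p q (W w i).1 = k.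
Proof.
case/and3P=> lk /forall_inP H Ui.
have ck : ers_cand p q (W w i).1 = k.
  apply: (strict_race_cand p0 q0 pq) => // j /H.
  by rewrite in_itv/= andbT.
by split => //; rewrite /ers_accept /ers_Zbar ck.
Qed.

Lemma cand_wins i w : (forall j, 0 < S i j w) -> 0 < U i w ->
  ers_accept p q (W w i) -> wins true i (ers_cand p q (W w i).1) w.
Proof.
move=> S0 U0 ai; set k := ers_cand _ _ _.
have lk : 0 < lam (Y i k w).
  rewrite lt_neqAle lam0 andbT eq_sym; apply/eqP => lk.
  have l0 := cand_null p0 q0 pq (B := (W w i).1) S0 lk.
  move: ai; rewrite /ers_accept /ers_Zhat big1 ?mul0r; last first.
    by move=> j _; exact: l0.
  by rewrite leNgt U0.
apply/and3P; split => //; apply/forall_inP => j _; rewrite in_itv/= andbT.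
exact: (cand_race p0 q0 pq (B := (W w i).1)).
Qed.

Lemma rejectionsS i w : rejections i.+1 w =
  rejections i w * (~~ ers_accept p q (W w i))%:R.
Proof. by rewrite /rejections big_ord_recr. Qed.

Lemma rejections_eq i w :
  rejections i w = 0 \/ rejections i w = 1 /\
    forall j, (j < i)%N -> ~~ ers_accept p q (W w j).
Proof.
elim: i => [|i [IH|[IH H]]]; first by right; rewrite /rejections big_ord0.
  by left; rewrite rejectionsS IH mul0r.
rewrite rejectionsS IH mul1r; case: (boolP (~~ _)) => ai; [right|by left].
by split => // j; rewrite ltnS leq_eqVlt => /orP[/eqP->//|/H].
Qed.

(** At most one entry wins all its strict races, and a win means acceptance. The last factor is the
    indicator that i is the first accepted batch; it telescopes over i. *)
Lemma wins_le_sample C i w :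
  \sum_k rejections i w * \1_C (Y i k w) * (wins false i k w)%:R <=
  \1_C (ERS_sample (W w) p q) * (rejections i w - rejections i.+1 w).
Proof.
rewrite rejectionsS; have [->|[-> H]] := rejections_eq i w.
  by rewrite mul0r subr0 mulr0 big1// => k _; rewrite !mul0r.
under eq_bigr do rewrite !mul1r.
have [ai|nai] := boolP (ers_accept p q (W w i)); last first.
  rewrite mul1r subrr mulr0 big1// => k _.
  case: (boolP (wins false i k w)) => [/wins_cand[ai _]|_]; last by rewrite mulr0.
  by rewrite ai in nai.
rewrite mul1r subr0 mulr1 /ERS_sample (ERS_first ai H) /sample_at /=.
rewrite (bigD1 (ers_cand p q (W w i).1))//= big1 => [|k kc]; last first.
  case: (boolP (wins false i k w)) => [/wins_cand[_ ck]|_]; last by rewrite mulr0.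
  by rewrite ck eqxx in kc.
by rewrite addr0 ler_piMr//; case: (wins _ _ _ _).
Qed.

(** Positivity of [U i] excludes the acceptance of a batch whose weights all vanish, since its
    threshold is 0. *)
Lemma rejections_le_wins i w : (forall j, 0 < S i j w) -> 0 < U i w ->
  rejections i w <= rejections i.+1 w +
    \sum_k rejections i w * \1_setT (Y i k w) * (wins true i k w)%:R.
Proof.
move=> S0 U0; rewrite rejectionsS; have [->|[-> H]] := rejections_eq i w.
  by rewrite mul0r add0r sumr_ge0// => k _; rewrite !mul0r.
have [ai|nai] := boolP (ers_accept p q (W w i)); last first.
  by rewrite mul1r lerDl sumr_ge0// => k _; rewrite !mulr_ge0.
rewrite mul1r add0r (bigD1 (ers_cand p q (W w i).1))//=.
rewrite cand_wins// indicT mulr1 mulr1 lerDl sumr_ge0//.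
Qed.

(** Each denominator is at most n + 1 times omp. It follows that a batch is accepted with
    probability at least omp^-1 given the past, so the probability of repeated rejection decays
    geometrically. *)
Lemma inv_total_sum i w : omp^-1 <= \sum_k inv_total i k w.
Proof.
have -> : omp^-1 = \sum_(k < n.+1) (omp *+ n.+1)^-1.
  rewrite sumr_const card_ord -(mulr_natr omp) invfM -[RHS]mulr_natr.
  by rewrite -mulrA mulVf ?mulr1// pnatr_eq0.
apply: ler_sum => k _; rewrite lef_pV2 ?posrE; last 2 first.
- by rewrite mulrn_wgt0.
- by rewrite ltr_wpDr// sumr_ge0.
rewrite mulrS lerD2l; apply: le_trans (_ : \sum_(j < n.+1 | j != k) omp <= _).
  by apply: ler_sum => j _; exact: lam_om.
by rewrite sumr_const cardC1 card_ord.
Qed.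

Let rej0 i w : 0 <= rejections i w. Proof. by case/andP: (rejections01 i w). Qed.
Let rej1 i w : rejections i w <= 1. Proof. by case/andP: (rejections01 i w). Qed.

Lemma measurable_rejections i : measurable_fun setT (rejections i).
Proof.
apply: (@measurable_others _ _ _ _ _ _ _ Y S U (inr i)).
apply: measurable_rejections_others => j k ji; split => // -[ej].
by rewrite ej ltnn in ji.
Qed.

Lemma measurable_wins b i k : measurable_fun setT (fun w => (wins b i k w)%:R : R).
Proof.
rewrite (_ : (fun w => _) = fun w => (0 < lam (Y i k w))%R%:R *
  (\prod_(j | j != k) (S i j w \in Interval
      (BSide b (S i k w * (lam (Y i j w) / lam (Y i k w)))) +oo%O)%:R *
   (U i w <= acceptance i k w)%R%:R)); last first.
  by apply/funext => w; rewrite /wins -!mulnb !natrM natr_forall.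
have ml j : measurable_fun setT (fun w => lam (Y i j w)).
  exact: (measurableT_comp mlam).
apply: measurable_funM.
  by apply: measurable_natb; exact: measurable_fun_ltr.
apply: measurable_funM.
  apply: measurable_prod_cond => j _; apply: measurable_side => //.
  apply: measurable_funM => //; apply: measurable_funM => //.
  exact: (measurableT_comp measurable_invr).
apply: measurable_natb; apply: measurable_fun_ler => //.
apply: (@measurable_others _ _ _ _ _ _ _ Y S U (inr i)).
exact: measurable_acceptance_others.
Qed.

Let measurable_term b i k C : measurable C -> measurable_fun setT
  (fun w => (rejections i w * \1_C (Y i k w) * (wins b i k w)%:R)%:E).
Proof.
move=> mC; apply/measurable_EFinP; apply: measurable_funM.
  apply: measurable_funM; first exact: measurable_rejections.
  exact: (measurableT_comp (measurable_indic mC)).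
exact: measurable_wins.
Qed.

Lemma measurable_sample : measurable_fun setT (fun w => ERS_sample (W w) p q).
Proof.
apply: (@measurable_ERS_sample _ _ _ Om TY n (fun _ => p) q _ _ _ W) => //.
exact: (measurableT_comp mp).
Qed.

(** This turns out to be the probability that i is the first accepted batch. *)
Local Notation mass i :=
  (\sum_(k < n.+1) \int[P]_w (rejections i w * inv_total i k w)%:E)%E.

Lemma sample_ge C m : measurable C ->
  ((\int[nu]_(y in C) (p y)%:E) * \sum_(i < m) mass i <=
   P [set w | C (ERS_sample (W w) p q)])%E.
Proof.
move=> mC; have pC0 : (0 <= \int[nu]_(y in C) (p y)%:E)%E.
  by apply: integral_ge0 => y _; rewrite lee_fin.
have t0 i k w : 0 <= rejections i w * \1_C (Y i k w) * (wins false i k w)%:R.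
  by rewrite !mulr_ge0.
have mI i k : measurable_fun setT (fun w => (rejections i w * inv_total i k w)%:E).
  apply/measurable_EFinP; apply: measurable_funM; first exact: measurable_rejections.
  apply: (measurableT_comp measurable_invr); apply: measurable_funD => //.
  by apply: measurable_sum_cond => j _; exact: (measurableT_comp mlam).
rewrite ge0_sume_distrr; last first.
  move=> i _; apply: sume_ge0 => k _; apply: integral_ge0 => w _.
  by rewrite lee_fin mulr_ge0 ?inv_total_ge0.
under eq_bigr => i _.
  rewrite ge0_sume_distrr; last first.
    move=> k _; apply: integral_ge0 => w _.
    by rewrite lee_fin mulr_ge0 ?inv_total_ge0.
  under eq_bigr do rewrite -(win_probability false _ _ mC).
  rewrite -ge0_integral_sum//; first over.
  - by move=> k; exact: measurable_term.
  - by move=> k w _; rewrite lee_fin.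
rewrite -ge0_integral_sum//; last 2 first.
- by move=> i; apply: emeasurable_sum => k; exact: measurable_term.
- by move=> i w _; apply: sume_ge0 => k _; rewrite lee_fin.
have mYC : measurable [set w | C (ERS_sample (W w) p q)].
  by rewrite -[X in measurable X]setTI; exact: measurable_sample.
rewrite -[X in (_ <= P X)%E]setIT -integral_indic//.
apply: ge0_le_integral => //.
- by move=> w _; apply: sume_ge0 => i _; apply: sume_ge0 => k _; rewrite lee_fin.
- by apply: emeasurable_sum => i; apply: emeasurable_sum => k; exact: measurable_term.
- exact/measurable_EFinP/measurable_indic.
- move=> w _; under eq_bigr do rewrite sumEFin.
  rewrite sumEFin lee_fin.
  apply: le_trans; first by apply: ler_sum => i _; exact: wins_le_sample.
  rewrite -mulr_sumr; have -> : \sum_(i < m) (rejections i w - rejections i.+1 w) =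
      1 - rejections m w.
    elim: m => [|m' IH]; first by rewrite big_ord0 /rejections big_ord0 subrr.
    by rewrite big_ord_recr/= IH addrA subrK.
  by rewrite ler_piMr// gerBl.
Qed.

Let lty_unit (f : Om -> \bar R) : measurable_fun setT f ->
  (forall w, 0 <= f w <= 1)%E -> (\int[P]_w f w)%E \is a fin_num.
Proof.
move=> mf f01; rewrite ge0_fin_numE.
  apply: le_lt_trans (ltry 1); rewrite -[leRHS]mule1.
  rewrite -[X in (_ <= _ * X)%E](@probability_setT _ _ _ P).
  rewrite -integral_cst//; apply: ge0_le_integral => //.
  - by move=> w _; case/andP: (f01 w).
  - by move=> w _; case/andP: (f01 w).
by apply: integral_ge0 => w _; case/andP: (f01 w).
Qed.

Let measurable_mass i k :
  measurable_fun setT (fun w => (rejections i w * inv_total i k w)%:E).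
Proof.
apply/measurable_EFinP; apply: measurable_funM; first exact: measurable_rejections.
apply: (measurableT_comp measurable_invr); apply: measurable_funD => //.
by apply: measurable_sum_cond => j _; exact: (measurableT_comp mlam).
Qed.

Lemma ae_positive i :
  {ae P, forall w, (forall j, 0 < S i j w) /\ 0 < U i w}.
Proof.
have aeU : {ae P, forall w, 0 < U i w}.
  exists (U i @^-1` `]-oo, 0]%classic); split.
  - exact: measurable_funPTI.
  - transitivity (uniform_prob (@ltr01 R) `]-oo, 0]%classic).
      by case: crW => _ _ HU _; exact: HU.
    by rewrite uniform_cdf// lexx ler01.
  - by move=> w /= /negP; rewrite in_itv/= leNgt.
have aeS j : {ae P, forall w, 0 < S i j w}.
  have mS : measurable [set w | 0 < S i j w].
    rewrite (_ : [set w | _] = S i j @^-1` `]0, +oo[%classic).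
      exact: measurable_funPTI.
    by apply/seteqP; split => w /=; rewrite in_itv/= andbT.
  exists (~` [set w | 0 < S i j w]); split => //; first exact: measurableC.
  rewrite probability_setC//; have := exponential_tail false (0 : R).
  case: crW => _ HS _ _; rewrite -(HS i j)// maxxx oppr0 expR0.
  rewrite (_ : [set w | 0 < S i j w] = S i j @^-1` `]0, +oo[%classic).
    by move=> H; rewrite [X in (_ - X)%E]H subee.
  by apply/seteqP; split => w /=; rewrite in_itv/= andbT.
have aeS' : {ae P, forall w, forall j, 0 < S i j w} by exact: filter_forall.
by apply: filterS2 aeS' aeU => w.
Qed.

(** Only the lower bound p(C) <= P (sample in C) is proved directly, from strict wins in the first m
    batches with m tending to infinity. Applied to the complement of C as well, it becomes an
    equality because both total masses are 1. *)
Lemma sample_law C : measurable C ->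
  P [set w | C (ERS_sample (W w) p q)] = (\int[nu]_(y in C) (p y)%:E)%E.
Proof.
have [_ _ p1] := hp.
have r_fin i : (\int[P]_w (rejections i w)%:E)%E \is a fin_num.
  apply: (@lty_unit (fun w => (rejections i w)%:E)) => [|w].
    by apply/measurable_EFinP; exact: measurable_rejections.
  by rewrite !lee_fin rej0 rej1.
have m_fin i : mass i \is a fin_num.
  apply/sum_fin_numP => k _ _.
  apply: (@lty_unit (fun w => (rejections i w * inv_total i k w)%:E)) => // w.
  rewrite !lee_fin mulr_ge0 ?inv_total_ge0//= mulr_ile1 ?inv_total_ge0//.
  rewrite invf_le1; last by rewrite ltr_wpDr// sumr_ge0.
  by rewrite (le_trans omegaP_ge1)// lerDl sumr_ge0.
have m0 i : (0 <= mass i)%E.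
  apply: sume_ge0 => k _; apply: integral_ge0 => w _.
  by rewrite lee_fin mulr_ge0 ?inv_total_ge0.
pose r i := fine (\int[P]_w (rejections i w)%:E)%E.
pose a i := fine (mass i).
have rE i : (\int[P]_w (rejections i w)%:E = (r i)%:E)%E by rewrite fineK.
have aE i : mass i = (a i)%:E by rewrite /a fineK.
have termE b i : (\int[P]_w (\sum_k rejections i w * \1_setT (Y i k w) *
    (wins b i k w)%:R)%:E = mass i)%E.
  under eq_integral do rewrite -sumEFin.
  rewrite ge0_integral_sum//.
  - by apply: eq_bigr => k _; rewrite win_probability// p1 mul1e.
  - by move=> k; exact: measurable_term.
  - by move=> k w _; rewrite lee_fin !mulr_ge0.
have mterm b i : measurable_fun setT (fun w => (\sum_k rejections i w *
    \1_setT (Y i k w) * (wins b i k w)%:R)%:E).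
  under eq_fun do rewrite -sumEFin.
  by apply: emeasurable_sum => k; exact: measurable_term.
have mrej i : measurable_fun setT (fun w => (rejections i w)%:E).
  by apply/measurable_EFinP; exact: measurable_rejections.
have term0 b i w : 0 <= \sum_k rejections i w * \1_setT (Y i k w) * (wins b i k w)%:R.
  by rewrite sumr_ge0// => k _; rewrite !mulr_ge0.
have re0 i : forall w, [set: Om] w -> (0 <= (rejections i w)%:E)%E.
  by move=> w _; rewrite lee_fin.
have te0 b i : forall w, [set: Om] w -> (0 <= (\sum_k rejections i w *
    \1_setT (Y i k w) * (wins b i k w)%:R)%:E)%E.
  by move=> w _; rewrite lee_fin.
(* Weak races give this inequality and strict races give [down]; together r i = r i.+1 + a i, so the
   sums of the a i telescope. *)
have up i : r i <= r i.+1 + a i.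
  rewrite -lee_fin EFinD -!rE -aE -(termE true).
  rewrite -(ge0_integralD _ measurableT (re0 _) (mrej _) (te0 _ _))//.
  apply: ae_ge0_le_integral => //; first exact: re0.
  - by move=> w _; rewrite -EFinD lee_fin addr_ge0.
  - exact: emeasurable_funD.
  - apply: filterS (ae_positive i) => w [S0 U0] _.
    by rewrite -EFinD lee_fin rejections_le_wins.
have down i : r i.+1 + a i <= r i.
  rewrite -lee_fin EFinD -!rE -aE -(termE false).
  rewrite -(ge0_integralD _ measurableT (re0 _) (mrej _) (te0 _ _))//.
  apply: ge0_le_integral => //.
  - by move=> w _; rewrite -EFinD lee_fin addr_ge0.
  - exact: emeasurable_funD.
  - move=> w _; rewrite -EFinD lee_fin -lerBrDl.
    by apply: le_trans (wins_le_sample setT i w) _; rewrite indicT mul1r.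
have loss i : omp^-1 * r i <= a i.
  rewrite -lee_fin EFinM -rE -aE -(ge0_integralZl _ measurableT (mrej _) (re0 _));
    last by rewrite lee_fin invr_ge0 ltW.
  rewrite -ge0_integral_sum//; last by move=> k w _; rewrite lee_fin mulr_ge0 ?inv_total_ge0.
  apply: ge0_le_integral => //.
  - by move=> w _; rewrite -EFinM lee_fin mulr_ge0// invr_ge0 ltW.
  - exact: measurable_funeM.
  - exact: emeasurable_sum.
  - move=> w _; rewrite -EFinM sumEFin lee_fin -mulr_sumr mulrC.
    by apply: ler_wpM2l => //; exact: inv_total_sum.
have r1 : r 0%N = 1.
  apply/EFin_inj; rewrite -rE (eq_integral (cst 1%E)).
    by rewrite integral_cst// mul1e; exact: probability_setT.
  by move=> w _; rewrite /rejections big_ord0.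
pose s := 1 - omp^-1.
have s01 : 0 <= s < 1.
  by rewrite /s subr_ge0 invf_le1 ?omegaP_ge1//= ltrBlDr ltrDl invr_gt0.
have r_le i : r i <= s ^+ i.
  elim: i => [|i IH]; first by rewrite r1.
  rewrite exprS; apply: le_trans (_ : s * r i <= _); last first.
    by apply: ler_wpM2l => //; case/andP: s01.
  by rewrite /s mulrBl mul1r lerBrDr (le_trans _ (down i))// lerD2l.
have sum_ge m : 1 - s ^+ m <= \sum_(i < m) a i.
  apply: le_trans (_ : 1 - r m <= _); first by rewrite lerB.
  elim: m => [|m IH]; first by rewrite big_ord0 r1 subrr.
  rewrite big_ord_recr/=; apply: le_trans (lerD IH (lexx _)).
  by have := up m; lra.
have ge : forall C, measurable C -> (\int[nu]_(y in C) (p y)%:E <=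
    P [set w | C (ERS_sample (W w) p q)])%E.
  move=> {}C mC.
  have C0 : (0 <= \int[nu]_(y in C) (p y)%:E)%E.
    by apply: integral_ge0 => y _; rewrite lee_fin.
  have cfin : (\int[nu]_(y in C) (p y)%:E)%E \is a fin_num.
    rewrite ge0_fin_numE//; apply: le_lt_trans (ltry 1); rewrite -p1.
    by apply: ge0_subset_integral => //; [exact/measurable_EFinP|move=> y _; rewrite lee_fin].
  have mYC : measurable [set w | C (ERS_sample (W w) p q)].
    by rewrite -[X in measurable X]setTI; exact: measurable_sample.
  have xfin : P [set w | C (ERS_sample (W w) p q)] \is a fin_num by exact: fin_num_measure.
  rewrite -(fineK cfin) -(fineK xfin) lee_fin.
  apply: (le_of_geometric_bound s01) => m.
  rewrite -lee_fin (fineK xfin); apply: le_trans (sample_ge m mC).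
  under eq_bigr do rewrite aE.
  rewrite sumEFin EFinM (fineK cfin); apply: lee_wpmul2l => //.
  by rewrite lee_fin; exact: sum_ge.
move=> mC; apply/eqP; rewrite eq_le ge// andbT.
have mYC : measurable [set w | C (ERS_sample (W w) p q)].
  by rewrite -[X in measurable X]setTI; exact: measurable_sample.
have C0 D : (0 <= \int[nu]_(y in D) (p y)%:E)%E.
  by apply: integral_ge0 => y _; rewrite lee_fin.
have split1 : (\int[nu]_(y in C) (p y)%:E + \int[nu]_(y in ~` C) (p y)%:E = 1)%E.
  rewrite -ge0_integral_setU ?setUv//; first exact: measurableC.
  - exact/measurable_EFinP.
  - by move=> y _; rewrite lee_fin.
  - exact/disj_setPCl.
have := ge (~` C) (measurableC mC).
rewrite (_ : [set w | (~` C) _] = ~` [set w | C (ERS_sample (W w) p q)])//.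
rewrite probability_setC//.
rewrite -(fineK (fin_num_measure P _ mYC)); move: (fine (P _)) => x.
move: split1 (C0 C) (C0 (~` C)).
move: (\int[nu]_(y in C) _)%E (\int[nu]_(y in ~` C) _)%E.
move=> [y| |]// [z| |]//=.
by rewrite -EFinD -EFinB !lee_fin => -[] ? ? ? ?; lra.
Qed.

Lemma integral_sample (G : TY -> \bar R) : measurable_fun setT G ->
  (forall y, 0 <= G y)%E ->
  (\int[P]_w G (ERS_sample (W w) p q) = \int[nu]_y (G y * (p y)%:E))%E.
Proof.
move=> mG G0.
transitivity (\int[pushforward P (fun w => ERS_sample (W w) p q)]_y G y)%E.
  by rewrite (ge0_integral_pushforward measurable_sample).
apply: (ge0_integral_density
  (m := measure_function_pushforward__canonical__measure_function_Measure
    P measurable_sample)) => //.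
by move=> A mA; exact: sample_law.
Qed.

End law.

(** * The probability of a match in the first batch *)

Section real_inequalities.
Context {R : realType}.

Lemma tangent_inv (x t : R) : 0 < x -> 2 * t <= x^-1 + t ^+ 2 * x.
Proof.
move=> x0; rewrite -subr_ge0.
have -> : x^-1 + t ^+ 2 * x - 2 * t = (t * x - 1) ^+ 2 / x by field; rewrite gt_eqF.
by rewrite divr_ge0 ?sqr_ge0 ?ltW.
Qed.

(* AM-HM *)
Lemma inv_sum_le (I : finType) (p : pred I) (b : I -> R) (D : R) :
  (forall j, 0 <= b j) -> 0 < D -> \sum_(j | p j) b j <= D -> (0 < #|p|)%N ->
  ((D^-1)%:E <= ((#|p|%:R ^+ 2)^-1)%:E * \sum_(j | p j) ((b j)%:E)^-1)%E.
Proof.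
move=> b0 D0 bD p0; have m0 : 0 < #|p|%:R :> R by rewrite ltr0n.
have i0 j : (0 <= ((b j)%:E)^-1)%E by rewrite inve_ge0 lee_fin.
have [/exists_inP[j pj /eqP bj]|] := boolP [exists (j | p j), b j == 0].
  rewrite (bigD1 j)//= bj inve0 addye; last first.
    by rewrite gt_eqF// (@lt_le_trans _ _ 0%E)// sume_ge0.
  by rewrite gt0_muley ?leey// lte_fin invr_gt0 exprn_gt0.
rewrite negb_exists_in => /forall_inP bn.
have bp j : p j -> 0 < b j by move=> /bn bj; rewrite lt_neqAle eq_sym bj b0.
rewrite (eq_bigr (fun j => ((b j)^-1)%:E)) => [|j /bn bj]; last by rewrite inver (negbTE bj).
rewrite sumEFin -EFinM lee_fin mulrC ler_pdivlMr ?exprn_gt0//.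
(* The point where the tangent inequality is tight when all the b_j equal D / #|p|. *)
pose t := #|p|%:R / D.
have H : \sum_(j | p j) (2 * t) <= \sum_(j | p j) ((b j)^-1 + t ^+ 2 * b j).
  by apply: ler_sum => j pj; apply: tangent_inv; exact: bp.
move: H; rewrite sumr_const big_split/= -mulr_sumr -[(2 * t) *+ _]mulr_natr => H.
have K : t ^+ 2 * \sum_(j | p j) b j <= t ^+ 2 * D by rewrite ler_wpM2l ?sqr_ge0.
have E1 : 2 * t * #|p|%:R = 2 * (D^-1 * #|p|%:R ^+ 2) by rewrite /t; ring.
have E2 : t ^+ 2 * D = D^-1 * #|p|%:R ^+ 2 by rewrite /t; field; rewrite gt_eqF.
by move: H K; rewrite E1 E2; lra.
Qed.

(** With A = a + A' and B = b + B', the first factor is at most A / a + B / b, and the inverse of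
    the minimum is at most 1 + (omA - a) / A + (omB - b) / B, as both excesses are nonnegative. In
    the product each excess cancels against its own total, and only the mixed ratios A / B and B / A
    survive. *)
Lemma race_cost_le (a b A' B' omA omB om s : R) :
  0 < a -> 0 < b -> 0 <= A' -> 0 <= B' -> a <= omA -> b <= omB ->
  omA <= om -> omB <= om -> 0 <= s -> s <= A' / a + B' / b ->
  (1 + s) / Num.min ((a + A') / (A' + omA)) ((b + B') / (B' + omB)) <=
  a^-1 * (A' + om + om * ((a + A') / (b + B'))) +
  b^-1 * (B' + om + om * ((b + B') / (a + A'))).
Proof.
move=> a0 b0 A0 B0 aom bom Aom Bom s0 sAB.
set A := a + A'; set B := b + B'.
have A1 : 0 < A by rewrite ltr_pwDl. have B1 : 0 < B by rewrite ltr_pwDl.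
have An : A != 0 by rewrite gt_eqF.
have Bn : B != 0 by rewrite gt_eqF.
have an : a != 0 by rewrite gt_eqF.
have bn : b != 0 by rewrite gt_eqF.
have om0 : 0 < om by rewrite (lt_le_trans a0)// (le_trans aom).
have K : (Num.min (A / (A' + omA)) (B / (B' + omB)))^-1 <=
    1 + (omA - a) / A + (omB - b) / B.
  have EA : (A / (A' + omA))^-1 = 1 + (omA - a) / A.
    by rewrite invf_div -(divff An) /A -mulrDl; congr (_ / _); ring.
  have EB : (B / (B' + omB))^-1 = 1 + (omB - b) / B.
    by rewrite invf_div -(divff Bn) /B -mulrDl; congr (_ / _); ring.
  have pA : 0 <= (omA - a) / A by apply: divr_ge0; [rewrite subr_ge0|exact: ltW].
  have pB : 0 <= (omB - b) / B by apply: divr_ge0; [rewrite subr_ge0|exact: ltW].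
  by rewrite minEle; case: ifP => _; rewrite ?EA ?EB; lra.
apply: le_trans (_ : (A / a + B / b) * (1 + (omA - a) / A + (omB - b) / B) <= _).
  apply: ler_pM => //.
  - by rewrite addr_ge0.
  - rewrite invr_ge0 le_min !divr_ge0 ?ltW//; lra.
  - have -> : A / a + B / b = 1 + (A' / a + B' / b) + 1.
      by rewrite /A /B; field; rewrite an bn.
    lra.
have -> : (A / a + B / b) * (1 + (omA - a) / A + (omB - b) / B) =
   a^-1 * (A' + omA + (omB - b) * (A / B)) + b^-1 * (B' + omB + (omA - a) * (B / A)).
  by rewrite /A /B in An Bn *; field; rewrite An Bn an bn.
have AB0 : 0 <= A / B by rewrite divr_ge0 ?ltW.
have BA0 : 0 <= B / A by rewrite divr_ge0 ?ltW.
apply: lerD; (apply: ler_wpM2l; first by rewrite invr_ge0 ltW); apply: lerD.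
- by rewrite lerD2l.
- by apply: ler_wpM2r => //; lra.
- by rewrite lerD2l.
- by apply: ler_wpM2r => //; lra.
Qed.

End real_inequalities.

(** The conventions agree: where q = 0 both integrands are 0, and where p = 0 < q both are +oo. *)
Lemma d2_weight {R : realType} {d : measure_display} {T : measurableType d}
    (nu : {measure set T -> \bar R}) (p q : T -> R) :
  (forall y, 0 <= p y) -> (forall y, 0 <= q y) ->
  d2 nu q p = (\int[nu]_y (((weight p q y)%:E)^-1 * (q y)%:E))%E.
Proof.
move=> p0 q0; apply: eq_integral => y _.
have [->|qn] := eqVneq (q y) 0; first by rewrite mul0e mule0.
rewrite muleC; congr (_ * _)%E; rewrite /dratio /weight /dratio.
have qp : 0 < q y by rewrite lt_neqAle eq_sym qn q0.
have [->|pn] := eqVneq (p y) 0; first by rewrite mul0e inve0 gt0_muley ?lte_fin.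
by rewrite !inver (negbTE qn) (negbTE pn) /= mulf_eq0 invr_eq0 (negbTE qn) (negbTE pn) /= invf_div.
Qed.

Lemma ge0_integral_sum_cond {R : realType} {d : measure_display}
    {T : measurableType d} (mu : {measure set T -> \bar R}) (I : Type)
    (s : seq I) (p : pred I) (f : I -> T -> \bar R) :
  (forall i, measurable_fun setT (f i)) -> (forall i x, 0 <= f i x)%E ->
  (\int[mu]_x (\sum_(i <- s | p i) f i x) = \sum_(i <- s | p i) \int[mu]_x f i x)%E.
Proof.
move=> mf f0; rewrite -big_filter -ge0_integral_sum//.
by apply: eq_integral => x _; rewrite big_filter.
Qed.

Lemma emeasurable_sum_cond {R : realType} {d : measure_display}
    {T : measurableType d} (I : Type)
    (s : seq I) (p : pred I) (f : I -> T -> \bar R) :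
  (forall i, measurable_fun setT (f i)) ->
  measurable_fun setT (fun x => \sum_(i <- s | p i) f i x)%E.
Proof.
move=> mf; under eq_fun do rewrite -big_filter.
exact: emeasurable_sum.
Qed.

Section mean_ratio.
Context {R : realType} {d dY : measure_display} {Om : measurableType d}
  {TY : measurableType dY} {P : probability Om R} {n : nat}
  {nu : {measure set TY -> \bar R}} {q : TY -> R}
  {Y : nat -> 'I_n.+1 -> {RV P >-> TY}}
  {S : nat -> 'I_n.+1 -> {RV P >-> R}} {U : nat -> {RV P >-> R}}.
Hypothesis crW : common_randomness nu q Y S U.
Hypothesis hq : prob_density nu q.
Local Notation others := (@others _ _ _ _ _ P n Y S U).
Variables (p1 p2 : TY -> R) (om dd : R) (i : nat) (k : 'I_n.+1) (a b : R).
Hypotheses (hp1 : prob_density nu p1) (hp2 : prob_density nu p2).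
Hypothesis pq1 : forall y, (dratio p1 q y <= om%:E)%E.
Hypothesis pq2 : forall y, (dratio p2 q y <= om%:E)%E.
Hypothesis d2E : d2 nu q p2 = dd%:E.
Hypotheses (a0 : 0 < a) (b0 : 0 < b) (aom : a <= om) (n0 : (0 < n)%N).
Local Notation lam1 := (weight p1 q).
Local Notation lam2 := (weight p2 q).

Let q0 y : 0 <= q y. Proof. by case: hq. Qed.
Let p10 y : 0 <= p1 y. Proof. by case: hp1. Qed.
Let p20 y : 0 <= p2 y. Proof. by case: hp2. Qed.
Let l10 y : 0 <= lam1 y. Proof. exact: weight_ge0. Qed.
Let l20 y : 0 <= lam2 y. Proof. exact: weight_ge0. Qed.
Let ml1 : measurable_fun setT lam1. Proof. exact: (measurable_weight1 hq). Qed.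
Let ml2 : measurable_fun setT lam2. Proof. exact: (measurable_weight1 hq). Qed.
Let om0 : 0 < om. Proof. exact: lt_le_trans aom. Qed.
Let l1om y : lam1 y <= om.
Proof. by rewrite -lee_fin -(dratioE p10 q0 pq1). Qed.

Local Notation tot1 w := (\sum_(j | j != k) lam1 (Y i j w)).
Local Notation tot2 w := (\sum_(j | j != k) lam2 (Y i j w)).
Local Notation inv2 j w := (((lam2 (Y i j w))%:E)^-1)%E.

Let inv20 j w : (0 <= inv2 j w)%E. Proof. by rewrite inve_ge0 lee_fin. Qed.

Let minv2 j : measurable_fun setT (fun w => inv2 j w).
Proof.
apply: (measurableT_comp measurable_inve); apply/measurable_EFinP.
exact: (measurableT_comp ml2).
Qed.

Lemma mean_weight j : (\int[P]_w (lam1 (Y i j w))%:E = 1)%E.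
Proof.
rewrite (integral_Y crW hq i j (f := fun y => (lam1 y)%:E))//; last first.
  exact/measurable_EFinP.
have [_ _ <-] := hp1; apply: eq_integral => y _.
by rewrite -EFinM (weight_mulr p10 pq1).
Qed.

Lemma mean_inverse j : (\int[P]_w inv2 j w = dd%:E)%E.
Proof.
rewrite (integral_Y crW hq i j (f := fun y => ((lam2 y)%:E)^-1%E)).
- by rewrite -d2E d2_weight.
- by apply: (measurableT_comp measurable_inve); exact/measurable_EFinP.
- by move=> y; rewrite inve_ge0 lee_fin.
Qed.

(** With [Y i j] frozen, averaging over [Y i l] gives dd; the mean of [lam1] is 1. *)
Lemma mean_product j l : l != j ->
  (\int[P]_w ((lam1 (Y i j w))%:E * inv2 l w) = dd%:E)%E.
Proof.
move=> lj.
pose f (x : others (inl (inl (i, l))) * TY) : \bar R :=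
  ((lam1 (Y i j x.1))%:E * ((lam2 x.2)%:E)^-1)%E.
have mI : measurable_fun setT (fun y => ((lam2 y)%:E)^-1 * (q y)%:E)%E.
  apply: emeasurable_funM; last by apply/measurable_EFinP; case: hq.
  by apply: (measurableT_comp measurable_inve); exact/measurable_EFinP.
have I0 y : (0 <= ((lam2 y)%:E)^-1 * (q y)%:E)%E.
  by rewrite mule_ge0 ?inve_ge0 ?lee_fin.
rewrite (integrate_Y crW hq (f := f)).
- transitivity (\int[P]_w ((lam1 (Y i j w))%:E * dd%:E))%E.
    apply: eq_integral => w _; rewrite /f /=.
    under eq_integral do rewrite -muleA.
    by rewrite ge0_integralZl ?lee_fin// -d2_weight// d2E.
  rewrite ge0_integralZr//; last 3 first.
  + by apply/measurable_EFinP; exact: (measurableT_comp ml1).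
  + by move=> w _; rewrite lee_fin.
  + by rewrite -d2E integral_ge0// => y _; rewrite mule_ge0 ?lee_fin ?dratio_ge0.
  by rewrite mean_weight mul1e.
- apply: emeasurable_funM.
    apply/measurable_EFinP; apply: (measurableT_comp ml1).
    apply: (measurableT_comp _ (@measurable_fst _ _ _ _)).
    by apply: measurable_Y_others => -[lj']; rewrite lj' eqxx in lj.
  apply: (measurableT_comp measurable_inve); apply/measurable_EFinP.
  exact: (measurableT_comp ml2 (@measurable_snd _ _ _ _)).
- by move=> x; rewrite /f mule_ge0 ?inve_ge0 ?lee_fin.
Qed.

(** There are n = N - 1 entries other than k. For the summand a <= om of the numerator, the harmonic
    bound over all n entries gives (om / n) dd. For a summand lam1 (Y_j), entry j is first dropped
    from the denominator, so that the numerator becomes independent of the n - 1 inverse weights in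
    the harmonic bound. *)
Lemma mean_ratio :
  (\int[P]_w ((a + tot1 w) / (b + tot2 w))%:E <=
   ((II n.+1 om 2 + om / n%:R) * dd)%:E)%E.
Proof.
have dd0 : 0 <= dd.
  rewrite -lee_fin -d2E; apply: integral_ge0 => y _.
  by rewrite mule_ge0 ?lee_fin ?dratio_ge0.
have D0 w : 0 < b + tot2 w by rewrite ltr_pwDl// sumr_ge0.
have mt1 : measurable_fun setT (fun w => tot1 w).
  by apply: measurable_sum_cond => j _; exact: (measurableT_comp ml1).
have mt2 : measurable_fun setT (fun w => tot2 w).
  by apply: measurable_sum_cond => j _; exact: (measurableT_comp ml2).
have t10 w : 0 <= tot1 w by exact: sumr_ge0.
have r0 w : 0 <= (a + tot1 w) / (b + tot2 w).
  by apply: divr_ge0; [apply: addr_ge0; [exact: ltW|exact: t10]|exact: ltW].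
have mr : measurable_fun setT (fun w => ((a + tot1 w) / (b + tot2 w))%:E).
  apply/measurable_EFinP; apply: measurable_funM; first exact: measurable_funD.
  by apply: (measurableT_comp measurable_invr); exact: measurable_funD.
have cardk : #|predC1 k| = n by rewrite cardC1 card_ord.
have s20 w : (0 <= \sum_(l | l != k) inv2 l w)%E by exact: sume_ge0.
have int1 : (\int[P]_w \sum_(l | l != k) inv2 l w = (n%:R * dd)%:E)%E.
  rewrite ge0_integral_sum_cond// (eq_bigr (fun=> dd%:E)) => [|l _].
    by rewrite sumEFin sumr_const cardk mulr_natl.
  exact: mean_inverse.
have ms2 : measurable_fun setT (fun w => \sum_(l | l != k) inv2 l w)%E.
  exact: emeasurable_sum_cond.
have amhm w : (((b + tot2 w)^-1)%:E <=
    ((n%:R ^+ 2)^-1)%:E * \sum_(l | l != k) inv2 l w)%E.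
  have := @inv_sum_le R _ (predC1 k) (fun l => lam2 (Y i l w)) (b + tot2 w).
  by rewrite cardk; apply => //; rewrite lerDr ltW.
(* For n = 1, dropping j would leave no weight for the harmonic bound. The numerator is bounded by 2
   om instead, which is the claimed constant because [II] is then om: this is the origin of the case
   N = 2. *)
have [n1|n1] := eqVneq n 1%N.
  have cE : (n%:R ^+ 2)^-1 = 1 :> R by rewrite n1 expr1n invr1.
  apply: le_trans (_ : \int[P]_w ((2 * om)%:E * \sum_(l | l != k) inv2 l w) <= _)%E.
    apply: ge0_le_integral => //.
    - by move=> w _; rewrite lee_fin.
    - exact: measurable_funeM.
    - move=> w _; rewrite EFinM; apply: lee_pmul => //.
      + by rewrite lee_fin addr_ge0 ?t10// ltW.
      + by rewrite lee_fin invr_ge0 ltW.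
      + rewrite lee_fin mulr_natl mulr2n lerD//.
        apply: le_trans (_ : \sum_(j | j != k) om <= _); first exact: ler_sum.
        by rewrite sumr_const cardk n1.
      + by have := amhm w; rewrite cE mul1e.
  rewrite ge0_integralZl//; last by rewrite lee_fin mulr_ge0// ltW.
  rewrite int1 -EFinM lee_fin n1 /II ltnn eqxx mulr0 add0r mulr1 divr1.
  by rewrite mul1r mulr_natl mulr2n.
have n2 : (1 < n)%N by case: (n) n0 n1 => [|[|]].
pose c := ((n.-1%:R ^+ 2)^-1 : R).
have c0 : 0 <= c by rewrite invr_ge0 exprn_ge0.
have amhm2 j w : j != k -> (((b + tot2 w)^-1)%:E <=
    c%:E * \sum_(l | (l != j) && (l != k)) inv2 l w)%E.
  move=> jk; have card2 : #|[predD1 predC1 k & j]| = n.-1.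
    by have /(congr1 predn) := cardD1 j (predC1 k); rewrite cardk inE /= jk add1n /= => ->.
  have := @inv_sum_le R _ [predD1 predC1 k & j] (fun l => lam2 (Y i l w)) (b + tot2 w).
  rewrite card2; apply => //; last by case: (n) n2 => [|[]].
    apply: le_trans (_ : tot2 w <= _); last by rewrite lerDr ltW.
    rewrite [leRHS](bigID (fun l => l != j))/=.
    rewrite (eq_bigl (fun l => (l != k) && (l != j))) ?lerDl ?sumr_ge0//.
    by move=> l /=; rewrite andbC.
pose g w := (om%:E * (((n%:R ^+ 2)^-1)%:E * \sum_(l | l != k) inv2 l w))%E.
pose h w := (\sum_(j | j != k) \sum_(l | (l != j) && (l != k))
  c%:E * ((lam1 (Y i j w))%:E * inv2 l w))%E.
have mlam1 j : measurable_fun setT (fun w => (lam1 (Y i j w))%:E).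
  by apply/measurable_EFinP; exact: (measurableT_comp ml1).
have mterm j l : measurable_fun setT (fun w => c%:E * ((lam1 (Y i j w))%:E * inv2 l w))%E.
  by apply: measurable_funeM; exact: emeasurable_funM.
have term0 j l w : (0 <= c%:E * ((lam1 (Y i j w))%:E * inv2 l w))%E.
  by rewrite !mule_ge0 ?lee_fin.
have g0 w : (0 <= g w)%E.
  by rewrite !mule_ge0// ?lee_fin ?invr_ge0 ?exprn_ge0// ltW.
have h0 w : (0 <= h w)%E by apply: sume_ge0 => j _; exact: sume_ge0.
have mg : measurable_fun setT g by do 2 apply: measurable_funeM.
have mh : measurable_fun setT h.
  by apply: emeasurable_sum_cond => j; exact: emeasurable_sum_cond.
apply: le_trans (_ : \int[P]_w (g w + h w) <= _)%E.
  apply: ge0_le_integral => //.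
  - by move=> w _; rewrite lee_fin.
  - exact: emeasurable_funD.
  - move=> w _; rewrite mulrDl EFinD; apply: leeD.
      rewrite /g EFinM; apply: lee_pmul => //; rewrite lee_fin ?invr_ge0 ltW//.
    rewrite mulr_suml -sumEFin; apply: lee_sum => j jk.
    rewrite -ge0_sume_distrr// => [|l _]; last by rewrite mule_ge0 ?lee_fin.
    rewrite -ge0_sume_distrr// muleCA EFinM.
    by apply: lee_wpmul2l; [rewrite lee_fin|exact: amhm2].
rewrite ge0_integralD//.
rewrite /g !ge0_integralZl//; last 3 first.
- exact: measurable_funeM.
- by move=> w _; rewrite mule_ge0// lee_fin invr_ge0 exprn_ge0.
- by rewrite lee_fin ltW.
rewrite int1 -!EFinM /h ge0_integral_sum_cond//; last 2 first.
- by move=> j; exact: emeasurable_sum_cond.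
- by move=> j w; exact: sume_ge0.
rewrite (eq_bigr (fun=> (c * (n.-1%:R * dd))%:E)) => [|j jk]; last first.
  rewrite ge0_integral_sum_cond//.
  rewrite (eq_bigr (fun=> (c * dd)%:E)) => [|l /andP[lj _]].
    rewrite sumEFin sumr_const (_ : #|_| = n.-1) ?mulr_natl ?mulrnAr//.
    have /(congr1 predn) := cardD1 j (predC1 k).
    rewrite cardk inE /= jk add1n /= => ->.
    by apply: eq_card => l; rewrite !inE.
  rewrite ge0_integralZl//; last 2 first.
  - exact: emeasurable_funM.
  - by move=> w _; rewrite mule_ge0 ?lee_fin.
  by rewrite mean_product// EFinM.
rewrite sumEFin sumr_const cardk -EFinD lee_fin /II ltnS n2 eqSS (negbTE n1).
have nn : (n%:R : R) = n.-1%:R + 1 by rewrite natr1 prednK.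
have m0 : 1 <= (n.-1%:R : R) by rewrite ler1n; case: (n) n2 => [|[]].
have nn0 : (n%:R : R) != 0 by rewrite pnatr_eq0 -lt0n.
(* The sum over j contributes n / (n - 1) times dd, at most 2 dd since n >= 2: this is the 2 of
   [II]. *)
rewrite mulr1 mulr0 addr0 mulrDl [leLHS]addrC; apply: lerD.
  rewrite /c -[_ *+ n]mulr_natl nn.
  have -> : (n.-1%:R + 1) * ((n.-1%:R ^+ 2)^-1 * (n.-1%:R * dd)) =
    (1 + (n.-1%:R)^-1) * dd by field; rewrite gt_eqF// (lt_le_trans ltr01).
  apply: ler_wpM2r => //; rewrite -[leRHS](_ : 1 + 1 = _)// lerD2l.
  by rewrite invf_le1// (lt_le_trans ltr01).
rewrite le_eqVlt; apply/orP; left; apply/eqP; field.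
by rewrite nn0.
Qed.

Lemma mean_cost :
  (\int[P]_w (a^-1 * (tot1 w + om + om * ((a + tot1 w) / (b + tot2 w))))%:E <=
   (a^-1 * (n%:R + om + om * ((II n.+1 om 2 + om / n%:R) * dd)))%:E)%E.
Proof.
have mt1 : measurable_fun setT (fun w => tot1 w).
  by apply: measurable_sum_cond => j _; exact: (measurableT_comp ml1).
have mt2 : measurable_fun setT (fun w => tot2 w).
  by apply: measurable_sum_cond => j _; exact: (measurableT_comp ml2).
have t10 w : 0 <= tot1 w by exact: sumr_ge0.
have t20 w : 0 <= tot2 w by exact: sumr_ge0.
have mr : measurable_fun setT (fun w => ((a + tot1 w) / (b + tot2 w))%:E).
  apply/measurable_EFinP; apply: measurable_funM; first exact: measurable_funD.
  by apply: (measurableT_comp measurable_invr); exact: measurable_funD.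
have r0 w : 0 <= (a + tot1 w) / (b + tot2 w).
  apply: divr_ge0; first by apply: addr_ge0; [exact: ltW|exact: t10].
  by apply: addr_ge0; [exact: ltW|exact: t20].
have E w : (a^-1 * (tot1 w + om + om * ((a + tot1 w) / (b + tot2 w))))%:E =
   (a^-1%:E * (((tot1 w)%:E + om%:E) + om%:E * ((a + tot1 w) / (b + tot2 w))%:E))%E.
  by [].
under eq_integral do rewrite E.
rewrite ge0_integralZl//; last 3 first.
- apply: emeasurable_funD; last exact: measurable_funeM.
  by apply: emeasurable_funD => //; exact/measurable_EFinP.
- move=> w _; rewrite -EFinM -!EFinD lee_fin; apply: addr_ge0.
    by apply: addr_ge0; [exact: t10|exact: ltW].
  by apply: mulr_ge0; [exact: ltW|exact: r0].
- by rewrite lee_fin invr_ge0 ltW.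
rewrite EFinM; apply: lee_wpmul2l; first by rewrite lee_fin invr_ge0 ltW.
rewrite ge0_integralD//; last 4 first.
- by move=> w _; rewrite -EFinD lee_fin addr_ge0 ?t10// ltW.
- by apply: emeasurable_funD => //; exact/measurable_EFinP.
- by move=> w _; rewrite -EFinM lee_fin mulr_ge0 ?r0// ltW.
- exact: measurable_funeM.
rewrite !EFinD; apply: leeD.
  rewrite ge0_integralD//; last 3 first.
  - by move=> w _; rewrite lee_fin t10.
  - exact/measurable_EFinP.
  - by move=> w _; rewrite lee_fin ltW.
  apply: leeD; last first.
    rewrite integral_cst// [X in (_ * X <= _)%E](_ : _ = 1%E) ?mule1//.
    exact: probability_setT.
  under eq_integral do rewrite -sumEFin.
  have mlam1 j : measurable_fun setT (fun w => (lam1 (Y i j w))%:E).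
    by apply/measurable_EFinP; exact: (measurableT_comp ml1).
  rewrite ge0_integral_sum_cond//; last by move=> j w; rewrite lee_fin.
  rewrite (eq_bigr (fun=> 1%:E)) => [|j _]; last exact: mean_weight.
  by rewrite sumEFin lee_fin sumr_const cardC1 card_ord.
rewrite ge0_integralZl//; last 2 first.
- by move=> w _; rewrite lee_fin r0.
- by rewrite lee_fin ltW.
rewrite EFinM; apply: lee_wpmul2l; first by rewrite lee_fin ltW.
exact: mean_ratio.
Qed.

End mean_ratio.

Section bound.
Context {R : realType} {d : measure_display} {T : measurableType d}
  (nu : {measure set T -> \bar R}) (q : T -> R).
Hypothesis q0 : forall y, 0 <= q y.

Lemma d2_ge0 p : (forall y, 0 <= p y) -> (0 <= d2 nu q p)%E.
Proof.
by move=> p0; apply: integral_ge0 => y _; rewrite mule_ge0 ?lee_fin ?dratio_ge0.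
Qed.

Lemma II_ge0 N (om : R) i : 0 <= om -> 0 <= II N om i.
Proof. by move=> om0; rewrite /II addr_ge0 ?mulr_ge0. Qed.

Lemma mu'_ge0 p om N : (forall y, 0 <= p y) -> 0 <= om ->
  (0 <= mu' nu q p om N)%E.
Proof.
move=> p0 om0; rewrite /mu' mule_ge0 ?lee_fin// !adde_ge0 ?lee_fin//.
  by rewrite mule_ge0 ?d2_ge0// lee_fin mulr_ge0 ?II_ge0.
by rewrite mule_ge0 ?d2_ge0// lee_fin divr_ge0 ?exprn_ge0.
Qed.

(** For N >= 2 the coefficients of [d2] are positive, so an infinite divergence does make the bound
    trivial. *)
Lemma mu'_pinfty p om n : (forall y, 0 <= p y) -> 0 < om -> (0 < n)%N ->
  d2 nu q p = +oo%E -> mu' nu q p om n.+1 = +oo%E.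
Proof.
move=> p0 om0 n0 dy; rewrite /mu' dy.
have II0 : 0 < II n.+1 om 2.
  case: (n) n0 => [|[|m]]// _; rewrite /II.
    by rewrite ltnn eqxx mulr0 add0r mulr1.
  by rewrite !ltnS leq0n !eqSS mulr0 addr0 mulr1.
rewrite gt0_muley ?lte_fin ?mulr_gt0// gt0_muley ?lte_fin ?divr_gt0 ?exprn_gt0 ?ltr0n//.
by rewrite addey// gt0_muley ?lte_fin ?invr_gt0 ?ltr0n.
Qed.

Lemma mu'_fin p om N dd : d2 nu q p = dd%:E ->
  mu' nu q p om N =
  (N%:R^-1 * (om + om * II N om 2 * dd + om ^+ 2 / N.-1%:R * dd))%:E.
Proof. by move=> dE; rewrite /mu' dE. Qed.

Lemma matching_bound_ge0 pA pB om N y : (forall y, 0 <= pA y) ->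
  (forall y, 0 <= pB y) -> 0 <= om ->
  (0 <= matching_bound nu q pA pB om N y)%E.
Proof.
move=> pA0 pB0 om0; rewrite /matching_bound inve_ge0.
apply: adde_ge0; first by apply: adde_ge0 => //; exact: mu'_ge0.
apply: mule_ge0; first exact: dratio_ge0.
by apply: adde_ge0 => //; exact: mu'_ge0.
Qed.
End bound.

(* Entry k of the batch b, with value y, is the strict winner of both races and
   is accepted by both parties. The value is a separate argument, and (b.1 k).1
   is not used, so that y can be frozen while the rest of b is integrated. *)
Definition matched {R : realType} {T : Type} {n : nat} (pA pB q : T -> R)
    (k : 'I_n.+1) (y : T) (b : ('I_n.+1 -> T * R) * R) : bool :=
  [&& 0 < weight pA q y, 0 < weight pB q y,
    [forall (j | j != k), (b.1 j).2 \in Interval (BSide false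
      ((b.1 k).2 * Num.max (weight pA q (b.1 j).1 / weight pA q y)
                           (weight pB q (b.1 j).1 / weight pB q y))) +oo%O],
    b.2 <= (weight pA q y + \sum_(j | j != k) weight pA q (b.1 j).1) /
           (\sum_(j | j != k) weight pA q (b.1 j).1 + omegaP pA q) &
    b.2 <= (weight pB q y + \sum_(j | j != k) weight pB q (b.1 j).1) /
           (\sum_(j | j != k) weight pB q (b.1 j).1 + omegaP pB q)].

Section matched_probability.
Context {R : realType} {d dY : measure_display} {Om : measurableType d}
  {TY : measurableType dY} {P : probability Om R} {n : nat}
  {nu : {measure set TY -> \bar R}} {q : TY -> R}
  {Y : nat -> 'I_n.+1 -> {RV P >-> TY}}
  {S : nat -> 'I_n.+1 -> {RV P >-> R}} {U : nat -> {RV P >-> R}}.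
Hypothesis crW : common_randomness nu q Y S U.
Hypothesis hq : prob_density nu q.
Local Notation others := (@others _ _ _ _ _ P n Y S U).
Local Notation W := (W_of Y S U).
Variables (pA pB : TY -> R) (om : R) (k : 'I_n.+1) (y : TY).
Hypotheses (hA : prob_density nu pA) (hB : prob_density nu pB).
Hypothesis pqA : forall y, (dratio pA q y <= om%:E)%E.
Hypothesis pqB : forall y, (dratio pB q y <= om%:E)%E.
Hypothesis n0 : (0 < n)%N.
Local Notation lamA := (weight pA q).
Local Notation lamB := (weight pB q).
Local Notation omA := (omegaP pA q).
Local Notation omB := (omegaP pB q).
Local Notation totA w := (\sum_(j | j != k) lamA (Y 0%N j w)).
Local Notation totB w := (\sum_(j | j != k) lamB (Y 0%N j w)).

Let q0 z : 0 <= q z. Proof. by case: hq. Qed.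
Let pA0 z : 0 <= pA z. Proof. by case: hA. Qed.
Let pB0 z : 0 <= pB z. Proof. by case: hB. Qed.
Let lA0 z : 0 <= lamA z. Proof. exact: weight_ge0. Qed.
Let lB0 z : 0 <= lamB z. Proof. exact: weight_ge0. Qed.
Let mlA : measurable_fun setT lamA. Proof. exact: (measurable_weight1 hq). Qed.
Let mlB : measurable_fun setT lamB. Proof. exact: (measurable_weight1 hq). Qed.

Section positive.
Hypotheses (a0 : 0 < lamA y) (b0 : 0 < lamB y).
Local Notation a := (lamA y).
Local Notation b := (lamB y).
Local Notation c j w := (Num.max (lamA (Y 0%N j w) / a) (lamB (Y 0%N j w) / b)).
Local Notation accept w := (Num.min ((a + totA w) / (totA w + omA))
                                    ((b + totB w) / (totB w + omB))).

Let aA : a <= omA. Proof. exact: (weight_le_omegaP pA0 q0 pqA). Qed.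
Let bB : b <= omB. Proof. exact: (weight_le_omegaP pB0 q0 pqB). Qed.
Let Aom : omA <= om. Proof. exact: (omegaP_le pA0 q0 pqA point). Qed.
Let Bom : omB <= om. Proof. exact: (omegaP_le pB0 q0 pqB point). Qed.
Let tA0 w : 0 <= totA w. Proof. exact: sumr_ge0. Qed.
Let tB0 w : 0 <= totB w. Proof. exact: sumr_ge0. Qed.

Let mlA' s j : s <> inl (inl (0%N, j)) ->
  measurable_fun setT (fun w : others s => lamA (Y 0%N j w)).
Proof. by move=> sj; apply: (measurableT_comp mlA); exact: measurable_Y_others. Qed.
Let mlB' s j : s <> inl (inl (0%N, j)) ->
  measurable_fun setT (fun w : others s => lamB (Y 0%N j w)).
Proof. by move=> sj; apply: (measurableT_comp mlB); exact: measurable_Y_others. Qed.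

Let accept01 w : 0 <= accept w <= 1.
Proof.
have H (e x om' : R) : 0 < e -> 0 <= x -> e <= om' -> 0 <= (e + x) / (x + om') <= 1.
  move=> e0 x0 eo; apply/andP; split; first by apply: divr_ge0; lra.
  by rewrite ler_pdivrMr ?mul1r; lra.
have /andP[hA0 hA1] := H _ _ _ a0 (tA0 w) aA.
have /andP[hB0 hB1] := H _ _ _ b0 (tB0 w) bB.
by rewrite le_min hA0 hB0/= ge_min hA1.
Qed.

Let accept_gt0 w : 0 < accept w.
Proof.
rewrite lt_min; apply/andP; split; apply: divr_gt0.
- exact: ltr_pwDl.
- by apply: ltr_wpDl => //; exact: lt_le_trans aA.
- exact: ltr_pwDl.
- by apply: ltr_wpDl => //; exact: lt_le_trans bB.
Qed.

Let maccept s : (forall j, s <> inl (inl (0%N, j))) ->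
  measurable_fun setT (fun w : others s => accept w).
Proof.
move=> sj; have mA : measurable_fun setT (fun w : others s => totA w).
  by apply: measurable_sum_cond => j _; exact: mlA'.
have mB : measurable_fun setT (fun w : others s => totB w).
  by apply: measurable_sum_cond => j _; exact: mlB'.
apply: measurable_minr; apply: measurable_funM; try exact: measurable_funD;
  by apply: (measurableT_comp measurable_invr); exact: measurable_funD.
Qed.

Let mc s j : (forall j, s <> inl (inl (0%N, j))) ->
  measurable_fun setT (fun w : others s => c j w).
Proof.
move=> sj; apply: measurable_maxr; apply: measurable_funM => //.
  exact: mlA'.
exact: mlB'.
Qed.

Let c0 j w : 0 <= c j w.
Proof. by rewrite le_max divr_ge0// ltW. Qed.

(** Winning two races with the same exponentials is one race against the larger ratios, and passing
    two tests with the same uniform variable is one test against the smaller threshold. *)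
Lemma integral_matched : (\int[P]_w (matched pA pB q k y (W w 0%N))%:R%:E =
  \int[P]_w ((1 + \sum_(j | j != k) c j w) / accept w)^-1%:E)%E.
Proof.
pose beats j w := S 0%N j w \in Interval (BSide false (S 0%N k w * c j w)) +oo%O.
transitivity (\int[P]_w ((\prod_(j | j != k) (beats j w)%:R)%:E *
    (U 0%N w <= accept w)%R%:R%:E))%E.
  apply: eq_integral => w _; rewrite -EFinM /matched a0 b0/= -[X in _ && X]le_min.
  by rewrite -mulnb natrM natr_forall.
rewrite (integrate_U crW)//; first last.
- by move=> w; rewrite lee_fin prodr_ge0.
- exact: maccept.
- apply/measurable_EFinP; apply: measurable_prod_cond => j _.
  apply: measurable_side; first exact: measurable_S_others.
  by apply: measurable_funM; [exact: measurable_S_others|exact: mc].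
under eq_integral do rewrite muleC.
rewrite (race crW (i := 0%N) false k (c := fun j w => c j w))//; first last.
- by move=> j; apply/measurable_EFinP; exact: maccept.
- by move=> w; rewrite lee_fin; case/andP: (accept01 w).
- by move=> j j'; exact: mc.
by apply: eq_integral => w _; rewrite -EFinM invf_div.
Qed.

(** [tau] is the left-hand side and M = 1 / tau bounds the mean of [XA] + [XB], hence that of [V].
    The tangent at tau then gives E [1 / V] >= 2 tau - tau^2 M = tau. *)
Lemma matched_probability_fin dA dB :
  d2 nu q pA = dA%:E -> d2 nu q pB = dB%:E ->
  (matching_bound nu q pA pB om n.+1 y * (n.+1%:R^-1 * a)%:E <=
   \int[P]_w (matched pA pB q k y (W w 0%N))%:R%:E)%E.
Proof.
move=> dAE dBE.
have om0 : 0 < om by rewrite (lt_le_trans a0)// (le_trans aA).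
have dA0 : 0 <= dA by rewrite -lee_fin -dAE d2_ge0.
have dB0 : 0 <= dB by rewrite -lee_fin -dBE d2_ge0.
pose N : R := n.+1%:R.
have N0 : 0 < N by rewrite ltr0n.
have nN : N = n%:R + 1 by rewrite natr1.
have nR : 0 < n%:R :> R by rewrite ltr0n.
pose m e := N^-1 * (om + om * II n.+1 om 2 * e + om ^+ 2 / n%:R * e).
have m0 e : 0 <= e -> 0 <= m e.
  move=> e0; apply: mulr_ge0; first by rewrite invr_ge0 ltW.
  apply: addr_ge0; first apply: addr_ge0; first exact: ltW.
    by rewrite !mulr_ge0// ?II_ge0 ?ltW.
  by rewrite mulr_ge0// divr_ge0 ?exprn_ge0// ltW.
have qy : 0 < q y.
  rewrite lt_neqAle q0 andbT eq_sym; apply/eqP => qy.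
  have := weight_mulr pA0 pqA y; rewrite qy mulr0 => pAy.
  by move: a0; rewrite /weight /dratio -pAy mul0e ltxx.
have dr : dratio pA pB y = (a / b)%:E.
  rewrite /dratio -(weight_mulr pA0 pqA) -(weight_mulr pB0 pqB) inver.
  rewrite mulf_eq0 (gt_eqF b0) (gt_eqF qy)/= -EFinM; congr (_%:E).
  by field; rewrite (gt_eqF b0) (gt_eqF qy).
pose tau := ((1 + m dB + a / b * (1 + m dA))^-1) * (N^-1 * a).
pose M := N * ((1 + m dB) / a + (1 + m dA) / b).
have M0 : 0 < M.
  by rewrite mulr_gt0// addr_gt0// divr_gt0// ltr_pwDl// m0.
have den0 : 0 < 1 + m dB + a / b * (1 + m dA).
  have mA1 : 0 <= 1 + m dA by rewrite addr_ge0 ?m0.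
  by apply: ltr_wpDr; [rewrite mulr_ge0// divr_ge0// ltW|rewrite ltr_pwDl ?m0].
have an : a != 0 by rewrite gt_eqF.
have bn : b != 0 by rewrite gt_eqF.
have tauM : tau = M^-1.
  have -> : M = N * ((1 + m dB + a / b * (1 + m dA)) / a).
    by rewrite /M; move: (m dA) (m dB) => u v; field; rewrite an bn.
  by rewrite /tau !invfM invrK mulrCA.
apply: (@le_trans _ _ tau%:E).
  rewrite /matching_bound dr (mu'_fin _ _ dAE) (mu'_fin _ _ dBE).
  rewrite [X in (X^-1)%E](_ : _ = (1 + m dB + a / b * (1 + m dA))%:E)//.
  by rewrite inver gt_eqF// -EFinM.
rewrite integral_matched.
pose V w := (1 + \sum_(j | j != k) c j w) / accept w.
pose XA w := a^-1 * (totA w + om + om * ((a + totA w) / (b + totB w))).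
pose XB w := b^-1 * (totB w + om + om * ((b + totB w) / (a + totA w))).
have V0 w : 0 < V w by rewrite divr_gt0// ltr_pwDl// sumr_ge0.
have VX w : V w <= XA w + XB w.
  apply: race_cost_le => //; first exact: sumr_ge0.
  rewrite !mulr_suml -big_split/=; apply: ler_sum => j _.
  by rewrite ge_max lerDl lerDr !divr_ge0// ltW.
have mtA : measurable_fun setT (fun w => totA w).
  by apply: measurable_sum_cond => j _; exact: (measurableT_comp mlA).
have mtB : measurable_fun setT (fun w => totB w).
  by apply: measurable_sum_cond => j _; exact: (measurableT_comp mlB).
have mc1 : measurable_fun setT (fun w => 1 + \sum_(j | j != k) c j w).
  apply: measurable_funD => //; apply: measurable_sum_cond => j _.
  by apply: measurable_maxr; apply: measurable_funM => //; exact: measurableT_comp.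
have mV : measurable_fun setT (fun w => ((V w)^-1)%:E).
  apply/measurable_EFinP; apply: (measurableT_comp measurable_invr).
  apply: measurable_funM => //; apply: (measurableT_comp measurable_invr).
  exact: (measurable_others (s := inr 0%N)) (maccept _).
have mXA : measurable_fun setT (fun w => (XA w)%:E).
  apply/measurable_EFinP; apply: measurable_funM => //; apply: measurable_funD.
    exact: measurable_funD.
  apply: measurable_funM => //; apply: measurable_funM; first exact: measurable_funD.
  by apply: (measurableT_comp measurable_invr); exact: measurable_funD.
have mXB : measurable_fun setT (fun w => (XB w)%:E).
  apply/measurable_EFinP; apply: measurable_funM => //; apply: measurable_funD.
    exact: measurable_funD.
  apply: measurable_funM => //; apply: measurable_funM; first exact: measurable_funD.
  by apply: (measurableT_comp measurable_invr); exact: measurable_funD.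
have X0 (e f t u : R) : 0 < e -> 0 < f -> 0 <= t -> 0 <= u ->
    0 <= e^-1 * (t + om + om * ((e + t) / (f + u))).
  move=> e0 f0 t0 u0; apply: mulr_ge0; first by rewrite invr_ge0 ltW.
  apply: addr_ge0; first by apply: addr_ge0 => //; exact: ltW.
  by apply: mulr_ge0; [exact: ltW|apply: divr_ge0; apply: addr_ge0 => //; exact: ltW].
have XA0 w : 0 <= XA w by exact: X0.
have XB0 w : 0 <= XB w by exact: X0.
have tau0 : 0 < tau by rewrite tauM invr_gt0.
have EX : (\int[P]_w (XA w + XB w)%:E <= M%:E)%E.
  under eq_integral do rewrite EFinD.
  rewrite ge0_integralD//; last 2 first.
  - by move=> w _; rewrite lee_fin.
  - by move=> w _; rewrite lee_fin.
  apply: le_trans; first apply: leeD.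
  - exact: (mean_cost crW hq 0%N k hA hB pqA dBE a0 b0 (le_trans aA Aom) n0).
  - exact: (mean_cost crW hq 0%N k hB hA pqB dAE b0 a0 (le_trans bB Bom) n0).
  have -> : M = a^-1 * (N * (1 + m dB)) + b^-1 * (N * (1 + m dA)).
    by rewrite /M; move: (m dA) (m dB) => u v; ring.
  rewrite -EFinD lee_fin.
  have NE e : N * (1 + m e) = n%:R + 1 + om + om * II n.+1 om 2 * e + om ^+ 2 / n%:R * e.
    by rewrite /m mulrDr mulr1 mulrA divff ?gt_eqF// mul1r nN !addrA.
  (* The n other weights have total mean n, while N = n + 1 stands in the target; the missing 1 is
     slack. *)
  have le e : n%:R + om + om * ((II n.+1 om 2 + om / n%:R) * e) <= N * (1 + m e).
    by rewrite NE mulrDl mulrDr expr2 !mulrA; lra.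
  by apply: lerD; apply: ler_wpM2l => //; rewrite invr_ge0 ltW.
have XAB0 w : 0 <= XA w + XB w by rewrite addr_ge0.
have mX : measurable_fun setT (fun w => (XA w + XB w)%:E).
  by apply/measurable_EFinP; apply: measurable_funD; exact/measurable_EFinP.
have tau2 : (0 <= (tau ^+ 2)%:E :> \bar R)%E by rewrite lee_fin sqr_ge0.
(* The quadratic term stays on the right, so that nothing is subtracted in [\bar R] until it is
   known to be at most tau. *)
have H : ((2 * tau)%:E <= \int[P]_w ((V w)^-1)%:E +
    (tau ^+ 2)%:E * \int[P]_w (XA w + XB w)%:E)%E.
  rewrite -ge0_integralZl//; last by move=> w _; rewrite lee_fin.
  rewrite -ge0_integralD//; last 3 first.
  - by move=> w _; rewrite lee_fin invr_ge0 ltW.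
  - by move=> w _; rewrite -EFinM lee_fin mulr_ge0 ?sqr_ge0.
  - exact: measurable_funeM.
  apply: le_trans (_ : \int[P]_w (2 * tau)%:E <= _)%E.
    rewrite integral_cst// [X in (_ <= _ * X)%E](_ : _ = 1%E) ?mule1//.
    exact: probability_setT.
  apply: ge0_le_integral => //.
  - by move=> w _; rewrite lee_fin mulr_ge0// ltW.
  - by apply: emeasurable_funD => //; exact: measurable_funeM.
  - move=> w _; rewrite -EFinM -EFinD lee_fin.
    apply: le_trans (tangent_inv tau (V0 w)) _.
    by rewrite lerD2l; apply: ler_wpM2l => //; exact: sqr_ge0.
have H2 : ((tau ^+ 2)%:E * \int[P]_w (XA w + XB w)%:E <= tau%:E)%E.
  apply: le_trans (lee_wpmul2l tau2 EX) _.
  by rewrite -EFinM lee_fin tauM expr2 -mulrA mulVf ?mulr1// gt_eqF.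
have : ((2 * tau)%:E <= \int[P]_w ((V w)^-1)%:E + tau%:E)%E.
  by apply: le_trans H _; rewrite leeD2l.
rewrite -leeBlDr// -EFinB; congr (_ <= _)%E; congr (_%:E).
by rewrite mulr_natl mulr2n addrK.
Qed.
End positive.

(** The degenerate cases join the finite one: if lamA y = 0 the factor after the bound is 0, and if
    lamB y = 0 or a divergence is infinite the inverted quantity is +oo and the bound is 0. *)
Lemma matched_probability :
  (matching_bound nu q pA pB om n.+1 y * (n.+1%:R^-1 * lamA y)%:E <=
   \int[P]_w (matched pA pB q k y (W w 0%N))%:R%:E)%E.
Proof.
have r0 : (0 <= \int[P]_w (matched pA pB q k y (W w 0%N))%:R%:E)%E.
  by apply: integral_ge0 => w _; rewrite lee_fin.
have [a0|a0] := ltP 0 (lamA y); last first.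
  have -> : lamA y = 0 by apply/le_anti; rewrite a0 lA0.
  by rewrite mulr0 mule0.
have om0 : 0 < om.
  by rewrite -lte_fin (lt_le_trans _ (pqA y))// (dratioE pA0 q0 pqA) lte_fin.
have pAy : 0 < pA y.
  rewrite lt_neqAle pA0 andbT eq_sym; apply/eqP => pAy.
  by move: a0; rewrite /weight /dratio pAy mul0e ltxx.
have dr0 : (0 < dratio pA pB y)%E.
  rewrite /dratio inver; case: eqVneq => [_|pBy]; first by rewrite gt0_muley ?lte_fin.
  by rewrite -EFinM lte_fin divr_gt0// lt_neqAle eq_sym pBy pB0.
have mu0 p N : (forall z, 0 <= p z) -> (0 <= mu' nu q p om N)%E.
  by move=> p0; apply: mu'_ge0 => //; exact: ltW.
have m1 p N : (forall z, 0 <= p z) -> (0 < 1 + mu' nu q p om N)%E.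
  by move=> p0; apply: (@lt_le_trans _ _ 1%E) => //; rewrite leeDl// mu0.
have zero : (1 + mu' nu q pB om n.+1 + dratio pA pB y * (1 + mu' nu q pA om n.+1) =
    +oo)%E -> (matching_bound nu q pA pB om n.+1 y * (n.+1%:R^-1 * lamA y)%:E <=
   \int[P]_w (matched pA pB q k y (W w 0%N))%:R%:E)%E.
  by rewrite /matching_bound => ->; rewrite invey mul0e.
have [b0|b0] := ltP 0 (lamB y); last first.
  have bE : lamB y = 0 by apply/le_anti; rewrite b0 lB0.
  apply: zero; have pBy : pB y = 0 by rewrite -(weight_mulr pB0 pqB) bE mul0r.
  have -> : dratio pA pB y = +oo%E.
    by rewrite /dratio pBy inve0 gt0_muley ?lte_fin.
  by rewrite gt0_mulye ?m1// addey// gt_eqF// (@lt_trans _ _ 0%E)// m1.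
have := d2_ge0 nu q0 pA0; have := d2_ge0 nu q0 pB0.
case dBE: (d2 nu q pB) => [dB| |]//; last first.
  move=> _ _; apply: zero; rewrite (mu'_pinfty pB0 om0 n0 dBE) [(1 + +oo)%E]addey//.
  by rewrite addye// gt_eqF// (@lt_le_trans _ _ 0%E)// mule_ge0 ?ltW// m1.
case dAE: (d2 nu q pA) => [dA| |]//; last first.
  move=> _ _; apply: zero; rewrite (mu'_pinfty pA0 om0 n0 dAE) [(1 + +oo)%E]addey//.
  by rewrite gt0_muley// addey// gt_eqF// (@lt_trans _ _ 0%E)// m1.
by move=> _ _; exact: matched_probability_fin dAE dBE.
Qed.
End matched_probability.

Section matched_winner.
Context {R : realType} {T : Type} {n : nat}.
Variables (pA pB q : T -> R) (omA omB : R) (k : 'I_n.+1)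
  (b : ('I_n.+1 -> T * R) * R).
Hypotheses (pA0 : forall y, 0 <= pA y) (pB0 : forall y, 0 <= pB y)
  (q0 : forall y, 0 <= q y).
Hypotheses (pqA : forall y, (dratio pA q y <= omA%:E)%E)
  (pqB : forall y, (dratio pB q y <= omB%:E)%E).

(** Since [(b.1 k).2] is nonnegative, beating the maximum of the two ratios beats each of them. *)
Lemma matched_winner : 0 <= (b.1 k).2 -> matched pA pB q k (b.1 k).1 b ->
  [/\ ers_cand pA q b.1 = k, ers_accept pA q b,
      ers_cand pB q b.1 = k & ers_accept pB q b].
Proof.
move=> Sk /and5P[a0 b0 /forall_inP H UA UB].
have cA : ers_cand pA q b.1 = k.
  apply: (strict_race_cand pA0 q0 pqA) => // j /H.
  rewrite in_itv/= andbT; apply: le_lt_trans.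
  by apply: ler_wpM2l => //; rewrite le_max lexx.
have cB : ers_cand pB q b.1 = k.
  apply: (strict_race_cand pB0 q0 pqB) => // j /H.
  rewrite in_itv/= andbT; apply: le_lt_trans.
  by apply: ler_wpM2l => //; rewrite le_max lexx orbT.
split=> //; rewrite /ers_accept /ers_Zbar ?cA ?cB /ers_Zhat (bigD1 k)//=.
  by rewrite [X in _ / X](_ : _ = \sum_(j | j != k) weight pA q (b.1 j).1 + omegaP pA q)//; ring.
by rewrite [X in _ / X](_ : _ = \sum_(j | j != k) weight pB q (b.1 j).1 + omegaP pB q)//; ring.
Qed.
End matched_winner.

(** Proposals are required to be measurable only for j != k, because the lemma is also applied over
    the sigma-algebra that omits the proposal of entry k. *)
Lemma measurable_matched {R : realType} {d0 dY : measure_display}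
    {T0 : measurableType d0} {TY : measurableType dY} {n : nat}
    (pA pB : T0 -> TY -> R) (q : TY -> R) (k : 'I_n.+1) (y : T0 -> TY)
    (b : T0 -> ('I_n.+1 -> TY * R) * R) :
  measurable_fun setT (fun u : T0 * TY => pA u.1 u.2) ->
  measurable_fun setT (fun u : T0 * TY => pB u.1 u.2) ->
  measurable_fun setT q ->
  measurable_fun setT (fun t => omegaP (pA t) q) ->
  measurable_fun setT (fun t => omegaP (pB t) q) ->
  measurable_fun setT y ->
  (forall j, j != k -> measurable_fun setT (fun t => ((b t).1 j).1)) ->
  (forall j, measurable_fun setT (fun t => ((b t).1 j).2)) ->
  measurable_fun setT (fun t => (b t).2) ->
  measurable_fun setT (fun t => (matched (pA t) (pB t) q k (y t) (b t))%:R : R).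
Proof.
move=> mA mB mq moA moB my mY mS mU.
have mla : measurable_fun setT (fun t => weight (pA t) q (y t)) by exact: measurable_weight.
have mlb : measurable_fun setT (fun t => weight (pB t) q (y t)) by exact: measurable_weight.
have mlA j : j != k -> measurable_fun setT (fun t => weight (pA t) q ((b t).1 j).1).
  by move=> /mY mj; exact: measurable_weight.
have mlB j : j != k -> measurable_fun setT (fun t => weight (pB t) q ((b t).1 j).1).
  by move=> /mY mj; exact: measurable_weight.
rewrite (_ : (fun t => _) = fun t => (0 < weight (pA t) q (y t))%R%:R *
  ((0 < weight (pB t) q (y t))%R%:R *
   (\prod_(j | j != k) (((b t).1 j).2 \in Interval (BSide false
      (((b t).1 k).2 * Num.max (weight (pA t) q ((b t).1 j).1 / weight (pA t) q (y t))
        (weight (pB t) q ((b t).1 j).1 / weight (pB t) q (y t)))) +oo%O)%:R *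
   (((b t).2 <= (weight (pA t) q (y t) + \sum_(j | j != k) weight (pA t) q ((b t).1 j).1) /
           (\sum_(j | j != k) weight (pA t) q ((b t).1 j).1 + omegaP (pA t) q))%R%:R *
    ((b t).2 <= (weight (pB t) q (y t) + \sum_(j | j != k) weight (pB t) q ((b t).1 j).1) /
           (\sum_(j | j != k) weight (pB t) q ((b t).1 j).1 + omegaP (pB t) q))%R%:R)))); last first.
  by apply/funext => t; rewrite /matched -!mulnb !natrM natr_forall.
have msA : measurable_fun setT (fun t => \sum_(j | j != k) weight (pA t) q ((b t).1 j).1).
  exact: measurable_sum_cond.
have msB : measurable_fun setT (fun t => \sum_(j | j != k) weight (pB t) q ((b t).1 j).1).
  exact: measurable_sum_cond.
apply: measurable_funM; first by apply: measurable_natb; exact: measurable_fun_ltr.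
apply: measurable_funM; first by apply: measurable_natb; exact: measurable_fun_ltr.
apply: measurable_funM.
  apply: measurable_prod_cond => j jk; apply: measurable_side => //.
  apply: measurable_funM => //; apply: measurable_maxr; apply: measurable_funM;
    [exact: mlA| |exact: mlB|]; exact: (measurableT_comp measurable_invr).
apply: measurable_funM; apply: measurable_natb; apply: measurable_fun_ler => //;
  (apply: measurable_funM; first exact: measurable_funD);
  apply: (measurableT_comp measurable_invr); exact: measurable_funD.
Qed.

(** * The two parties *)

Lemma measurable_comp_fst (d1 d2 d3 : measure_display) (T1 : measurableType d1)
    (T2 : measurableType d2) (T3 : measurableType d3) (f : T1 -> T3) :
  measurable_fun setT f -> measurable_fun setT (fun u : T1 * T2 => f u.1).
Proof. by move=> mf; exact: (measurableT_comp mf (@measurable_fst _ _ _ _)). Qed.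

Lemma measurable_comp_snd (d1 d2 d3 : measure_display) (T1 : measurableType d1)
    (T2 : measurableType d2) (T3 : measurableType d3) (f : T2 -> T3) :
  measurable_fun setT f -> measurable_fun setT (fun u : T1 * T2 => f u.2).
Proof. by move=> mf; exact: (measurableT_comp mf (@measurable_snd _ _ _ _)). Qed.

Section kernel_law.
Context {R : realType} {d1 d2 : measure_display} {T1 : measurableType d1}
  {T2 : measurableType d2} (k : R.-pker T1 ~> T2) (t : T1).

(** The kernel at a fixed point, packaged as a probability measure for use in Fubini's theorem. *)
Definition kernel_law : set T2 -> \bar R := k t.

HB.instance Definition _ := Measure.copy kernel_law (k t).

Let kernel_law_setT : kernel_law setT = 1%E.
Proof. exact: prob_kernel. Qed.

HB.instance Definition _ :=
  Measure_isProbability.Build _ _ R kernel_law kernel_law_setT.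
End kernel_law.

Section matching_given_source.
Context {R : realType} {d dY dZ : measure_display} {Om : measurableType d}
  {TY : measurableType dY} {TZ : measurableType dZ} {P : probability Om R}
  {n : nat} {nu : {sigma_finite_measure set TY -> \bar R}} {q : TY -> R}
  {Y : nat -> 'I_n.+1 -> {RV P >-> TY}}
  {S : nat -> 'I_n.+1 -> {RV P >-> R}} {U : nat -> {RV P >-> R}}.
Hypothesis hdiag : measurable [set u : TY * TY | u.1 = u.2].
Hypothesis crW : common_randomness nu q Y S U.
Hypothesis hq : prob_density nu q.
Local Notation others := (@others _ _ _ _ _ P n Y S U).
Local Notation W := (W_of Y S U).
Variables (kap : R.-pker TY ~> TZ) (pA : TY -> R) (pB : TZ -> TY -> R)
  (om : TZ -> R) (h : TY * TZ -> \bar R).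
Hypotheses (hA : prob_density nu pA) (hB : cond_density nu pB).
Hypothesis pqA : forall z y, (dratio pA q y <= (om z)%:E)%E.
Hypothesis pqB : forall z y, (dratio (pB z) q y <= (om z)%:E)%E.
Hypothesis momB : measurable_fun setT (fun z => omegaP (pB z) q).
Hypothesis n0 : (0 < n)%N.
Hypotheses (mh : measurable_fun setT h) (h0 : forall u, (0 <= h u)%E).
Local Notation bnd := (fun u : TY * TZ =>
  matching_bound nu q pA (pB u.2) (om u.2) n.+1 u.1).
Hypothesis mbnd : measurable_fun setT bnd.
Local Notation YA w := (ERS_sample (W w) pA q).
Local Notation YB z w := (ERS_sample (W w) (pB z) q).

Let q0 y : 0 <= q y. Proof. by case: hq. Qed.
Let mq : measurable_fun setT q. Proof. by case: hq. Qed.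
Let pA0 y : 0 <= pA y. Proof. by case: hA. Qed.
Let pB0 z y : 0 <= pB z y. Proof. by case: hB => _ /(_ z)[]. Qed.

Let bnd0 u : (0 <= bnd u)%E.
Proof.
apply: matching_bound_ge0 => //; rewrite -lee_fin.
by apply: le_trans (pqA u.2 point); exact: dratio_ge0.
Qed.

(** The first factor of the domain carries the sigma-algebra without [Y 0 k], whose value is the
    second argument; this is what allows [Y 0 k] to be integrated out. *)
Let match_at k (u : others (inl (inl (0%N, k))) * TY * TZ) : \bar R :=
  (h (u.1.2, u.2) * (matched pA (pB u.2) q k u.1.2 (W u.1.1 0%N))%:R%:E)%E.

Let match_at0 k u : (0 <= match_at (k := k) u)%E.
Proof. by rewrite mule_ge0. Qed.

Let measurable_comp_fst_snd (d1 d2 d3 d4 : measure_display) (T1 : measurableType d1)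
    (T2 : measurableType d2) (T3 : measurableType d3) (T4 : measurableType d4)
    (f : T2 -> T4) :
  measurable_fun setT f -> measurable_fun setT (fun u : T1 * T2 * T3 => f u.1.2).
Proof. by move=> mf; exact: (measurable_comp_fst (measurable_comp_snd mf)). Qed.

Let measurable_match_at k : measurable_fun setT (match_at (k := k)).
Proof.
apply: emeasurable_funM.
  apply: (measurableT_comp mh); apply: measurable_fun_pair => //.
  exact: (measurable_comp_fst_snd (@measurable_id _ TY setT)).
apply/measurable_EFinP.
apply: (@measurable_matched R _ dY (others (inl (inl (0%N, k))) * TY * TZ)%type TY
  n (fun _ => pA) (fun u => pB u.2) q k (fun u => u.1.2) (fun u => W u.1.1 0%N)).
- by case: hA => mpA _ _; exact: (measurable_comp_snd mpA).
- case: hB => mpB _; apply: (measurableT_comp (f := fun v => pB v.1 v.2) mpB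
    (g := fun u => (u.1.2, u.2))).
  apply: measurable_fun_pair => //.
  exact: (measurable_comp_fst_snd (@measurable_id _ TZ setT)).
- exact: mq.
- exact: measurable_cst.
- exact: (measurable_comp_snd momB).
- exact: (measurable_comp_fst_snd (@measurable_id _ TY setT)).
- move=> j jk; have mY : measurable_fun setT (Y 0%N j : others (inl (inl (0%N, k))) -> TY).
    by apply: measurable_Y_others => -[kj]; rewrite kj eqxx in jk.
  exact: (measurable_comp_fst (measurable_comp_fst mY)).
- move=> j; have mS : measurable_fun setT (S 0%N j : others (inl (inl (0%N, k))) -> R).
    exact: measurable_S_others.
  exact: (measurable_comp_fst (measurable_comp_fst mS)).
- have mU : measurable_fun setT (U 0%N : others (inl (inl (0%N, k))) -> R).
    exact: measurable_U_others.
  exact: (measurable_comp_fst (measurable_comp_fst mU)).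
Qed.

Let inner k (u : others (inl (inl (0%N, k))) * TY) : \bar R :=
  (\int[kap u.2]_z match_at (k := k) (u, z))%E.

Let measurable_inner k : measurable_fun setT (inner (k := k)).
Proof.
pose l : R.-pker (others (inl (inl (0%N, k))) * TY)%type ~> TZ :=
  kpull kap (@measurable_snd _ _ _ _).
exact (@measurable_fun_integral_finite_kernel _ _ _ _ _ _ l (@match_at0 k)
  (@measurable_match_at k)).
Qed.

Let inner0 k u : (0 <= inner (k := k) u)%E.
Proof. by apply: integral_ge0 => z _; exact: match_at0. Qed.

Let bound_at y : \bar R := (\int[kap y]_z (h (y, z) * bnd (y, z)))%E.

Let measurable_bound_at : measurable_fun setT bound_at.
Proof.
have hb0 u : (0 <= h u * bnd u)%E by rewrite mule_ge0.
exact (@measurable_fun_integral_finite_kernel _ _ _ _ _ _ kap hb0 (emeasurable_funM mh mbnd)).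
Qed.

Let bound_at0 y : (0 <= bound_at y)%E.
Proof. by apply: integral_ge0 => z _; rewrite mule_ge0. Qed.

(** Carries measurability over [others] back to [Om], where Fubini is applied. *)
Let measurable_coarsen k (dT : measure_display) (T : measurableType dT) :
  measurable_fun setT (fun u : Om * T =>
    (u.1, u.2) : others (inl (inl (0%N, k))) * T).
Proof.
exact (measurable_fun_pair
  (measurable_comp_fst (@measurable_id_others _ _ _ _ _ P n Y S U (inl (inl (0%N, k)))))
  (@measurable_snd _ _ _ _)).
Qed.

(** Once [Y 0 k] is integrated out, the integrals over y and over z are exchanged with the average
    over the rest of W. For frozen y and z this leaves [matched_probability]. *)
Let bound_at_le k :
  (\int[nu]_y (bound_at y * (n.+1%:R^-1 * pA y)%:E) <=
   \int[P]_w inner (k := k) (w, Y 0%N k w))%E.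
Proof.
rewrite (integrate_Y crW hq (@measurable_inner k) (@inner0 k)).
pose D (u : Om * TY) : \bar R := (inner (k := k) u * (q u.2)%:E)%E.
have mD : measurable_fun setT (D : Om * TY -> \bar R).
  apply: emeasurable_funM; last by apply/measurable_EFinP; exact: (measurable_comp_snd mq).
  exact (measurableT_comp (@measurable_inner k) (@measurable_coarsen k _ TY)).
have D0 u : (0 <= D u)%E by rewrite mule_ge0// lee_fin.
rewrite [leRHS](fubini_tonelli (m1 := P) (m2 := nu) D mD D0).
apply: ge0_le_integral => //.
- by move=> y _; rewrite mule_ge0// lee_fin mulr_ge0.
- apply: emeasurable_funM => //; apply/measurable_EFinP; apply: measurable_funM => //.
  by case: hA.
- exact: measurable_fun_fubini_tonelli_G.
move=> y _.
pose M (u : Om * TZ) := match_at (k := k) (u.1, y, u.2).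
have mM : measurable_fun setT M.
  have mc := @measurable_coarsen k _ TZ.
  have m1c : measurable_fun setT (fun u : Om * TZ =>
    (u.1 : others (inl (inl (0%N, k))), y, u.2)).
    apply: measurable_fun_pair => //; apply: measurable_fun_pair => //.
    exact: (measurableT_comp (@measurable_fst _ _ _ _) mc).
  exact: (measurableT_comp (@measurable_match_at k) m1c).
have M0 u : (0 <= M u)%E by exact: match_at0.
have -> : (\int[P]_w D (w, y) = (\int[P]_w \int[kap y]_z M (w, z)) * (q y)%:E)%E.
  rewrite -ge0_integralZr ?lee_fin//.
  - exact: (measurable_fun_fubini_tonelli_F (m2 := kernel_law kap y) M mM M0).
  - by move=> w _; apply: integral_ge0.
rewrite (@sfinite_Fubini _ _ _ _ _ P (kernel_law kap y) _ M0 mM).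
pose c : \bar R := (n.+1%:R^-1 * weight pA q y)%:E.
have c0 : (0 <= c)%E by rewrite lee_fin mulr_ge0// weight_ge0.
have -> : (n.+1%:R^-1 * pA y)%:E = (c * (q y)%:E)%E.
  by rewrite -EFinM -mulrA (weight_mulr pA0 (pqA point)).
rewrite muleA; apply: lee_wpmul2r; first by rewrite lee_fin.
have my : measurable_fun setT (fun z => h (y, z) * bnd (y, z))%E.
  exact: (measurableT_comp (emeasurable_funM mh mbnd) (measurable_pair1 y)).
rewrite -ge0_integralZr//; last by move=> z _; rewrite mule_ge0.
apply: ge0_le_integral => //.
- by move=> z _; rewrite !mule_ge0.
- exact: emeasurable_funM.
- exact: (measurable_fun_fubini_tonelli_G M mM M0).
move=> z _; rewrite /M /match_at/= ge0_integralZl//; last first.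
  apply/measurable_EFinP.
  apply: (@measurable_matched R _ dY Om TY n (fun=> pA) (fun=> pB z) q k
    (fun=> y) (fun w => W w 0%N)) => //; last by case: hB => _ /(_ z)[] /measurable_comp_snd.
  by case: hA => /measurable_comp_snd.
rewrite -muleA; apply: lee_wpmul2l => //.
have [_ /(_ z) hBz] := hB.
exact: (matched_probability crW hq k y hA hBz (pqA z) (pqB z) n0).
Qed.
Local Notation diag := [set u : TY * TY | u.1 = u.2].
Local Notation agree := (fun u : Om * TZ => \1_diag (YA u.1, YB u.2 u.1) : R).

Let measurable_YA : measurable_fun setT (fun w => YA w).
Proof. exact (measurable_sample hq hA). Qed.

Let measurable_agree : measurable_fun setT agree.
Proof.
have mYB : measurable_fun setT (fun u : Om * TZ => YB u.2 u.1).
  apply: (@measurable_ERS_sample _ _ _ (Om * TZ)%type TY n (fun u => pB u.2) q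
    _ _ _ (fun u => W u.1)) => //.
  - case: hB => mpB _; apply: (measurableT_comp (f := fun v => pB v.1 v.2) mpB
      (g := fun u : Om * TZ * TY => (u.1.2, u.2))).
    apply: measurable_fun_pair => //.
  exact: (measurable_comp_fst_snd (@measurable_id _ TZ setT)).
  - exact: (measurable_comp_snd momB).
  - by move=> i k; exact: measurable_comp_fst.
  - by move=> i k; exact: measurable_comp_fst.
  - by move=> i; exact: measurable_comp_fst.
apply: (measurableT_comp (measurable_indic hdiag)).
exact (measurable_fun_pair (measurable_comp_fst measurable_YA) mYB).
Qed.

Let measurable_rhs : measurable_fun setT (fun w =>
  \int[kap (YA w)]_z (h (YA w, z) * (agree (w, z))%:E))%E.
Proof.
pose l : R.-pker Om ~> TZ := kpull kap measurable_YA.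
pose F (u : Om * TZ) : \bar R := (h (YA u.1, u.2) * (agree u)%:E)%E.
have F0 u : (0 <= F u)%E by rewrite mule_ge0.
have mF : measurable_fun setT F.
  apply: emeasurable_funM; last exact/measurable_EFinP.
  apply: (measurableT_comp mh); apply: measurable_fun_pair => //.
  exact: (measurable_comp_fst measurable_YA).
exact (@measurable_fun_integral_finite_kernel _ _ _ _ _ _ l F0 mF).
Qed.

(** [h] is a test function of (Y_A, Z) for one fixed source value. The left side is an integral
    against the density of Y_A, split into N equal shares pA / N, one for each entry; the shares add
    up on the right because matches of different entries exclude each other and each forces Y_A =
    Y_B. *)
Lemma matching_given_source :
  (\int[P]_w \int[kap (YA w)]_z (h (YA w, z) * bnd (YA w, z)) <=
   \int[P]_w \int[kap (YA w)]_z
     (h (YA w, z) * (\1_diag (YA w, YB z w))%:E))%E.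
Proof.
rewrite [leLHS](integral_sample crW hq hA (pqA point) measurable_bound_at bound_at0).
have -> : (\int[nu]_y (bound_at y * (pA y)%:E) =
    \sum_(k < n.+1) \int[nu]_y (bound_at y * (n.+1%:R^-1 * pA y)%:E))%E.
  rewrite -ge0_integral_sum//.
  - apply: eq_integral => y _; rewrite -ge0_sume_distrr; last first.
      by move=> k _; rewrite lee_fin mulr_ge0.
    by rewrite sumEFin sumr_const card_ord -mulrnAl -mulr_natl divff ?mul1r ?pnatr_eq0.
  - move=> k; apply: emeasurable_funM => //; apply/measurable_EFinP.
    by apply: measurable_funM => //; case: hA.
  - by move=> k y _; rewrite mule_ge0// lee_fin mulr_ge0.
have mI k : measurable_fun setT (fun w => inner (k := k) (w, Y 0%N k w)).
  have mp : measurable_fun setT (fun w : Om =>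
      (w : others (inl (inl (0%N, k))), Y 0%N k w)).
    exact (measurable_fun_pair
      (@measurable_id_others _ _ _ _ _ P n Y S U (inl (inl (0%N, k))))
      (measurable_funPT (Y 0%N k))).
  exact (measurableT_comp (@measurable_inner k) mp).
apply: le_trans; first by apply: lee_sum => k _; exact: bound_at_le.
rewrite -ge0_integral_sum//.
apply: ae_ge0_le_integral => //.
- by move=> w _; exact: sume_ge0.
- exact: emeasurable_sum.
- by move=> w _; apply: integral_ge0 => z _; rewrite mule_ge0.
apply: filterS (ae_positive crW 0%N) => w [S0 _] _.
have winner k z : matched pA (pB z) q k (Y 0%N k w) (W w 0%N) ->
    [/\ ers_cand pA q (W w 0%N).1 = k, ers_accept pA q (W w 0%N),
        ers_cand (pB z) q (W w 0%N).1 = k & ers_accept (pB z) q (W w 0%N)].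
  apply: (matched_winner (k := k) (b := W w 0%N) pA0 (pB0 z) q0 (pqA z) (pqB z)).
  exact: (ltW (S0 k)).
(* A matched entry is the candidate of A, so at most one term of the sum is nonzero. *)
pose k0 := ers_cand pA q (W w 0%N).1.
rewrite (bigD1 k0)//= big1 ?adde0; last first.
  move=> k kk0; apply: integral0_eq => z _; rewrite /match_at/=.
  case: (boolP (matched _ _ _ _ _ _)) => [/winner[k0k]|]; last by rewrite mule0.
  by rewrite -k0k eqxx in kk0.
have [aA|aA] := boolP (ers_accept pA q (W w 0%N)); last first.
  rewrite [leLHS]integral0_eq.
    by apply: integral_ge0 => z _; rewrite mule_ge0.
  move=> z _; rewrite /match_at/=.
  case: (boolP (matched _ _ _ _ _ _)) => [/winner[_]|]; last by rewrite mule0.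
  by rewrite (negbTE aA).
have YAE : YA w = Y 0%N k0 w by rewrite /ERS_sample (ERS_first aA).
rewrite /inner /= YAE.
have mk (F : Om * TZ -> R) : measurable_fun setT F ->
    measurable_fun setT (fun z => (h (Y 0%N k0 w, z) * (F (w, z))%:E)%E).
  move=> mF; apply: emeasurable_funM.
    exact: (measurableT_comp mh (measurable_pair1 _)).
  by apply/measurable_EFinP; exact: (measurableT_comp mF (measurable_pair1 w)).
have mg := mk _ measurable_agree; rewrite /= YAE in mg.
apply: ge0_le_integral => //.
- exact (measurableT_comp (@measurable_match_at k0)
    (measurable_pair1 (w : others (inl (inl (0%N, k0))), Y 0%N k0 w))).
move=> z _; rewrite /match_at /=; apply: lee_wpmul2l => //.
case: (boolP (matched _ _ _ _ _ _)) => [/winner[_ _ cB aB]|_]; last by rewrite lee_fin.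
rewrite indicE mem_set//= /ERS_sample (ERS_first aB)//.
by rewrite /sample_at /= cB.
Qed.
End matching_given_source.

(** * Monotonicity and measurability of the bound *)

Section matching_bound.
Context {R : realType} {d : measure_display} {T : measurableType d}
  {nu : {sigma_finite_measure set T -> \bar R}} {q : T -> R}.
Hypothesis hq : prob_density nu q.

Let q0 y : 0 <= q y. Proof. by case: hq. Qed.
Let mq : measurable_fun setT q. Proof. by case: hq. Qed.

Lemma le_mu' p om om' N : (forall y, 0 <= p y) -> 0 <= om <= om' ->
  (mu' nu q p om N <= mu' nu q p om' N)%E.
Proof.
move=> p0 /andP[om0 omom']; have om'0 := le_trans om0 omom'.
rewrite /mu'; apply: lee_wpmul2l; first by rewrite lee_fin.
apply: leeD; first apply: leeD; first by rewrite lee_fin.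
  apply: lee_wpmul2r; first exact: d2_ge0.
  rewrite lee_fin; apply: ler_pM => //; first exact: II_ge0.
  by rewrite lerD2l; apply: ler_wpM2r.
apply: lee_wpmul2r; first exact: d2_ge0.
by rewrite lee_fin; apply: ler_wpM2r => //; rewrite lerXn2r.
Qed.

(** This allows the estimate to be proved with the smallest common constant, which is measurable in
    (x, z), and then weakened to [omega x]. *)
Lemma matching_bound_le pA pB om om' N y : (forall y, 0 <= pA y) ->
  (forall y, 0 <= pB y) -> 0 <= om <= om' ->
  (matching_bound nu q pA pB om' N y <= matching_bound nu q pA pB om N y)%E.
Proof.
move=> pA0 pB0 omom'; have [om0 _] := andP omom'.
have mu0 p : (forall y, 0 <= p y) -> (0 <= 1 + mu' nu q p om N)%E.
  by move=> p0; apply: adde_ge0 => //; exact: mu'_ge0.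
have mu0' p : (forall y, 0 <= p y) -> (0 <= 1 + mu' nu q p om' N)%E.
  move=> p0; apply: adde_ge0 => //; apply: mu'_ge0 => //.
  by case/andP: omom'; exact: le_trans.
have mu_le p : (forall y, 0 <= p y) ->
    (1 + mu' nu q p om N <= 1 + mu' nu q p om' N)%E.
  by move=> p0; rewrite leeD2l// le_mu'.
have r0 := dratio_ge0 pA0 pB0 y.
rewrite /matching_bound lee_pV2 ?inE/=; last 2 first.
- by apply: adde_ge0; [exact: mu0'|apply: mule_ge0 => //; exact: mu0'].
- by apply: adde_ge0; [exact: mu0|apply: mule_ge0 => //; exact: mu0].
by apply: leeD; [exact: mu_le|apply: lee_wpmul2l => //; exact: mu_le].
Qed.

Section measurability.
Context {d0 : measure_display} {T0 : measurableType d0}.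

Lemma measurable_d2 (p : T0 -> T -> R) :
  measurable_fun setT (fun u : T0 * T => p u.1 u.2) ->
  (forall t y, 0 <= p t y) ->
  measurable_fun setT (fun t => d2 nu q (p t)).
Proof.
move=> mp p0.
pose f (u : T0 * T) : \bar R := ((q u.2)%:E * dratio q (p u.1) u.2)%E.
have f0 u : (0 <= f u)%E by rewrite mule_ge0 ?lee_fin ?dratio_ge0.
have mq2 : measurable_fun setT (fun u : T0 * T => (q u.2)%:E).
  by apply/measurable_EFinP; exact: (measurableT_comp mq (@measurable_snd _ _ _ _)).
have mf : measurable_fun setT f.
  apply: emeasurable_funM => //; apply: emeasurable_funM => //.
  by apply: (measurableT_comp measurable_inve); exact/measurable_EFinP.
exact: (measurable_fun_fubini_tonelli_F (m2 := nu) f mf f0).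
Qed.

Lemma measurable_matching_bound (pA pB : T0 -> T -> R) (om : T0 -> R)
    (y : T0 -> T) N :
  measurable_fun setT (fun u : T0 * T => pA u.1 u.2) ->
  measurable_fun setT (fun u : T0 * T => pB u.1 u.2) ->
  (forall t y, 0 <= pA t y) -> (forall t y, 0 <= pB t y) ->
  measurable_fun setT om -> measurable_fun setT y ->
  measurable_fun setT (fun t =>
    matching_bound nu q (pA t) (pB t) (om t) N (y t)).
Proof.
move=> mA mB pA0 pB0 mom my.
have mmu (p : T0 -> T -> R) : measurable_fun setT (fun u : T0 * T => p u.1 u.2) ->
    (forall t y, 0 <= p t y) ->
    measurable_fun setT (fun t => 1 + mu' nu q (p t) (om t) N)%E.
  move=> mp p0; have md := measurable_d2 mp p0.
  apply: emeasurable_funD => //; apply: emeasurable_funM => //.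
  apply: emeasurable_funD; last first.
    apply: emeasurable_funM => //; apply/measurable_EFinP.
    by apply: measurable_funM => //; exact: measurable_funX.
  apply: emeasurable_funD; first exact/measurable_EFinP.
  apply: emeasurable_funM => //; apply/measurable_EFinP.
  apply: measurable_funM => //; apply: measurable_funD => //.
  exact: measurable_funM.
apply: (measurableT_comp measurable_inve); apply: emeasurable_funD; first exact: mmu.
apply: emeasurable_funM; last exact: mmu.
have my' : measurable_fun setT (fun t => (t, y t)) by exact: measurable_fun_pair.
rewrite /dratio; apply: emeasurable_funM.
  by apply/measurable_EFinP; exact: (measurableT_comp mA my').
apply: (measurableT_comp measurable_inve); apply/measurable_EFinP.
exact: (measurableT_comp mB my').
Qed.
End measurability.
End matching_bound.

(** * From integrated bounds to versions of a conditional probability *)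

Section conditional_probability.
Context {R : realType} {d d' : measure_display} {Om : measurableType d}
  {T : measurableType d'} {P : probability Om R}.
Local Open Scope ereal_scope.

(** The set where g < b is covered by the sets [F1 m] and [F2 m], and each has probability 0. On
    [F1 m] the integral of g, which is a probability, would be negative; on [F2 m] the function b
    exceeds g by at least 1 / (m + 1), yet its integral is no larger. *)
Lemma cond_prob_version_ge (E : set Om) (V : Om -> T) (g : T -> R)
    (b : T -> \bar R) :
  measurable_fun setT V -> measurable_fun setT b -> (forall v, 0 <= b v) ->
  cond_prob_version P E V g ->
  (forall F, measurable F ->
    \int[P]_(w in V @^-1` F) b (V w) <= P (E `&` V @^-1` F)) ->
  {ae P, forall w, b (V w) <= (g (V w))%:E}.
Proof.
move=> mV mb b0 [mg gE] bE.
have mgE : measurable_fun setT (EFin \o g) by exact/measurable_EFinP.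
have mVF F : measurable F -> measurable (V @^-1` F).
  by move=> mF; rewrite -[X in measurable X]setTI; exact: mV.
have mc m : (0 < m.+1%:R^-1 :> R)%R by [].
have null F m : measurable F ->
    P (V @^-1` F) * (m.+1%:R^-1)%:E <= 0 -> P.-negligible (V @^-1` F).
  move=> mF PF; exists (V @^-1` F); split => //; first exact: mVF.
  apply/eqP; rewrite eq_le measure_ge0 andbT.
  by move: PF; rewrite pmule_lle0 ?lte_fin.
pose F1 m := [set v | (g v <= - m.+1%:R^-1)%R].
(* The cap g <= m makes the integral of g finite, so that it can be cancelled. *)
pose F2 m := [set v | [/\ (0 <= g v)%R, (g v <= m%:R)%R &
  (g v + m.+1%:R^-1)%:E <= b v]].
have mF1 m : measurable (F1 m).
  by rewrite -[F1 m]setTI; exact: measurable_fun_le.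
have mF2 m : measurable (F2 m).
  rewrite (_ : F2 m = [set v | (0 <= g v)%R] `&` [set v | (g v <= m%:R)%R] `&`
    [set v | (g v + m.+1%:R^-1)%:E <= b v]); last first.
    by apply/seteqP; split => v [] => [|[]].
  apply: measurableI; first apply: measurableI.
  - by rewrite -[X in measurable X]setTI; exact: measurable_fun_le.
  - by rewrite -[X in measurable X]setTI; exact: measurable_fun_le.
  - rewrite -[X in measurable X]setTI; apply: emeasurable_fun_le => //.
    by apply/measurable_EFinP; exact: measurable_funD.
have n1 m : P.-negligible (V @^-1` F1 m).
  have mF := mVF _ (mF1 m).
  apply: (null _ m) => //.
  have g0 w : (V @^-1` F1 m) w -> (0 <= - g (V w))%R.
    by rewrite oppr_ge0 => /le_trans; apply; rewrite oppr_le0 ltW.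
  rewrite muleC -integral_cst//.
  apply: le_trans (_ : \int[P]_(w in V @^-1` F1 m) (- g (V w))%:E <= _).
    apply: ge0_le_integral => //.
    - by move=> w _; rewrite lee_fin.
    - apply: measurable_funTS; apply/measurable_EFinP; apply: measurable_funN.
      exact: (measurableT_comp mg mV).
    - by move=> w Fw; rewrite lee_fin lerNr.
  rewrite -oppe_ge0 -integral_ge0N; last by move=> w /g0; rewrite lee_fin.
  rewrite (eq_integral (fun w => (g (V w))%:E)) ?gE//.
  by move=> w _; rewrite -EFinN opprK.
have n2 m : P.-negligible (V @^-1` F2 m).
  have mF := mVF _ (mF2 m).
  apply: (null _ m) => //.
  set I := \int[P]_(w in V @^-1` F2 m) (g (V w))%:E.
  have mgF : measurable_fun (V @^-1` F2 m) (fun w => (g (V w))%:E).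
    by apply: measurable_funTS; exact: (measurableT_comp mgE mV).
  have I0 : 0 <= I by apply: integral_ge0 => w [? _ _]; rewrite lee_fin.
  have Ifin : I \is a fin_num.
    rewrite ge0_fin_numE//; apply: le_lt_trans (_ : m%:R%:E * P (V @^-1` F2 m) < _).
      rewrite -integral_cst//; apply: ge0_le_integral => //.
        by move=> w [g0 _ _]; rewrite lee_fin.
      by move=> w [_ gm _]; rewrite lee_fin.
    by rewrite lte_mul_pinfty// (le_lt_trans (probability_le1 P mF))// ltry.
  have : I + P (V @^-1` F2 m) * (m.+1%:R^-1)%:E <= I.
    rewrite muleC -integral_cst// -ge0_integralD//; last 2 first.
    - by move=> w [? _ _]; rewrite lee_fin.
    - by move=> w _; rewrite lee_fin invr_ge0.
    rewrite [leRHS]gE//; apply: le_trans (bE _ (mF2 m)).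
    apply: ge0_le_integral => //.
    - by move=> w [g0 _ _]; rewrite -EFinD lee_fin addr_ge0// ltW.
    - exact: emeasurable_funD.
    - by apply: measurable_funTS; exact: (measurableT_comp mb mV).
    - by move=> w [].
  by rewrite -[leRHS]adde0 leeD2lE.
rewrite /almost_everywhere.
apply: (@negligibleS _ _ _ P
  (\bigcup_m V @^-1` F1 m `|` \bigcup_m V @^-1` F2 m)); last first.
  by apply: negligibleU; apply: negligible_bigcup.
move=> w /negP; rewrite -ltNge => gb.
have [g0|g0] := ltP (g (V w)) 0%R.
  have [k /ltW gk] := ltr_add_invr g0.
  by left; exists k => //=; move: gk; rewrite /F1/= -lerBrDr sub0r.
have [k gk] : exists k, (g (V w) + k.+1%:R^-1)%:E <= b (V w).
  case: (b (V w)) gb => [r||]//; last by exists 0%N; rewrite leey.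
  by rewrite lte_fin => /ltr_add_invr[k /ltW]; exists k.
(* The index has to be at least k for the gap and at least g (V w) for the cap. *)
right; exists (maxn k (Num.truncn (g (V w))).+1) => //; split => //.
  apply: le_trans (ltW (truncnS_gt _)) _; by rewrite ler_nat leq_maxr.
apply: le_trans gk; rewrite lee_fin lerD2l lef_pV2 ?posrE// ler_nat ltnS.
exact: leq_maxl.
Qed.
End conditional_probability.

(** * The communication setup *)

Section communication.
Context {R : realType} {d dX dY dZ : measure_display} {Om : measurableType d}
  {TX : measurableType dX} {TY : measurableType dY} {TZ : measurableType dZ}
  {P : probability Om R} {n : nat}
  {nu : {sigma_finite_measure set TY -> \bar R}} {q : TY -> R}
  {pYX : TX -> TY -> R} {ptYZ : TZ -> TY -> R}
  {PZXY : R.-pker (TX * TY)%type ~> TZ} {omega : TX -> R}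
  {X : {RV P >-> TX}} {Z : {RV P >-> TZ}}
  {Y : nat -> 'I_n.+1 -> {RV P >-> TY}}
  {S : nat -> 'I_n.+1 -> {RV P >-> R}} {U : nat -> {RV P >-> R}}.
Local Notation W := (W_of Y S U).
Local Notation all_W := (@all_W _ _ _ _ _ P n Y S U).
Local Notation YA := (fun w => ERS_sample (W w) (pYX (X w)) q).
Local Notation YB := (fun w => ERS_sample (W w) (ptYZ (Z w)) q).
Hypothesis hdiag : measurable [set u : TY * TY | u.1 = u.2].
Hypothesis hq : prob_density nu q.
Hypotheses (hA : cond_density nu pYX) (hB : cond_density nu ptYZ).
Hypothesis pqA : forall x y, (dratio (pYX x) q y <= (omega x)%:E)%E.
Hypothesis pqB : forall x z y, (dratio (ptYZ z) q y <= (omega x)%:E)%E.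
Hypothesis momA : measurable_fun setT (fun x => omegaP (pYX x) q).
Hypothesis momB : measurable_fun setT (fun z => omegaP (ptYZ z) q).
Hypothesis n0 : (0 < n)%N.
Hypothesis crW : common_randomness nu q Y S U.
Hypothesis XW : indep_of_W X Y S U.
Hypothesis genZ : generated_from PZXY X YA Z Y S U.

Let q0 y : 0 <= q y. Proof. by case: hq. Qed.
Let mq : measurable_fun setT q. Proof. by case: hq. Qed.
Let pA0 x y : 0 <= pYX x y. Proof. by case: hA => _ /(_ x)[]. Qed.
Let pB0 z y : 0 <= ptYZ z y. Proof. by case: hB => _ /(_ z)[]. Qed.

(* omega is not assumed to be measurable; this smaller constant is. *)
Let om x z : R := Num.max (omegaP (pYX x) q) (omegaP (ptYZ z) q).

Let dratioA_om x z y : (dratio (pYX x) q y <= (om x z)%:E)%E.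
Proof.
rewrite (dratioE (pA0 x) q0 (pqA x)) lee_fin le_max.
by rewrite (weight_le_omegaP (pA0 x) q0 (pqA x)).
Qed.

Let dratioB_om x z y : (dratio (ptYZ z) q y <= (om x z)%:E)%E.
Proof.
rewrite (dratioE (pB0 z) q0 (pqB x z)) lee_fin le_max.
by rewrite (weight_le_omegaP (pB0 z) q0 (pqB x z)) orbT.
Qed.

Let om_le x z : 0 <= om x z <= omega x.
Proof.
rewrite /om ge_max (omegaP_le (pA0 x) q0 (pqA x) point)
  (omegaP_le (pB0 z) q0 (pqB x z) point) le_max !andbT.
by rewrite (omegaP_ge0 (pA0 x) q0 (pqA x) point).
Qed.

Let bnd (u : TY * TX * TZ) : \bar R :=
  matching_bound nu q (pYX u.1.2) (ptYZ u.2) (om u.1.2 u.2) n.+1 u.1.1.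

Let bnd0 u : (0 <= bnd u)%E.
Proof. by apply: matching_bound_ge0 => //; case/andP: (om_le u.1.2 u.2). Qed.

Let measurable_bnd : measurable_fun setT bnd.
Proof.
have mX : measurable_fun setT (fun u : TY * TX * TZ => u.1.2).
  exact: (measurable_comp_fst (@measurable_snd _ _ _ _)).
apply: (measurable_matching_bound hq (T0 := (TY * TX * TZ)%type)
  (pA := fun u => pYX u.1.2) (pB := fun u => ptYZ u.2)
  (om := fun u => om u.1.2 u.2)) => //.
- case: hA => mpA _; apply: (measurableT_comp (f := fun v => pYX v.1 v.2) mpA
    (g := fun u : TY * TX * TZ * TY => (u.1.1.2, u.2))).
  by apply: measurable_fun_pair => //; exact: (measurable_comp_fst mX).
- case: hB => mpB _; apply: (measurableT_comp (f := fun v => ptYZ v.1 v.2) mpB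
    (g := fun u : TY * TX * TZ * TY => (u.1.2, u.2))).
  by apply: measurable_fun_pair => //; exact: (measurable_comp_fst (@measurable_snd _ _ _ _)).
- apply: measurable_maxr; first exact: (measurableT_comp momA mX).
  exact: (measurable_comp_snd momB).
- exact: (measurable_comp_fst (@measurable_fst _ _ _ _)).
Qed.

Let mY i k : measurable_fun setT (Y i k : all_W -> TY).
Proof. exact: measurable_Y_all. Qed.

Let mS i k : measurable_fun setT (S i k : all_W -> R).
Proof. exact: measurable_S_all. Qed.

Let mU i : measurable_fun setT (U i : all_W -> R).
Proof. exact: measurable_U_all. Qed.

(** The domain keeps the source apart from W, as the independence of X concerns the sigma-algebra of
    W. *)
Let sA (u : TX * all_W) : TY := ERS_sample (W u.2) (pYX u.1) q.

Let measurable_sA : measurable_fun setT sA.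
Proof.
apply: (@measurable_ERS_sample _ _ _ (TX * all_W)%type TY n (fun u => pYX u.1) q
  _ _ _ (fun u => W u.2)) => //.
- case: hA => mpA _; apply: (measurableT_comp (f := fun v => pYX v.1 v.2) mpA
    (g := fun u : TX * all_W * TY => (u.1.1, u.2))).
  by apply: measurable_fun_pair => //; exact: (measurable_comp_fst (@measurable_fst _ _ _ _)).
- exact: (measurable_comp_fst momA).
- by move=> i k; exact: (measurable_comp_snd (mY i k)).
- by move=> i k; exact: (measurable_comp_snd (mS i k)).
- by move=> i; exact: (measurable_comp_snd (mU i)).
Qed.

Let measurable_sB :
  measurable_fun setT (fun u : all_W * TZ => ERS_sample (W u.1) (ptYZ u.2) q).
Proof.
apply: (@measurable_ERS_sample _ _ _ (all_W * TZ)%type TY n (fun u => ptYZ u.2) q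
  _ _ _ (fun u => W u.1)) => //.
- case: hB => mpB _; apply: (measurableT_comp (f := fun v => ptYZ v.1 v.2) mpB
    (g := fun u : all_W * TZ * TY => (u.1.2, u.2))).
  by apply: measurable_fun_pair => //; exact: (measurable_comp_fst (@measurable_snd _ _ _ _)).
- exact: (measurable_comp_snd momB).
- by move=> i k; exact: (measurable_comp_fst (mY i k)).
- by move=> i k; exact: (measurable_comp_fst (mS i k)).
- by move=> i; exact: (measurable_comp_fst (mU i)).
Qed.

Let XWpair (w : Om) : TX * all_W := (X w, w).

Let measurable_XWpair : measurable_fun setT XWpair.
Proof.
exact (measurable_fun_pair (measurable_funPT X)
  (@measurable_id_all _ _ _ _ _ P n Y S U)).
Qed.

Local Open Scope ereal_scope.

(** By independence, W can be replaced with a copy w' drawn independently of X. *)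
Let integrate_source (g : TX * all_W -> \bar R) :
  measurable_fun setT g -> (forall u, 0 <= g u) ->
  \int[P]_w g (X w, w) = \int[P]_w \int[P]_w' g (X w, w').
Proof.
move=> mg g0.
pose PW : probability all_W R :=
  distribution P (mfun_Sub (mem_set (@measurable_id_all _ _ _ _ _ P n Y S U))).
rewrite (@disintegration _ _ _ _ _ TX all_W P X id _ _ (kcst PW) _ g)//.
- apply: eq_integral => w _; rewrite /kcst ge0_integral_distribution//.
  exact: (measurableT_comp mg (measurable_pair1 (X w))).
- exact: measurable_id_all.
- move=> E D mE mD; rewrite /kcst integral_cst//; last exact: measurable_funPTI.
  rewrite muleC; apply: XW => //.
  by exists E => //; rewrite setTI.
Qed.

(** An event in [XWpair] belongs to [sigma_XW], where [generated_from] prescribes the law of Z. *)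
Let integrate_Z (f : TX * all_W * TZ -> \bar R) :
  measurable_fun setT f -> (forall u, 0 <= f u) ->
  \int[P]_w f (XWpair w, Z w) =
  \int[P]_w \int[PZXY (X w, YA w)]_z f (XWpair w, z).
Proof.
move=> mf f0.
have mxs : measurable_fun setT (fun u : TX * all_W => (u.1, sA u)).
  by apply: measurable_fun_pair.
rewrite (@disintegration _ _ _ _ _ _ TZ P XWpair Z measurable_XWpair _
  (kpull PZXY mxs) _ f)// => E D mE mD.
apply: genZ => //.
pose T := g_sigma_algebraType (g_sigma_algebra_preimage X `|` sigma_W Y S U).
have mX : measurable_fun setT (X : T -> TX).
  move=> _ A mA; rewrite setTI; apply: sub_sigma_algebra; left.
  by exists A => //; rewrite setTI.
have mid : measurable_fun setT (id : T -> all_W).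
  by move=> _ A mA; rewrite setTI; apply: sub_sigma_algebra; right.
by have := measurable_fun_pair mX mid measurableT mE; rewrite setTI.
Qed.

Let slice (F : set (TY * TX * TZ)) (b : TX * all_W * TZ -> \bar R) u : \bar R :=
  (\1_F (sA u.1, u.1.1, u.2))%:E * b u.

Let bound (u : TX * all_W * TZ) : \bar R := bnd (sA u.1, u.1.1, u.2).

Let agree (u : TX * all_W * TZ) : \bar R :=
  (\1_[set v : TY * TY | v.1 = v.2]
     (sA u.1, ERS_sample (W u.1.2) (ptYZ u.2) q))%:E.

Let measurable_triple : measurable_fun setT
  (fun u : TX * all_W * TZ => (sA u.1, u.1.1, u.2) : TY * TX * TZ).
Proof.
apply: measurable_fun_pair => //; apply: measurable_fun_pair.
  exact: (measurable_comp_fst measurable_sA).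
exact: (measurable_comp_fst (@measurable_fst _ _ _ _)).
Qed.

Let measurable_bound : measurable_fun setT bound.
Proof. exact: (measurableT_comp measurable_bnd measurable_triple). Qed.

Let measurable_choices : measurable_fun setT (fun u : TX * all_W * TZ =>
  (sA u.1, ERS_sample (W u.1.2) (ptYZ u.2) q)).
Proof.
apply: measurable_fun_pair; first exact: (measurable_comp_fst measurable_sA).
apply: (measurableT_comp measurable_sB (g := fun u : TX * all_W * TZ => (u.1.2, u.2))).
by apply: measurable_fun_pair => //; exact: (measurable_comp_fst (@measurable_snd _ _ _ _)).
Qed.

Let measurable_agree : measurable_fun setT agree.
Proof.
apply/measurable_EFinP.
exact: (measurableT_comp (measurable_indic hdiag) measurable_choices).
Qed.

Let measurable_slice F b : measurable F -> measurable_fun setT b ->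
  measurable_fun setT (slice F b).
Proof.
move=> mF mb; apply: emeasurable_funM => //; apply/measurable_EFinP.
exact: (measurableT_comp (measurable_indic mF) measurable_triple).
Qed.

(** [G x] is the mean of the slice given X = x. Its measurability comes from Fubini over [all_W],
    while its formula is stated over [P], the form that [matching_given_source] compares. *)
Let integrate_slice F b : measurable F -> measurable_fun setT b ->
  (forall u, 0 <= b u) ->
  exists2 G : TX -> \bar R, measurable_fun setT G &
    \int[P]_w slice F b (XWpair w, Z w) = \int[P]_w G (X w) /\
    forall x, G x = \int[P]_w \int[PZXY (x, sA (x, w))]_z slice F b ((x, w), z).
Proof.
move=> mF mb b0.
have s0 u : 0 <= slice F b u by rewrite mule_ge0.
have ms := measurable_slice mF mb.
have mxs : measurable_fun setT (fun u : TX * all_W => (u.1, sA u)).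
  by apply: measurable_fun_pair.
pose l : R.-pker (TX * all_W)%type ~> TZ := kpull PZXY mxs.
pose g (u : TX * all_W) := \int[l u]_z slice F b (u, z).
have mg : measurable_fun setT g.
  exact (@measurable_fun_integral_finite_kernel _ _ _ _ _ _ l s0 ms).
have g0 u : 0 <= g u by exact: integral_ge0.
pose PW : probability all_W R :=
  distribution P (mfun_Sub (mem_set (@measurable_id_all _ _ _ _ _ P n Y S U))).
have PWE x : \int[PW]_w g (x, w) = \int[P]_w g (x, w).
  rewrite ge0_integral_distribution//.
  exact: (measurableT_comp mg (measurable_pair1 x)).
exists (fun x => \int[PW]_w g (x, w)).
  exact: (measurable_fun_fubini_tonelli_F (m2 := PW) g mg g0).
split => [|x]; last exact: PWE.
rewrite integrate_Z// (integrate_source mg g0).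
by apply: eq_integral => w _; rewrite PWE.
Qed.

Local Notation V := (fun w => (YA w, X w, Z w)).

(** Both sides are averages of functions of X, so they are compared at each fixed x, by
    [matching_given_source] with the kernel [PZXY] at (x, .) and with [h] the section at x of the
    indicator of F. *)
Lemma matching_bound_integral F : measurable F ->
  \int[P]_(w in V @^-1` F) bnd (V w) <=
  P ([set w | YA w = YB w] `&` V @^-1` F).
Proof.
move=> mF.
have mV : measurable_fun setT V.
  exact (measurableT_comp measurable_triple
    (measurable_fun_pair measurable_XWpair (measurable_funPT Z))).
have mVF : measurable (V @^-1` F) by rewrite -[X in measurable X]setTI; exact: mV.
have mE : measurable [set w | YA w = YB w].
  have := measurableT_comp measurable_choices
    (measurable_fun_pair measurable_XWpair (measurable_funPT Z)).
  by move=> /(_ measurableT _ hdiag); rewrite setTI.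
have -> : \int[P]_(w in V @^-1` F) bnd (V w) =
    \int[P]_w slice F bound (XWpair w, Z w).
  rewrite integral_mkcond; apply: eq_integral => w _.
  rewrite patchE /slice indicE /bound (_ : (w \in _) = (V w \in F))//=.
  by case: ifP => _; rewrite ?mul1e ?mul0e.
have -> : P ([set w | YA w = YB w] `&` V @^-1` F) =
    \int[P]_w slice F agree (XWpair w, Z w).
  rewrite setIC -[X in P X]setIT -integral_indic//; last exact: measurableI.
  by apply: eq_integral => w _; rewrite indicI.
have agree0 u : 0 <= agree u by rewrite lee_fin.
have bound0 u : 0 <= bound u by exact: bnd0.
have [G1 mG1 [-> G1E]] := integrate_slice mF measurable_bound bound0.
have [G2 mG2 [-> G2E]] := integrate_slice mF measurable_agree agree0.
apply: ge0_le_integral => //.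
- move=> w _; rewrite G1E; apply: integral_ge0 => w' _.
  by apply: integral_ge0 => z _; rewrite mule_ge0.
- exact: (measurableT_comp mG1).
- exact: (measurableT_comp mG2).
move=> w _; rewrite G1E G2E; move: (X w) => x {w}.
have mx : measurable_fun setT (fun u : TY * TZ => (u.1, x, u.2) : TY * TX * TZ).
  by apply: measurable_fun_pair => //; apply: measurable_fun_pair.
apply: (@matching_given_source _ _ _ _ _ _ _ P n nu q Y S U hdiag crW hq
  (kpull PZXY (pair1_measurable x)) (pYX x) ptYZ (om x)
  (fun u => (\1_F (u.1, x, u.2))%:E)) => //.
- by case: hA.
- apply/measurable_EFinP; exact: (measurableT_comp (measurable_indic mF) mx).
- exact: (measurableT_comp measurable_bnd mx).
Qed.

Lemma conditional_matching_bound (g : TY * TX * TZ -> R) :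
  cond_prob_version P [set w | YA w = YB w] V g ->
  {ae P, forall w,
    matching_bound nu q (pYX (X w)) (ptYZ (Z w)) (omega (X w)) n.+1 (YA w)
    <= (g (V w))%:E}.
Proof.
move=> gV.
have mV : measurable_fun setT V.
  exact (measurableT_comp measurable_triple
    (measurable_fun_pair measurable_XWpair (measurable_funPT Z))).
have := cond_prob_version_ge mV measurable_bnd bnd0 gV matching_bound_integral.
apply: filterS => w; apply: le_trans.
by apply: (matching_bound_le hq).
Qed.
End communication.

(** * Rate of convergence *)

Lemma mu'_rate {R : realType} {d : measure_display} {T : measurableType d}
    (nu : {measure set T -> \bar R}) (q p : T -> R) (om : R) :
  (forall y, 0 <= q y) -> (forall y, 0 <= p y) -> 0 <= om ->
  (d2 nu q p < +oo)%E ->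
  mu' nu q p om @ \oo --> 0%E /\
  (fun N => fine (mu' nu q p om N) : R^o) =O_\oo (fun N => N%:R^-1 : R^o).
Proof.
move=> q0 p0 om0 dfin; have d0 := d2_ge0 nu q0 p0.
have [r dE] : exists r, d2 nu q p = r%:E.
  by move: d0 dfin; case: (d2 _ _ _) => // r _ _; exists r.
have r0 : 0 <= r by rewrite -lee_fin -dE.
(* For N >= 3 one has [II] = 2 and 1 / (N - 1) <= 1, so that mu' is at most K / N. *)
pose K := om + om * 2 * r + om ^+ 2 * r.
have muE N : mu' nu q p om N = (fine (mu' nu q p om N))%:E.
  by rewrite (mu'_fin _ _ dE).
have f0 N : 0 <= fine (mu' nu q p om N) by exact/fine_ge0/mu'_ge0.
have K0 : 0 <= K by rewrite !addr_ge0 ?mulr_ge0 ?exprn_ge0.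
have le : \forall N \near \oo, fine (mu' nu q p om N) <= K * N%:R^-1.
  exists 3%N => // N /= N3; rewrite (mu'_fin _ _ dE)/= mulrC.
  apply: ler_wpM2r; first by rewrite invr_ge0.
  apply: lerD; first (rewrite lerD2l; apply: ler_wpM2r => //; apply: ler_wpM2l => //).
    by rewrite /II N3 gtn_eqF// mulr0 addr0 mulr1.
  apply: ler_wpM2r => //; apply: ler_piMr; first exact: exprn_ge0.
  by rewrite invf_le1 ?ltr0n ?ler1n; case: N N3 => [|[]].
split; last first.
  apply/eqOP; exists K; split; first exact: num_real.
  move=> k Kk; near=> N.
  rewrite !ger0_norm ?invr_ge0//; apply: (@le_trans _ _ (K * N%:R^-1)).
    by near: N.
  by apply: ler_wpM2r; [rewrite invr_ge0|exact: ltW].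
rewrite (_ : mu' nu q p om = fun N => (fine (mu' nu q p om N))%:E); last exact/funext.
apply: cvg_EFin; first exact: nearW.
apply: (@squeeze_cvgr _ _ _ _ (cst 0) (fun N => K * N%:R^-1)).
- by near=> N; rewrite f0/=; near: N.
- exact: cvg_cst.
- rewrite -[X in _ --> X](mulr0 K); apply: cvgMl_tmp.
  by rewrite -cvg_shiftS; exact: cvg_harmonic.
Unshelve. all: by end_near. Qed.

Theorem proposition5p4 (R : realType) (dX dY dZ : measure_display)
  (TX : measurableType dX) (TY : measurableType dY) (TZ : measurableType dZ)
  (nu : {sigma_finite_measure set TY -> \bar R})
  (* Q_Y, P_{Y|X}, tilde P_{Y|Z}, P_{Z|X,Y} *)
  (q : TY -> R) (pYX : TX -> TY -> R) (ptYZ : TZ -> TY -> R)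
  (PZXY : R.-pker (TX * TY)%type ~> TZ)
  (omega : TX -> R)
  (* makes {Y_A = Y_B} an event; automatic on a standard Borel space *)
  (hdiag : measurable [set u : TY * TY | u.1 = u.2])
  (hq : prob_density nu q)
  (hpYX : cond_density nu pYX)
  (hptYZ : cond_density nu ptYZ)
  (homegaA : forall x y, (dratio (pYX x) q y <= (omega x)%:E)%E)
  (homegaB : forall x z y, (dratio (ptYZ z) q y <= (omega x)%:E)%E)
  (* makes Y_A and Y_B random variables *)
  (hmeasA : measurable_fun setT (fun x => omegaP (pYX x) q))
  (hmeasB : measurable_fun setT (fun z => omegaP (ptYZ z) q)) :
  (forall n : nat, (2 <= n.+1)%N ->
   forall (d : measure_display) (Omega : measurableType d)
     (P : probability Omega R)
     (X : {RV P >-> TX}) (Z : {RV P >-> TZ})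
     (Y : nat -> 'I_n.+1 -> {RV P >-> TY})
     (S : nat -> 'I_n.+1 -> {RV P >-> R})
     (U : nat -> {RV P >-> R}),
   let W := W_of Y S U in
   let YA := fun w => ERS_sample (W w) (pYX (X w)) q in
   let YB := fun w => ERS_sample (W w) (ptYZ (Z w)) q in
   common_randomness nu q Y S U ->
   indep_of_W X Y S U ->
   generated_from PZXY X YA Z Y S U ->
   forall g : TY * TX * TZ -> R,
   cond_prob_version P [set w | YA w = YB w]
     (fun w => (YA w, X w, Z w)) g ->
   {ae P, forall w,
     (matching_bound nu q (pYX (X w)) (ptYZ (Z w)) (omega (X w)) n.+1 (YA w)
      <= (g (YA w, X w, Z w))%:E)%E})
  /\
  (forall x z,
   (d2 nu q (pYX x) < +oo)%E -> (d2 nu q (ptYZ z) < +oo)%E ->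
   let mu1 := mu' nu q (ptYZ z) (omega x) in
   let mu2 := mu' nu q (pYX x) (omega x) in
   [/\ mu1 @ \oo --> 0%E, mu2 @ \oo --> 0%E,
       (fun N => fine (mu1 N) : R^o) =O_\oo (fun N => N%:R^-1 : R^o) &
       (fun N => fine (mu2 N) : R^o) =O_\oo (fun N => N%:R^-1 : R^o)]).
Proof.
have q0 y : 0 <= q y by case: hq.
have pA0 x y : 0 <= pYX x y by case: hpYX => _ /(_ x)[].
have pB0 z y : 0 <= ptYZ z y by case: hptYZ => _ /(_ z)[].
split=> [n n1 d Omega P X Z Y S U W YA YB crW XW genZ g gV|x z dA dB mu1 mu2].
  exact: (conditional_matching_bound hdiag hq hpYX hptYZ homegaA homegaB
    hmeasA hmeasB n1 crW XW genZ gV).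
have om0 : 0 <= omega x.
  by rewrite -lee_fin (le_trans _ (homegaA x point))// dratio_ge0.
have [cvg1 rate1] := mu'_rate q0 (pB0 z) om0 dB.
have [cvg2 rate2] := mu'_rate q0 (pA0 x) om0 dA.
exact: And4 cvg1 cvg2 rate1 rate2.
Qed.
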